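(* The system $\varphi(x),\varphi(2x),\varphi(3x),\ldots$ is a Riesz basis in $L^2(0,1)$ if and only if both $S\varphi$ and $1/S\varphi$ belong to $\mathcal{M}$.
   Context: $\varphi\in L^2(0,1)$ is given, and is extended to the whole real line as an odd periodic function of period 2. Write $\varphi(x)=\sum_{n=1}^\infty a_n\sqrt2\sin(n\pi x)$ for its sine expansion on $(0,1)$; it is normalized by $a_1=1$. Its associated Dirichlet series is $S\varphi(s)=\sum_{n=1}^\infty a_n n^{-s}$, which is analytic on $\Re s>\frac12$. The reciprocal $1/S\varphi$ is given by a Dirichlet series $\sum_n b_n n^{-s}$ (with $b_1=1$ and $\sum_{d\mid n}b_d a_{n/d}=0$ for $n>1$) convergent in some right half-plane. $\mathcal{H}$ is the Hilbert space of Dirichlet series $f(s)=\sum_{n=1}^\infty c_n n^{-s}$ with $\|f\|_{\mathcal{H}}^2=\sum_n|c_n|^2<+\infty$, regarded as analytic functions on $\Re s>\frac12$; $\mathcal{M}$ is the set of multipliers of $\mathcal{H}$, i.e. holomorphic functions $m$ on $\Re s>\frac12$ with $mf\in\mathcal{H}$ for all $f\in\mathcal{H}$. A sequence $\{f_n\}_n$ in a separable Hilbert space is a Riesz basis if for some bounded invertible operator $L$ on the space, $\{Lf_n\}_n$ is an orthonormal basis. *)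

(* Defs.v *)
From HB Require Import structures.
From mathcomp Require Import all_boot all_order all_algebra.
From mathcomp Require Import generic_quotient ring_quotient.
From mathcomp Require Import all_classical all_reals all_analysis measurable_realfun.
From mathcomp Require Import zify ring lra.
From mathcomp.real_closed Require Import complex.
Set Implicit Arguments.
Unset Strict Implicit.
Unset Printing Implicit Defensive.
Import Order.TTheory GRing.Theory Num.Theory numFieldNormedType.Exports.
Local Open Scope classical_set_scope.
Local Open Scope ring_scope.
Local Open Scope complex_scope.
Local Open Scope quotient_scope.
Local Notation Re := complex.Re.
Local Notation Im := complex.Im.

Definition sqmod {R : realType} (z : R[i]) : R := Re z ^+ 2 + Im z ^+ 2.

Section L2.
Context {R : realType}.
Local Notation C := R[i].
Local Notation mu := (@lebesgue_measure R).
Local Notation D := (`]0, 1[%classic : set (measurableTypeR R)).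

Lemma sqmod_ge0 (z : C) : 0 <= sqmod z.
Proof. by rewrite addr_ge0 ?sqr_ge0. Qed.

Lemma sqmodD (z w : C) : sqmod (z + w) <= 2 * sqmod z + 2 * sqmod w.
Proof.
case: z w => [a b] [c d]; rewrite /sqmod /= -subr_ge0.
suff -> : 2 * (a ^+ 2 + b ^+ 2) + 2 * (c ^+ 2 + d ^+ 2) -
    ((a + c) ^+ 2 + (b + d) ^+ 2) = (a - c) ^+ 2 + (b - d) ^+ 2.
  by rewrite addr_ge0 ?sqr_ge0.
ring.
Qed.

Lemma sqmodM (z w : C) : sqmod (z * w) = sqmod z * sqmod w.
Proof. by case: z w => [a b] [c d]; rewrite /sqmod /=; ring. Qed.

Definition cmeasurable_fun (A : set (measurableTypeR R)) (f : R -> C) : Prop :=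
  measurable_fun A (fun x => Re (f x)) /\ measurable_fun A (fun x => Im (f x)).

(* The values of [f] outside (0,1) are irrelevant. *)
Definition sq_integrable (f : R -> C) : Prop :=
  cmeasurable_fun D f /\ (\int[mu]_(x in D) (sqmod (f x))%:E < +oo)%E.

Lemma measurable_sqmod A (f : R -> C) : cmeasurable_fun A f ->
  measurable_fun A (fun x => sqmod (f x)).
Proof. by case=> mr mi; apply: measurable_funD; apply: measurable_funX. Qed.

Lemma cmeasurable_lin A (a : C) (f g : R -> C) :
  cmeasurable_fun A f -> cmeasurable_fun A g ->
  cmeasurable_fun A (fun x => a * f x + g x).
Proof.
case: a => [a b] [fr fi] [gr gi]; split.
- have -> : (fun x => Re ((a +i* b) * f x + g x)) =
      (fun x => a * Re (f x) - b * Im (f x) + Re (g x)).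
    by apply/funext => x; case: (f x) (g x) => [? ?] [].
  apply: measurable_funD => //; apply: measurable_funB;
    exact: measurable_funM.
- have -> : (fun x => Im ((a +i* b) * f x + g x)) =
      (fun x => a * Im (f x) + b * Re (f x) + Im (g x)).
    by apply/funext => x; case: (f x) (g x) => [? ?] [].
  apply: measurable_funD => //; apply: measurable_funD;
    exact: measurable_funM.
Qed.

Lemma sq_integrable_lin (a : C) (f g : R -> C) :
  sq_integrable f -> sq_integrable g -> sq_integrable (fun x => a * f x + g x).
Proof.
move=> [mf If] [mg Ig]; have mh := cmeasurable_lin a mf mg; split=> //.
have mE u : cmeasurable_fun D u ->
    measurable_fun D (fun x => (sqmod (u x))%:E).
  by move=> mu'; apply/measurable_EFinP; exact: measurable_sqmod.
have mD : measurable D by exact: measurable_itv.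
apply: (@le_lt_trans _ _ (\int[mu]_(x in D)
   ((2 * sqmod a)%:E * (sqmod (f x))%:E + 2%:E * (sqmod (g x))%:E))%E).
  apply: ge0_le_integral => //=.
  - by move=> x _; rewrite lee_fin sqmod_ge0.
  - exact: mE.
  - by apply: emeasurable_funD; apply: measurable_funeM; apply: mE.
  - move=> x _; rewrite -!EFinM -EFinD lee_fin.
    by rewrite (le_trans (sqmodD _ _))// sqmodM mulrA.
have s0 (z : C) : (0 <= (sqmod z)%:E)%E by rewrite lee_fin sqmod_ge0.
rewrite ge0_integralD//; first last.
- by apply: measurable_funeM; exact: mE.
- by move=> x _; rewrite mule_ge0.
- by apply: measurable_funeM; exact: mE.
- by move=> x _; rewrite mule_ge0// lee_fin mulr_ge0// sqmod_ge0.
rewrite !ge0_integralZl_EFin//; [|exact: mE|exact: mE|].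
  by rewrite lte_add_pinfty// lte_mul_pinfty// ?lee_fin ?mulr_ge0 ?sqmod_ge0.
by rewrite mulr_ge0// sqmod_ge0.
Qed.

Definition sq_int : {pred R -> C} := mem [set f | sq_integrable f].

Lemma sq_int_submod_closed : submod_closed sq_int.
Proof.
split.
  apply/mem_set; split; first by split; exact: measurable_cst.
  under eq_integral do rewrite /sqmod /= expr0n /= addr0.
  by rewrite integral0.
move=> a f g /set_mem hf /set_mem hg; apply/mem_set.
exact: sq_integrable_lin.
Qed.

HB.instance Definition _ := GRing.isSubmodClosed.Build C (R -> C) sq_int
  sq_int_submod_closed.

Record L2fun := MkL2fun {L2val :> R -> C; _ : L2val \in sq_int}.
HB.instance Definition _ := [isSub for L2val].
HB.instance Definition _ := [Choice of L2fun by <:].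
HB.instance Definition _ := [SubChoice_isSubLmodule of L2fun by <:].

Definition L2null : {pred L2fun} :=
  mem [set f : L2fun | ae_eq mu D f (fun=> 0)].

Lemma L2null_submod_closed : submod_closed L2null.
Proof.
split; first by apply/mem_set; exact: ae_eq_refl.
move=> a f g /set_mem /= hf /set_mem /= hg; apply/mem_set => /=.
apply: filterS2 hf hg => x hf hg Dx.
by rewrite /= /GRing.add /GRing.scale /= hf// hg// /GRing.scale/= mulr0 addr0.
Qed.

HB.instance Definition _ := GRing.isSubmodClosed.Build C L2fun L2null
  L2null_submod_closed.

(* classes of square integrable functions modulo a.e. equality on (0,1) *)
Definition L2 : Type := Quotient.quot L2null.
HB.instance Definition _ := GRing.Zmodule.on L2.
HB.instance Definition _ : EqQuotient L2fun (Quotient.equiv L2null) L2 :=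
  EqQuotient.on L2.

Definition L2scale (a : C) : L2 -> L2 := lift_op1 L2 ( *:%R a).

Lemma L2eqE (f g : L2fun) : (f == g %[mod L2]) = (f - g \in L2null).
Proof. exact/esym/Quotient.idealrBE. Qed.

Lemma pi_L2scale a : {morph \pi_L2 : f / a *: f >-> L2scale a f}.
Proof.
move=> f; rewrite /L2scale; unlock; apply/eqP.
by rewrite L2eqE -scalerBr rpredZ// -L2eqE reprK.
Qed.

Lemma pi_L2D : {morph \pi_L2 : f g / f + g}.
Proof. exact: Quotient.pi_add. Qed.

Lemma L2scaleA a b v : L2scale a (L2scale b v) = L2scale (a * b) v.
Proof. by elim/quotW: v => f; rewrite -!pi_L2scale scalerA. Qed.
Lemma L2scale1 : left_id 1 L2scale.
Proof. by elim/quotW => f; rewrite -!pi_L2scale scale1r. Qed.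
Lemma L2scaleDr : right_distributive L2scale +%R.
Proof.
move=> a; elim/quotW => f; elim/quotW => g.
by rewrite -pi_L2D -!pi_L2scale -pi_L2D scalerDr.
Qed.
Lemma L2scaleDl v : {morph L2scale^~ v : a b / a + b}.
Proof. by elim/quotW: v => f a b; rewrite -!pi_L2scale -pi_L2D scalerDl. Qed.

HB.instance Definition _ := GRing.Zmodule_isLmodule.Build C L2
  L2scaleA L2scale1 L2scaleDr L2scaleDl.

(* The odd 2-periodic extension of [f] restricted to (0,1); it vanishes at the
   integers.  For x = k + t with k an integer and 0 < t < 1, it takes the value
   f t when k is even, and - f (1 - t) when k is odd; see [odd_ext_id],
   [odd_extD2] and [odd_extN], which characterize it. *)
Definition odd_ext (f : R -> C) (x : R) : C :=
  let k := Num.floor x in let t := x - k%:~R in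
  if t == 0 then 0 else if odd `|k|%N then - f (1 - t) else f t.

Lemma odd_ext_id f x : 0 < x < 1 -> odd_ext f x = f x.
Proof.
move=> /andP[x0 x1]; have k0 : Num.floor x = 0.
  by apply/floor_def; rewrite (ltW x0) add0r.
by rewrite /odd_ext k0 subr0 gt_eqF.
Qed.

Lemma odd_extD2 f x : odd_ext f (x + 2) = odd_ext f x.
Proof.
have k2 : Num.floor (x + 2) = Num.floor x + 2.
  by rewrite -[2 in LHS]/(2%:~R) floorDrz ?intr_int// intrKfloor.
rewrite /odd_ext k2 intrD (_ : x + 2 - _ = x - (Num.floor x)%:~R); last by ring.
suff -> : odd `|(Num.floor x + 2)%R|%N = odd `|Num.floor x|%N by [].
by move: (Num.floor x) => k; lia.
Qed.

Lemma odd_extN f x : odd_ext f (- x) = - odd_ext f x.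
Proof.
rewrite /odd_ext; set k := Num.floor x.
have [xk|xk] := eqVneq x k%:~R.
  have -> : Num.floor (- x) = - k by rewrite [in LHS]xk -mulrNz intrKfloor.
  by rewrite mulrNz -xk opprK addNr subrr eqxx oppr0.
have /andP[k1 k2] := floor_itv x; rewrite -/k in k1 k2.
have kx : k%:~R < x by rewrite lt_neqAle k1 eq_sym xk.
have Nk : Num.floor (- x) = - k - 1.
  apply/floor_def; move: k2 kx; rewrite !rmorphD !rmorphN /= => k2 kx.
  by apply/andP; split; lra.
rewrite Nk; have -> : - x - (- k - 1)%:~R = 1 - (x - k%:~R).
  by rewrite rmorphD !rmorphN /=; ring.
have -> : (1 - (x - k%:~R) == 0) = false.
  apply/negbTE; move: k2; rewrite rmorphD /= => k2; apply/eqP => h; lra.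
have -> : (x - k%:~R == 0) = false by rewrite subr_eq0 (negbTE xk).
have -> : odd `|(- k - 1)%R|%N = ~~ odd `|k|%N by lia.
have -> : 1 - (1 - (x - k%:~R)) = x - k%:~R by ring.
by case: (odd _) => /=; rewrite ?opprK.
Qed.



Let cut (f : R -> C) (x : R) : C := if 0 < x < 1 then f x else 0.

Let DE (x : R) : (x \in (D : set R)) = (0 < x < 1).
Proof. by apply/idP/idP => [/set_mem|h]; [|apply/mem_set]; rewrite /= in_itv. Qed.

Section affine.
Variables (a b : R).
Hypothesis a0 : a != 0.
Let T (x : measurableTypeR R) : measurableTypeR R := a * x + b.

Let mT : measurable_fun setT T.
Proof. by apply: measurable_funD => //; apply: measurable_funM. Qed.

Let pT : {measure set (measurableTypeR R) -> \bar R} :=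
  measure_function_pushforward__canonical__measure_function_Measure mu mT.
Let na : 0 <= `|a|. Proof. by []. Qed.
Let nu : {measure set (measurableTypeR R) -> \bar R} :=
  mscale (NngNum na) pT.

Let muE (A : set (measurableTypeR R)) : measurable A -> mu A = nu A.
Proof.
apply: lebesgue_measure_unique => _ [[c d]] _ <-.
rewrite /nu /= /mscale /= /pushforward.
have [a_gt0|a_le0] := ltP 0 a.
  have -> : T @^-1` `]c, d] = `](c - b) / a, (d - b) / a]%classic.
    apply/seteqP; split=> x /=; rewrite !in_itv/= /T ltr_pdivrMr//
      ler_pdivlMr// (mulrC x) ltrBlDr lerBrDr//.
  rewrite !lebesgue_measure_itv /= !lte_fin ltr_pM2r ?invr_gt0// ltrD2r.
  case: ifP => _; last by rewrite mule0.
  rewrite -!EFinB -EFinM gtr0_norm//; congr (_%:E).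
  by field.
have a_lt0 : a < 0 by rewrite lt_neqAle a0.
have -> : T @^-1` `]c, d] = `[(d - b) / a, (c - b) / a[%classic.
  apply/seteqP; split=> x /=; rewrite !in_itv/= /T ltr_ndivlMr//
    ler_ndivrMr// (mulrC x) ltrBlDr lerBrDr// andbC//.
rewrite !lebesgue_measure_itv /= !lte_fin ltr_nM2r ?invr_lt0// ltrD2r.
case: ifP => _; last by rewrite mule0.
rewrite -!EFinB -EFinM ltr0_norm//; congr (_%:E).
by field.
Qed.

Lemma ge0_integral_affine (h : R -> \bar R) :
  measurable_fun [set: measurableTypeR R] h -> (forall x, 0 <= h x)%E ->
  (\int[mu]_x h x = `|a|%:E * \int[mu]_x h (a * x + b)%R)%E.
Proof.
move=> mh h0; rewrite (@eq_measure_integral _ _ _ _ nu); last first.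
  by move=> A mA _; exact: muE.
by rewrite ge0_integral_mscale//= ge0_integral_pushforward// preimage_setT.
Qed.

Lemma cmeasurable_affine (f : R -> C) :
  cmeasurable_fun setT f -> cmeasurable_fun setT (fun x => f (a * x + b)).
Proof. by case=> mr mi; split; [move: mr|move: mi]; move/measurableT_comp; apply. Qed.

Lemma sq_integrable_affine (f : R -> C) :
  sq_integrable f -> sq_integrable (fun x => cut f (a * x + b)).
Proof.
move=> [[mr mi] If].
have mf : cmeasurable_fun setT (cut f).
  have mD : measurable D by exact: measurable_itv.
  split.
    have -> : (fun x => Re (cut f x)) = (fun x => Re (f x)) \_ D.
      by apply/funext => x; rewrite patchE DE /cut; case: ifP.
    exact/(measurable_restrictT _ mD).
  have -> : (fun x => Im (cut f x)) = (fun x => Im (f x)) \_ D.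
    by apply/funext => x; rewrite patchE DE /cut; case: ifP.
  exact/(measurable_restrictT _ mD).
have mg := cmeasurable_affine mf.
split; first by case: mg => mr' mi'; split; exact: measurable_funTS.
have mh : measurable_fun [set: measurableTypeR R]
    (fun x => (sqmod (cut f x))%:E).
  by apply/measurable_EFinP; exact: measurable_sqmod.
have h0 x : (0 <= (sqmod (cut f x))%:E)%E by rewrite lee_fin sqmod_ge0.
have := ge0_integral_affine mh h0.
have -> : (\int[mu]_x (sqmod (cut f x))%:E
    = \int[mu]_(x in D) (sqmod (f x))%:E)%E.
  rewrite [RHS]integral_mkcond; apply: eq_integral => x _.
  rewrite patchE DE /cut; case: ifP => // _.
  by rewrite /sqmod /= expr0n /= addr0.
move=> E; move: If; rewrite E => {E}.
have pa : (0 < `|a|%:E :> \bar R)%E by rewrite lte_fin normr_gt0.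
set I := (\int[mu]_x _)%E => If.
have {If} : (I < +oo)%E.
  rewrite ltey; apply/eqP => Iy; move: If; rewrite Iy.
  by rewrite gt0_muley// ltxx.
move=> Ilt; apply: (le_lt_trans _ Ilt).
apply: (@ge0_subset_integral _ _ _ mu D setT) => //=.
by apply/measurable_EFinP; exact: measurable_sqmod.
Qed.

End affine.

Lemma dilateE (f : R -> C) n x : 0 < x < 1 -> odd_ext f (n%:R * x) =
  \sum_(k < n) (if odd k then - cut f (- n%:R * x + k.+1%:R)
                else cut f (n%:R * x + - k%:R)).
Proof.
move=> /andP[x0 x1]; set y := n%:R * x.
have y0 : 0 <= y by rewrite mulr_ge0// ltW.
have /andP[k1 k2] := floor_itv y; rewrite /odd_ext.
have fl0 : 0 <= Num.floor y by rewrite floor_ge0.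
case: (Num.floor y) fl0 k1 k2 => // k _; rewrite rmorphD /= -pmulrn => k1 k2.
under eq_bigr do rewrite mulNr -/y.
have cut0 (t : R) : ~~ (0 < t < 1) -> cut f t = 0 by rewrite /cut => /negbTE ->.
have [yk|yk] := eqVneq y k%:R.
  rewrite yk subrr eqxx big1// => i _.
  have [ik|ki] := ltnP i k.
    have ik' : i.+1%:R <= k%:R :> R by rewrite ler_nat.
    rewrite -[i.+1%:R]natr1 in ik' *.
    by case: ifP => _; rewrite cut0 ?oppr0//; apply/negP => /andP[]; lra.
  have ki' : k%:R <= i%:R :> R by rewrite ler_nat.
  by case: ifP => _; rewrite cut0 ?oppr0// -?natr1; apply/negP => /andP[]; lra.
have kn : (k < n)%N.
  rewrite -(ltr_nat R); apply: (le_lt_trans k1); rewrite /y gtr_pMr// ltr0n.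
  case: (n) @y y0 k1 k2 yk => // y _ + _.
  rewrite /y mul0r => k0; rewrite eq_sym; move: k0.
  by rewrite (_ : 0 = 0%:R)// ler_nat leqn0 => /eqP ->; rewrite eqxx.
rewrite subr_eq0 (negbTE yk) (bigD1 (Ordinal kn))//= big1 ?addr0; last first.
  move=> i /eqP ik.
  have [ik'|ki|ik'] := ltngtP i k; last by case: ik; exact: val_inj.
    have h : i.+1%:R <= k%:R :> R by rewrite ler_nat.
    rewrite -[i.+1%:R]natr1 in h *.
    by case: ifP => _; rewrite cut0 ?oppr0//; apply/negP => /andP[]; lra.
  have h : k.+1%:R <= i%:R :> R by rewrite ler_nat.
  rewrite -[k.+1%:R]natr1 in h.
  by case: ifP => _; rewrite cut0 ?oppr0// -?natr1; apply/negP => /andP[]; lra.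
have ky : k%:R < y by rewrite lt_neqAle k1 eq_sym yk.
rewrite /cut -[k.+1%:R]natr1; case: ifP => _.
  rewrite (_ : - y + _ = 1 - (y - k%:R)); last by ring.
  by rewrite ifT//; apply/andP; split; lra.
by rewrite ifT//; apply/andP; split; lra.
Qed.

Lemma sq_int_dilate (f : R -> C) n : sq_integrable f ->
  sq_integrable (fun x => odd_ext f (n%:R * x)).
Proof.
move=> hf; have [->|n0] := eqVneq n 0%N.
  have -> : (fun x : R => odd_ext f (0%:R * x)) = 0.
    apply/funext => x; rewrite mul0r /odd_ext.
    by rewrite -(_ : 0%:~R = 0 :> R)// intrKfloor subrr eqxx.
  exact: (set_mem (rpred0 sq_int)).
have nR : n%:R != 0 :> R by rewrite pnatr_eq0.
have : (\sum_(k < n) (fun x : R => if odd k then - cut f (- n%:R * x + k.+1%:R)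
                else cut f (n%:R * x + - k%:R))) \in sq_int.
  apply: rpred_sum => k _; case: (odd k); last exact/mem_set/sq_integrable_affine.
  rewrite (_ : (fun x => _) = - (fun x => cut f (- n%:R * x + k.+1%:R)))//.
  rewrite rpredN; apply/mem_set/sq_integrable_affine => //.
  by rewrite oppr_eq0.
move/set_mem; set g := \sum_(k < n) _.
have fg x : 0 < x < 1 -> odd_ext f (n%:R * x) = g x.
  by move=> x01; rewrite dilateE// /g fct_sumE.
have fgD A x : x \in (D : set R) -> A (odd_ext f (n%:R * x)) = A (g x) :> R.
  by rewrite DE => /fg ->.
case=> [[mr mi] Ig]; split; first split.
- by apply: eq_measurable_fun mr => x xD; rewrite fgD.
- by apply: eq_measurable_fun mi => x xD; rewrite fgD.
- move: Ig; congr (_ < +oo)%E; apply: eq_integral => x xD.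
  by rewrite (fgD sqmod).
Qed.


Definition dilate (f : L2fun) (n : nat) : L2fun :=
  MkL2fun (mem_set (sq_int_dilate n (set_mem (valP f)))).

Definition Cintegral (f : R -> C) : C :=
  (\int[mu]_(x in D) Re (f x))%R +i* (\int[mu]_(x in D) Im (f x))%R.

Definition L2dot (u v : L2) : C :=
  Cintegral (fun x => repr u x * conjc (repr v x)).

Lemma L2dot_pi (f g : L2fun) :
  L2dot (\pi f) (\pi g) = Cintegral (fun x => f x * conjc (g x)).
Proof.
have mE (h k : L2fun) : cmeasurable_fun D (fun x => h x * conjc (k x)).
  have [[hr hi] _] := set_mem (valP h); have [[kr ki] _] := set_mem (valP k).
  split.
    have -> : (fun x => Re (h x * conjc (k x))) =
        (fun x => Re (h x) * Re (k x) + Im (h x) * Im (k x)).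
      by apply/funext => x; case: (h x) (k x) => [? ?] [? ?] /=; ring.
    by apply: measurable_funD; apply: measurable_funM.
  have -> : (fun x => Im (h x * conjc (k x))) =
      (fun x => Im (h x) * Re (k x) - Re (h x) * Im (k x)).
    by apply/funext => x; case: (h x) (k x) => [? ?] [? ?] /=; ring.
  by apply: measurable_funB; apply: measurable_funM.
have ae (h : L2fun) : ae_eq mu D (repr (\pi_L2 h)) h.
  have : repr (\pi_L2 h) - h \in L2null by rewrite -L2eqE reprK.
  move/set_mem => /=; apply: filterS => x hx Dx; apply/eqP.
  by rewrite -subr_eq0; apply/eqP; exact: hx.
have aeP : ae_eq mu D (fun x => repr (\pi_L2 f) x * conjc (repr (\pi_L2 g) x))
    (fun x => f x * conjc (g x)).
  by apply: filterS2 (ae f) (ae g) => x hf hg Dx; rewrite hf// hg.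
have mD : measurable D by exact: measurable_itv.
have [mr mi] := mE (repr (\pi_L2 f)) (repr (\pi_L2 g)).
have [mr' mi'] := mE f g.
by congr (_ +i* _); rewrite /Rintegral; congr fine; apply: ae_eq_integral => //;
  try (by apply/measurable_EFinP); apply: filterS aeP => x hx Dx;
  rewrite /= hx.
Qed.

Definition sine_coef (f : R -> C) (n : nat) : C :=
  Cintegral (fun x => f x * (Num.sqrt 2 * sin (n%:R * pi * x))%:C).

End L2.

Arguments L2fun R : clear implicits.
Arguments L2 R : clear implicits.

(* Notions for a complex inner product space [V]; [dot] is linear in its first
   argument and conjugate-linear in the second. *)
Section riesz_basis.
Context {R : realType} {V : lmodType R[i]} (dot : V -> V -> R[i]).

Definition hnorm (v : V) : R := Num.sqrt (Re (dot v v)).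

Definition bounded_operator (L : V -> V) : Prop :=
  exists M : R, forall v, hnorm (L v) <= M * hnorm v.

Definition bounded_invertible (L : {linear V -> V}) : Prop :=
  bounded_operator L /\
  exists K : {linear V -> V}, [/\ bounded_operator K, cancel L K & cancel K L].

Definition orthonormal_basis (e : nat -> V) : Prop :=
  (forall i j, dot (e i) (e j) = (i == j)%:R) /\
  (forall (v : V) (eps : R), 0 < eps ->
     exists (n : nat) (c : nat -> R[i]),
       hnorm (v - \sum_(i < n) c i *: e i) < eps).

Definition riesz_basis (f : nat -> V) : Prop :=
  exists2 L : {linear V -> V},
    bounded_invertible L & orthonormal_basis (fun n => L (f n)).

End riesz_basis.

Section dirichlet.
Context {R : realType}.
Local Notation C := R[i].

Definition cexp (z : C) : C := (expR (Re z))%:C * (cos (Im z) +i* sin (Im z)).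

(* [npow n s] is $n^{-s}$, for [0 < n] *)
Definition npow (n : nat) (s : C) : C := cexp (- s * (ln n%:R)%:C).

(* Sequences of coefficients are indexed from 1: [c 0] is never used.  The
   regular algebra [C^o] carries the topology of the complex plane. *)
Definition dirichlet_series (c : nat -> C) (s : C) : C :=
  limn (fun N => \sum_(1 <= n < N) c n * npow n s : C^o).

Definition sq_summable (c : nat -> C) : Prop :=
  (\sum_(1 <= n <oo) (sqmod (c n))%:E < +oo)%E.

Definition half_plane : set C := [set s | 2^-1 < Re s].

(* Functions are total: only their values on the half-plane matter in the
   following three definitions. *)
Definition dirichlet_space : set (C -> C) :=
  [set f | exists2 c, sq_summable c &
     forall s, half_plane s -> f s = dirichlet_series c s].

(* differentiability over the field [C] *)
Definition holomorphic (m : C -> C) : Prop :=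
  forall s, half_plane s -> derivable (m : C^o -> C^o) s 1.

Definition multipliers : set (C -> C) :=
  [set m | holomorphic m /\
     forall f, dirichlet_space f -> dirichlet_space (fun s => m s * f s)].

End dirichlet.

(* Main.v *)
From HB Require Import structures.
Require Import Defs.
From mathcomp Require Import all_boot all_order all_algebra.
From mathcomp Require Import generic_quotient.
From mathcomp Require Import all_classical all_reals all_analysis measurable_realfun.
From mathcomp Require Import zify ring lra.
From mathcomp.real_closed Require Import complex.
Set Implicit Arguments.
Unset Strict Implicit.
Unset Printing Implicit Defensive.
Import Order.TTheory GRing.Theory Num.Theory numFieldNormedType.Exports.
Local Open Scope classical_set_scope.
Local Open Scope ring_scope.
Local Open Scope complex_scope.
Local Open Scope quotient_scope.
Local Notation Re := complex.Re.
Local Notation Im := complex.Im.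

(** Write hat v for the sequence of sine coefficients of v, and a for that of
    phi.  The sine functions form an orthonormal basis of L2(0,1), so that hat is
    an isometry onto the square summable sequences, indexed from 1; the latter are
    the coefficients of the functions of the Hilbert space of Dirichlet series.
    The dilate phi(n x) has the coefficient a (m / n) at the multiples m of n and
    0 elsewhere (hat_dilate).  Under this identification it is the Dirichlet
    series of n^-s Sphi(s), the image of the basis vector n^-s under the
    multiplication by Sphi.  The dilates form a Riesz basis exactly when this
    multiplication is bounded and invertible.  On coefficients, it is the
    Dirichlet convolution by a (dirichlet_mul, dirichlet_inj).

    Suppose that the dilates form a Riesz basis (riesz_bounds,
    riesz_multipliers).  Bessel's inequality bounds the convolution by a.
    Expanding a vector in the Riesz basis shows that this convolution is onto.
    In particular some square summable b satisfies b * a = 1, its Dirichlet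
    series is the reciprocal of Sphi, which therefore has no zero, and dividing
    by Sphi amounts to solving an equation d * a = c.  Holomorphy holds for all
    Dirichlet series with square summable coefficients (dirichlet_holomorphic).

    Conversely, suppose that Sphi and 1/Sphi are multipliers
    (multipliers_riesz).  Applied to the constant function 1, the second
    hypothesis gives a Dirichlet series for 1/Sphi, with coefficients b
    (reciprocal_series).  The convolutions by a and by b preserve square
    summability; being given by triangular matrices they are bounded
    (local_operator_bounded).  By the Riesz-Fischer theorem they are the actions
    on coefficients of two bounded operators of L2(0,1), inverse to each other,
    and the convolution by b sends the dilates to the sine functions.

    The sine system is complete (sine_complete_real) because a function
    orthogonal to the sines is orthogonal to sin(pi x) p(cos(pi x)) for every
    polynomial p, and suitable p(cos(pi x)) converge boundedly to the indicators
    of the intervals (b, 1).  Every square summable sequence is a sequence of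
    coefficients (riesz_fischer) because some subsequence of the partial sums
    converges almost everywhere. *)

(** * Inner products and the space L2(0,1) *)

Section squared_modulus.
Context {R : realType}.
Implicit Types z : R[i].

Lemma sqmod0 : sqmod (0 : R[i]) = 0.
Proof. by rewrite /sqmod /= expr0n addr0. Qed.

Lemma sqmod1 : sqmod (1 : R[i]) = 1.
Proof. by rewrite /sqmod /= expr0n expr1n addr0. Qed.

Lemma sqmod_real (x : R) : sqmod x%:C = x ^+ 2.
Proof. by rewrite /sqmod /= expr0n addr0. Qed.

Lemma sqmodN z : sqmod (- z) = sqmod z.
Proof. by case: z => a b; rewrite /sqmod /= !sqrrN. Qed.

Lemma sqmod_eq0 z : sqmod z = 0 -> z = 0.
Proof.
case: z => a b; rewrite /sqmod /= => /eqP.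
by rewrite paddr_eq0 ?sqr_ge0// !sqrf_eq0 => /andP[/eqP -> /eqP ->].
Qed.

End squared_modulus.

Section partial_sums.
Context {R : realType}.

Lemma partial_sum_mono k (w : nat -> R) : (forall n, 0 <= w n) ->
  {homo (fun N => \sum_(k <= n < N) w n) : m n / (m <= n)%N >-> m <= n}.
Proof.
move=> w0 m n; elim: n => [|n IH]; first by rewrite leqn0 => /eqP ->.
rewrite leq_eqVlt => /predU1P[->//|]; rewrite ltnS => /IH mn.
apply: (le_trans mn); have [kn|nk] := leqP k n.
  by rewrite [leRHS]big_nat_recr//= lerDl.
by rewrite !big_geq// ltnW.
Qed.

Lemma monotone_tail (u : nat -> R) (M e : R) : 0 < e ->
  {homo u : m n / (m <= n)%N >-> m <= n} -> (forall n, u n <= M) ->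
  exists N, forall n m, (N <= n)%N -> u m - u n <= e.
Proof.
move=> e0 um uM.
have hs : has_sup (range u) by split; [exists (u 0%N); exists 0%N|exists M => _ [n _ <-]].
have [_ [N _ <-] uN] := sup_adherent e0 hs.
exists N => n m Nn; have h1 := um _ _ Nn.
have h2 : u m <= sup (range u) by apply: sup_ubound; [exact: hs.2|exists m].
lra.
Qed.

End partial_sums.

Section abstract_inner_product.
Context {R : realType} {V : lmodType R[i]} (dot : V -> V -> R[i]).
Hypothesis dot_linl : forall a u v w, dot (a *: u + v) w = a * dot u w + dot v w.
Hypothesis dotC : forall u v, dot v u = conjc (dot u v).
Hypothesis dot_ge0 : forall v, 0 <= Re (dot v v).

Lemma dot0l w : dot 0 w = 0.
Proof. by have := dot_linl (-1) 0 0 w; rewrite scaler0 add0r mulN1r addNr. Qed.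

Lemma dotDl u v w : dot (u + v) w = dot u w + dot v w.
Proof. by rewrite -[u in LHS]scale1r dot_linl mul1r. Qed.

Lemma dotZl a u w : dot (a *: u) w = a * dot u w.
Proof. by rewrite -[_ *: u]addr0 dot_linl dot0l addr0. Qed.

Lemma dotNl u w : dot (- u) w = - dot u w.
Proof. by rewrite -scaleN1r dotZl mulN1r. Qed.

Lemma dotBl u v w : dot (u - v) w = dot u w - dot v w.
Proof. by rewrite dotDl dotNl. Qed.

Lemma dot_suml I (r : seq I) (P : pred I) (F : I -> V) w :
  dot (\sum_(i <- r | P i) F i) w = \sum_(i <- r | P i) dot (F i) w.
Proof. by elim/big_rec2: _ => [|i y x _ <-]; rewrite ?dot0l// dotDl. Qed.

(** Squared norms are used throughout: every estimate below is quadratic, and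
    square roots only appear in the interface with hnorm. *)
Definition nrm2 v : R := Re (dot v v).

Lemma hnormE v : hnorm dot v = Num.sqrt (nrm2 v). Proof. by []. Qed.

Lemma nrm2_ge0 v : 0 <= nrm2 v. Proof. exact: dot_ge0. Qed.

Lemma nrm2D u v : nrm2 (u + v) = nrm2 u + nrm2 v + 2 * Re (dot u v).
Proof.
rewrite /nrm2 dotDl (dotC (u + v)) dotDl (dotC (u + v) v) dotDl !rmorphD /=.
rewrite -!dotC (dotC u v).
by case: (dot u u) (dot v v) (dot u v) => [? ?] [? ?] [? ?] /=; ring.
Qed.

Lemma nrm2Z a v : nrm2 (a *: v) = sqmod a * nrm2 v.
Proof.
rewrite /nrm2 dotZl (dotC (a *: v)) dotZl rmorphM /= -dotC.
have := dotC v v; case: (dot v v) => [x y] [] xy; case: a => a b.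
have -> : y = 0 by lra.
by rewrite /sqmod /=; ring.
Qed.

Lemma nrm2N v : nrm2 (- v) = nrm2 v.
Proof.
by rewrite -scaleN1r nrm2Z sqmodN sqmod1 mul1r.
Qed.

Definition orthonormal_seq (g : nat -> V) := forall i j, dot (g i) (g j) = (i == j)%:R.

Section orthonormal_family.
Variable g : nat -> V.
Hypothesis og : orthonormal_seq g.

Lemma dot_combination n (c : nat -> R[i]) k : (k < n)%N ->
  dot (\sum_(i < n) c i *: g i) (g k) = c k.
Proof.
move=> kn; rewrite dot_suml (bigD1 (Ordinal kn)) //= big1 ?addr0.
  by rewrite dotZl og eqxx mulr1.
by move=> i ik; rewrite dotZl og (negbTE (_ : nat_of_ord i != k)) ?mulr0.
Qed.

(** The identity behind Bessel's inequality, the isometry of orthonormal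
    combinations, and the optimality of the coefficients <v, g i>: each of them
    is read off from a particular choice of c or v. *)
Lemma nrm2_sub_combination v n (c : nat -> R[i]) :
  nrm2 (v - \sum_(i < n) c i *: g i) =
  nrm2 v + \sum_(i < n) sqmod (dot v (g i) - c i) - \sum_(i < n) sqmod (dot v (g i)).
Proof.
elim: n => [|n IH]; first by rewrite !big_ord0 !subr0 addr0.
rewrite !big_ord_recr /= opprD addrA nrm2D IH nrm2N nrm2Z.
have -> : nrm2 (g n) = 1 by rewrite /nrm2 og eqxx.
have -> : dot (v - \sum_(i < n) c i *: g i) (- (c n *: g n)) =
    - conjc (c n) * dot v (g n).
  rewrite dotC dotNl dotZl rmorphN rmorphM /= -dotC mulNr.
  rewrite dotBl dot_suml big1 ?subr0// => i _.
  by rewrite dotZl og (negbTE (_ : nat_of_ord i != n)) ?mulr0// ltn_eqF.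
case: (c n) (dot v (g n)) => a b [x y]; rewrite /sqmod /=; ring.
Qed.

Lemma bessel v n : \sum_(i < n) sqmod (dot v (g i)) <= nrm2 v.
Proof.
have := nrm2_sub_combination v n (fun i => dot v (g i)).
rewrite [X in nrm2 v + X - _]big1 ?addr0 => [E|i _].
  by rewrite -subr_ge0 -E nrm2_ge0.
by rewrite subrr sqmod0.
Qed.

Lemma nrm2_combination n (c : nat -> R[i]) :
  nrm2 (\sum_(i < n) c i *: g i) = \sum_(i < n) sqmod (c i).
Proof.
have := nrm2_sub_combination 0 n c; rewrite sub0r nrm2N => ->.
rewrite /nrm2 dot0l /= add0r [X in _ - X]big1 ?subr0 => [|i _].
  by apply: eq_bigr => i _; rewrite dot0l sub0r sqmodN.
by rewrite dot0l sqmod0.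
Qed.

End orthonormal_family.
End abstract_inner_product.

Section L2_inner_product.
Context {R : realType}.
Local Notation C := R[i].
Local Notation mu := (@lebesgue_measure R).
Local Notation D := (`]0, 1[%classic : set (measurableTypeR R)).
Implicit Types f g : L2fun R.

Definition cintegrable (h : R -> C) : Prop :=
  mu.-integrable D (EFin \o (fun x => Re (h x))) /\
  mu.-integrable D (EFin \o (fun x => Im (h x))).

Let mD : measurable D. Proof. exact: measurable_itv. Qed.

Lemma Cintegral_lin a h k : cintegrable h -> cintegrable k ->
  Cintegral (fun x => a * h x + k x) = a * Cintegral h + Cintegral k.
Proof.
move=> [hr hi] [kr ki]; case: a => a b.
have Z c h' : mu.-integrable D (EFin \o h') ->
    mu.-integrable D (EFin \o (fun x => c * h' x)).
  by move=> /(integrableZl mD c); exact.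
have E p q r s t u : mu.-integrable D (EFin \o p) ->
    mu.-integrable D (EFin \o q) -> mu.-integrable D (EFin \o r) ->
    \int[mu]_(x in D) (s * p x + (t * q x + u * r x)) =
    s * (\int[mu]_(x in D) p x) + (t * (\int[mu]_(x in D) q x) +
    u * (\int[mu]_(x in D) r x)) :> R.
  move=> ip iq ir; rewrite RintegralD//; [|exact: Z|]; last first.
    by have := integrableD mD (Z t _ iq) (Z u _ ir); exact.
  by rewrite RintegralD//; [|exact: Z|exact: Z]; rewrite !RintegralZl.
rewrite /Cintegral /=; congr Complex.
  under eq_Rintegral => x _.
    have -> : Re ((a +i* b) * h x + k x) =
      a * Re (h x) + ((- b) * Im (h x) + 1 * Re (k x)).
      by case: (h x) (k x) => ? ? [? ?] /=; ring.
    over.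
  by rewrite E// mul1r addrA mulNr.
under eq_Rintegral => x _.
  have -> : Im ((a +i* b) * h x + k x) =
      a * Im (h x) + (b * Re (h x) + 1 * Im (k x)).
    by case: (h x) (k x) => ? ? [? ?] /=; ring.
  over.
by rewrite E// mul1r addrA.
Qed.

Lemma sqmod_integrable f : mu.-integrable D (EFin \o (fun x => sqmod (f x))).
Proof.
have [mf If] := set_mem (valP f).
apply/integrableP; split.
  by apply/measurable_EFinP; exact: measurable_sqmod.
apply: le_lt_trans If; rewrite le_eqVlt; apply/orP; left; apply/eqP.
by apply: eq_integral => x _ /=; rewrite ger0_norm// sqmod_ge0.
Qed.

(** The product is dominated by |f|^2 + |g|^2. *)
Lemma cintegrable_mulJ f g : cintegrable (fun x => f x * conjc (g x)).
Proof.
have [[fr fi] _] := set_mem (valP f); have [[gr gi] _] := set_mem (valP g).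
have dom (h : R -> R) : measurable_fun D h ->
    (forall x, `|h x| <= sqmod (f x) + sqmod (g x)) ->
    mu.-integrable D (EFin \o h).
  move=> mh hle; apply: (@le_integrable _ _ _ mu D mD _
    (EFin \o (fun x => sqmod (f x) + sqmod (g x)))).
  - exact/measurable_EFinP.
  - move=> x _ /=; rewrite lee_fin [leRHS]ger0_norm//.
    by rewrite addr_ge0 ?sqmod_ge0.
  - by have := integrableD mD (sqmod_integrable f) (sqmod_integrable g); exact.
have b2 (p q r s : R) : `|p * r + q * s| <= (p^+2 + q^+2) + (r^+2 + s^+2).
  rewrite ler_norml; apply/andP; split; rewrite -subr_ge0.
    rewrite (_ : _ - _ = ((p + r)^+2 + (q + s)^+2 + p^+2+q^+2+r^+2+s^+2) / 2).
      by rewrite divr_ge0// !addr_ge0 ?sqr_ge0.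
    by field.
  rewrite (_ : _ - _ = ((p - r)^+2 + (q - s)^+2 + p^+2+q^+2+r^+2+s^+2) / 2).
    by rewrite divr_ge0// !addr_ge0 ?sqr_ge0.
  by field.
split; apply: dom.
- have -> : (fun x => Re (f x * conjc (g x))) =
      (fun x => Re (f x) * Re (g x) + Im (f x) * Im (g x)).
    by apply/funext => x; case: (f x) (g x) => [? ?] [? ?] /=; ring.
  by apply: measurable_funD; apply: measurable_funM.
- move=> x; case: (f x) (g x) => [p q] [r s]; rewrite /sqmod /=.
  by rewrite (_ : _ - _ = p * r + q * s)//; ring.
- have -> : (fun x => Im (f x * conjc (g x))) =
      (fun x => Im (f x) * Re (g x) - Re (f x) * Im (g x)).
    by apply/funext => x; case: (f x) (g x) => [? ?] [? ?] /=; ring.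
  by apply: measurable_funB; apply: measurable_funM.
- move=> x; case: (f x) (g x) => [p q] [r s]; rewrite /sqmod /=.
  by rewrite (le_trans (b2 _ _ _ _))// sqrrN (addrC (s ^+ 2)).
Qed.

Lemma L2dot_linl a (u v w : L2 R) :
  L2dot (a *: u + v) w = a * L2dot u w + L2dot v w.
Proof.
elim/quotW: u => f; elim/quotW: v => g; elim/quotW: w => h.
pose F : L2fun R := a *: f + g.
have -> : a *: (\pi_(L2 R) f) + \pi_(L2 R) g = \pi_(L2 R) F.
  by rewrite pi_L2D pi_L2scale.
rewrite !L2dot_pi -Cintegral_lin; try exact: cintegrable_mulJ.
congr Cintegral; apply/funext => x.
by rewrite mulrA -mulrDl.
Qed.

Lemma L2dotC (u v : L2 R) : L2dot v u = conjc (L2dot u v).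
Proof.
elim/quotW: u => f; elim/quotW: v => g; rewrite !L2dot_pi /Cintegral /=.
have [_ ii] := cintegrable_mulJ f g.
congr Complex.
  by apply: eq_Rintegral => x _; case: (f x) (g x) => ? ? [? ?] /=; ring.
rewrite -mulN1r -RintegralZl//; apply: eq_Rintegral => x _.
by case: (f x) (g x) => ? ? [? ?] /=; ring.
Qed.

Lemma nrm2_pi f : nrm2 L2dot (\pi_(L2 R) f) = \int[mu]_(x in D) sqmod (f x).
Proof.
rewrite /nrm2 L2dot_pi /=; apply: eq_Rintegral => x _.
by case: (f x) => ? ?; rewrite /sqmod /=; ring.
Qed.

Lemma nrm2_piE f :
  (nrm2 L2dot (\pi_(L2 R) f))%:E = (\int[mu]_(x in D) (sqmod (f x))%:E)%E.
Proof.
rewrite nrm2_pi fineK//.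
exact: (integrable_fin_num mD (sqmod_integrable f)).
Qed.

Lemma L2dot_ge0 (v : L2 R) : 0 <= Re (L2dot v v).
Proof.
elim/quotW: v => f; rewrite -/(nrm2 L2dot _) nrm2_pi.
by apply: Rintegral_ge0 => x _; exact: sqmod_ge0.
Qed.

Lemma pi_L2Z a f : \pi_(L2 R) (a *: f) = a *: \pi_(L2 R) f.
Proof. by rewrite pi_L2scale. Qed.

Lemma pi_L20 : \pi_(L2 R) 0 = 0.
Proof. by rewrite -(scale0r 0) pi_L2Z scale0r. Qed.

Lemma pi_L2B f g : \pi_(L2 R) (f - g) = \pi_(L2 R) f - \pi_(L2 R) g.
Proof. by rewrite pi_L2D -scaleN1r pi_L2Z scaleN1r. Qed.

Lemma pi_L2_eq0 f : ae_eq mu D f (fun=> 0) -> \pi_(L2 R) f = 0.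
Proof. by move=> f0; rewrite -pi_L20; apply/eqP; rewrite L2eqE subr0; apply/mem_set. Qed.

End L2_inner_product.

(** * The sine system *)

Section sines.
Context {R : realType}.
Local Notation C := R[i].
Local Notation mu := (@lebesgue_measure R).
Local Notation D := (`]0, 1[%classic : set (measurableTypeR R)).
Let mD : measurable D. Proof. exact: measurable_itv. Qed.

Lemma sin_natpi k : sin (k%:R * pi) = 0 :> R.
Proof.
elim: k => [|k IH]; first by rewrite mul0r sin0.
by rewrite -natr1 mulrDl mul1r sinDpi IH oppr0.
Qed.

Lemma integrable_mul_bounded (M : R) (f g : R -> R) :
  mu.-integrable D (EFin \o f) ->
  measurable_fun D g -> (forall x, `|g x| <= M) ->
  mu.-integrable D (EFin \o (fun x => f x * g x)).
Proof.
move=> fi mg gM.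
have M0 : 0 <= M by apply: le_trans (gM 0).
have mf : measurable_fun D f by apply/measurable_EFinP; exact: measurable_int fi.
apply: (@le_integrable _ _ _ mu D mD _ (EFin \o (fun x => M * f x))).
- by apply/measurable_EFinP; apply: measurable_funM.
- move=> x _ /=; rewrite lee_fin !normrM mulrC ler_wpM2r//.
  by rewrite (le_trans (gM x))// ler_norm.
- by have := integrableZl mD M fi; exact.
Qed.

Lemma integrable_cst01 (c : R) : mu.-integrable D (EFin \o (fun=> c)).
Proof.
apply: measurable_bounded_integrable => //.
  by rewrite /= lebesgue_measure_itv /= lte_fin ltr01 ltry.
by exists `|c|; split; rewrite ?num_real// => x xc y _ /=; exact: ltW.
Qed.

Lemma integrable_bounded (M : R) (g : R -> R) : measurable_fun D g ->
  (forall x, `|g x| <= M) -> mu.-integrable D (EFin \o g).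
Proof.
move=> mg gM; have := integrable_mul_bounded (integrable_cst01 1) mg gM.
by under [X in _ \o X]eq_fun do rewrite mul1r.
Qed.

Lemma measurable_sin_mul (c : R) : measurable_fun D (fun x : R => sin (c * x)).
Proof.
apply: measurable_funTS; apply: (measurableT_comp (f := @sin R) (g := fun x => c * x)).
  by apply: continuous_measurable_fun; exact: continuous_sin.
exact: measurable_funM.
Qed.

Lemma measurable_cos_mul (c : R) : measurable_fun D (fun x : R => cos (c * x)).
Proof.
apply: measurable_funTS; apply: (measurableT_comp (f := @cos R) (g := fun x => c * x)).
  by apply: continuous_measurable_fun; exact: continuous_cos.
exact: measurable_funM.
Qed.

Lemma integral_cos_natpi k : (0 < k)%N ->
  \int[mu]_(x in D) cos (k%:R * pi * x) = 0 :> R.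
Proof.
move=> k0; pose w : R := k%:R * pi.
have w0 : w != 0 by rewrite mulf_neq0 ?pnatr_eq0 -?lt0n// gt_eqF// pi_gt0.
have ci : mu.-integrable D (EFin \o (fun x : R => cos (w * x))).
  by apply: (@integrable_bounded 1) => [|x]; [exact: measurable_cos_mul|exact: cos_max].
have cw : continuous (fun x : R => w * x : R).
  exact: mulrl_continuous.
have dF (x : R) : is_derive x (1 : R) (fun x : R => w^-1 * sin (w * x)) (cos (w * x)).
  have h1 : is_derive x (1 : R) (fun x : R => w * x) w.
    have := @is_deriveZ _ _ _ id w x (1 : R) (1 : R) (is_derive_id _ _).
    by rewrite /GRing.scale /= mulr1.
  have h2 := is_derive1_comp (is_derive_sin (w * x)) h1.
  have := @is_deriveZ _ _ _ _ w^-1 x (1 : R) _ h2.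
  by rewrite /GRing.scale /= mulrC -mulrA mulfV// mulr1.
have cF (x : R) : {for x, continuous (fun x : R => w^-1 * sin (w * x))}.
  apply: differentiable_continuous; apply/derivable1_diffP.
  by case: (dF x).
rewrite Rintegral_itv_obnd_cbnd//.
rewrite Rintegral_itv_bndo_bndc; last first.
  apply: (@integrableS _ _ _ mu `[0, 1]%classic) => //.
  - by move=> x /=; rewrite !in_itv /= => /andP[-> /ltW].
  - apply: continuous_compact_integrable; first exact: segment_compact.
    apply: continuous_subspaceT => x.
    by apply: continuous_comp; [exact: cw|exact: continuous_cos].
rewrite /Rintegral (@continuous_FTC2 _ _ (fun x : R => w^-1 * sin (w * x)))//.
- by rewrite mulr1 mulr0 /w sin_natpi sin0 !mulr0 -EFinB subrr.
- apply: continuous_subspaceT => x.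
  by apply: continuous_comp; [exact: cw|exact: continuous_cos].
- split => [x _||]; first by case: (dF x).
    exact/cvg_at_right_filter/cF.
  exact/cvg_at_left_filter/cF.
- move=> x _; rewrite derive1E; exact: (@derive_val _ _ _ _ _ _ _ (dF x)).
Qed.

(** The product of two sines is a difference of cosines, and cosines of nonzero
    integral frequency have zero mean. *)
Lemma integral_sin_sin n m : (0 < n)%N -> (0 < m)%N ->
  \int[mu]_(x in D) ((Num.sqrt 2 * sin (n%:R * pi * x)) *
     (Num.sqrt 2 * sin (m%:R * pi * x))) = (n == m)%:R :> R.
Proof.
wlog nm : n m / (n <= m)%N => [hw n0 m0|n0 m0].
  have [nm|/ltnW nm] := leqP n m; first exact: hw.
  rewrite eq_sym -hw//; apply: eq_Rintegral => x _; exact: mulrC.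
have ci k : mu.-integrable D (EFin \o (fun x : R => cos (k%:R * pi * x))).
  by apply: (@integrable_bounded 1) => [|x]; [exact: measurable_cos_mul|exact: cos_max].
under eq_Rintegral => x _.
  have -> : Num.sqrt 2 * sin (n%:R * pi * x) * (Num.sqrt 2 * sin (m%:R * pi * x))
      = cos ((m - n)%:R * pi * x) - cos ((m + n)%:R * pi * x) :> R.
    rewrite natrB// natrD !mulrDl !mulNr !cosD sinN cosN.
    rewrite mulrACA -expr2 sqr_sqrtr//; ring.
  over.
rewrite RintegralB// (@integral_cos_natpi (m + n)) ?addn_gt0 ?n0 ?orbT// subr0.
have [->|nm'] := eqVneq n m; last by rewrite integral_cos_natpi// subn_gt0 ltn_neqAle nm'.
under eq_Rintegral do rewrite subnn !mul0r cos0.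
rewrite Rintegral_cst// /= lebesgue_measure_itv /= lte_fin ltr01 oppr0 adde0 /= mul1r//.
Qed.

Definition sine (n : nat) (x : R) : R := Num.sqrt 2 * sin (n%:R * pi * x).

Lemma sine_le2 n x : `|sine n x| <= Num.sqrt 2.
Proof.
by rewrite /sine normrM ger0_norm ?sqrtr_ge0// ler_piMr ?sqrtr_ge0// sin_max.
Qed.

Lemma measurable_sine n : measurable_fun D (sine n).
Proof. by apply: measurable_funM => //; exact: measurable_sin_mul. Qed.

Lemma sine_sq_int n : (fun x => (sine n x)%:C) \in @sq_int R.
Proof.
apply/mem_set; split; first by split => //; exact: measurable_sine.
apply: (@le_lt_trans _ _ (\int[mu]_(x in D) 2%:E)%E).
  apply: ge0_le_integral => //.
  - by move=> x _; rewrite lee_fin sqmod_ge0.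
  - apply/measurable_EFinP; apply: measurable_sqmod; split => //.
    exact: measurable_sine.
  - move=> x _; rewrite lee_fin sqmod_real -real_normK ?num_real//.
    rewrite -[leRHS](@sqr_sqrtr _ 2)// ler_pXn2r ?nnegrE ?sqrtr_ge0//.
    exact: sine_le2.
by rewrite integral_cst//= lebesgue_measure_itv /= lte_fin ltr01 oppr0 adde0 mule1 ltry.
Qed.

Definition sineL n : L2fun R := MkL2fun (sine_sq_int n).

Definition esine n : L2 R := \pi_(L2 R) (sineL n).

(** The map hat is the isometry from L2(0,1) onto the square summable
    sequences on which the proof rests. *)
Definition hat (v : L2 R) (n : nat) : C := L2dot v (esine n).

Lemma hat_pi (f : L2fun R) n : hat (\pi_(L2 R) f) n = sine_coef f n.
Proof.
rewrite /hat L2dot_pi; congr Cintegral; apply/funext => x.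
by congr (_ * _); rewrite /= oppr0.
Qed.

Lemma pi_sine_combination N (c : nat -> C) :
  \pi_(L2 R) (\sum_(i < N) c i *: sineL i.+1) = \sum_(i < N) c i *: esine i.+1.
Proof.
elim: N => [|N IH]; first by rewrite !big_ord0 pi_L20.
by rewrite !big_ord_recr /= pi_L2D IH pi_L2Z.
Qed.

Lemma hat_esine n m : (0 < n)%N -> (0 < m)%N -> hat (esine n) m = (n == m)%:R.
Proof.
move=> n0 m0; rewrite /hat /esine L2dot_pi /Cintegral.
have -> : (n == m)%:R = ((n == m)%:R : R)%:C by rewrite rmorph_nat.
rewrite -(integral_sin_sin n0 m0); congr Complex.
  by apply: eq_Rintegral => x _ /=; rewrite mul0r subr0.
transitivity (\int[mu]_(x in D) (0 : R)).
  by apply: eq_Rintegral => x _ /=; rewrite mul0r oppr0 mulr0 addr0.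
by rewrite Rintegral_cst// mul0r.
Qed.

Lemma sine_orthonormal : orthonormal_seq L2dot (fun i => esine i.+1).
Proof. by move=> i j; rewrite -/(hat _ _) hat_esine. Qed.

End sines.

(** * Completeness of the sine system *)

Section step_polynomials.
Context {R : realType}.
Implicit Types (u y a t : R) (p : {poly R}).

Lemma bernoulli_ge u N : 0 <= u <= 1 -> 1 - N%:R * u <= (1 - u) ^+ N.
Proof.
move=> /andP[u0 u1]; elim: N => [|N IH]; first by rewrite mul0r subr0 expr0.
have u1' : 0 <= 1 - u by rewrite subr_ge0.
rewrite exprS; apply: le_trans (ler_wpM2l u1' IH); rewrite -subr_ge0 -natr1.
rewrite (_ : _ - _ = N%:R * u ^+ 2); last by ring.
by rewrite mulr_ge0// sqr_ge0.
Qed.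

Lemma onem_exp_le u N : 0 < u <= 1 -> (0 < N)%N -> (1 - u) ^+ N <= (N%:R * u)^-1.
Proof.
move=> /andP[u0 u1] N0; have Nu : 0 < N%:R * u by rewrite mulr_gt0// ltr0n.
have b (n : nat) : 1 + n%:R * u <= (1 + u) ^+ n.
  elim: n => [|n IH]; first by rewrite mul0r addr0 expr0.
  have u0' : 0 <= 1 + u by rewrite addr_ge0// ltW.
  rewrite exprS; apply: le_trans (ler_wpM2l u0' IH); rewrite -subr_ge0 -natr1.
  rewrite (_ : _ - _ = n%:R * u ^+ 2); last by ring.
  by rewrite mulr_ge0// sqr_ge0.
have p0 : 0 <= (1 - u) ^+ N by rewrite exprn_ge0// subr_ge0.
rewrite -(ler_pM2r Nu) mulVf ?gt_eqF//.
apply: (@le_trans _ _ ((1 - u) ^+ N * (1 + u) ^+ N)).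
  by rewrite ler_wpM2l// (le_trans _ (b N))// lerDr.
rewrite -exprMn exprn_ile1//.
  by rewrite mulr_ge0 ?subr_ge0// addr_ge0 ?ltW.
rewrite -subr_ge0 (_ : _ - _ = u ^+ 2); last by ring.
exact: sqr_ge0.
Qed.

Lemma onem_exp_itv y n : 0 <= y <= 1 -> 0 <= (1 - y ^+ n) ^+ (2 ^ n) <= 1.
Proof.
move=> /andP[y0 y1].
have h : 0 <= 1 - y ^+ n by rewrite subr_ge0 exprn_ile1.
by rewrite exprn_ge0//= exprn_ile1// gerBl exprn_ge0.
Qed.

Lemma step_cvg1 y : 0 <= y < 2^-1 -> (fun n => (1 - y ^+ n) ^+ (2 ^ n)) @ \oo --> (1 : R).
Proof.
move=> /andP[y0 y2].
have y1 : y <= 1 by rewrite (le_trans (ltW y2))// invf_le1// ler1n.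
apply: (@squeeze_cvgr _ _ _ _ (fun n => 1 - (2 * y) ^+ n) (fun=> 1)).
- apply: nearW => n; have /andP[_ ->] := @onem_exp_itv y n (introT andP (conj y0 y1)).
  rewrite andbT exprMn -natrX; apply: bernoulli_ge.
  by rewrite exprn_ge0//= exprn_ile1.
- rewrite -[X in _ --> X]subr0; apply: cvgB; first exact: cvg_cst.
  by apply: cvg_expr; rewrite ger0_norm ?mulr_ge0//; lra.
- exact: cvg_cst.
Qed.

Lemma step_cvg0 y : 2^-1 < y <= 1 -> (fun n => (1 - y ^+ n) ^+ (2 ^ n)) @ \oo --> (0 : R).
Proof.
move=> /andP[y2 y1].
have y0 : 0 < y by rewrite (lt_trans _ y2)// invr_gt0.
apply: (@squeeze_cvgr _ _ _ _ (fun=> 0) (fun n => (2 * y)^-1 ^+ n)).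
- apply: nearW => n.
  have /andP[-> _] := @onem_exp_itv y n (introT andP (conj (ltW y0) y1)).
  rewrite /= exprVn exprMn -natrX; apply: onem_exp_le; last by rewrite expn_gt0.
  by rewrite exprn_gt0//= exprn_ile1// ltW.
- exact: cvg_cst.
- apply: cvg_expr; rewrite ger0_norm ?invr_ge0 ?mulr_ge0 ?ltW//.
  by rewrite invf_lt1 ?mulr_gt0//; lra.
Qed.

(** With y = 1/2 + (t - a)/4, which lies in [0, 1] when t and a lie in [-1, 1],
    these are the polynomials (1 - y^n)^(2^n).  They take values in [0, 1] and
    tend to 1 where y < 1/2, that is t < a, and to 0 where t > a: Bernoulli's
    inequality bounds them below by 1 - (2y)^n and above by (2y)^-n. *)
Definition step_poly a n : {poly R} :=
  (1 - ((2^-1 - 4^-1 * a)%:P + 4^-1 *: 'X) ^+ n) ^+ (2 ^ n).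

Lemma step_polyE a n t :
  (step_poly a n).[t] = (1 - (2^-1 + (t - a) / 4) ^+ n) ^+ (2 ^ n).
Proof.
rewrite /step_poly !(horner_exp, hornerE).
by rewrite (_ : 2^-1 - 4^-1 * a + 4^-1 * t = 2^-1 + (t - a) / 4)//; ring.
Qed.

End step_polynomials.

Section sine_completeness.
Context {R : realType}.
Local Notation C := R[i].
Local Notation mu := (@lebesgue_measure R).
Local Notation D := (`]0, 1[%classic : set (measurableTypeR R)).
Let mD : measurable D. Proof. exact: measurable_itv. Qed.

Section vanishing_moments.
Variable f : R -> R.
Hypothesis fi : mu.-integrable D (EFin \o f).
Hypothesis f0 : forall k, \int[mu]_(x in D) (f x * sin (k%:R * pi * x)) = 0 :> R.

Let mcospoly (p : {poly R}) : measurable_fun D (fun x => p.[cos (pi * x)]) /\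
  exists M, forall x, `|p.[cos (pi * x)]| <= M.
Proof.
elim/poly_ind: p => [|p c [mp [M pM]]].
  split; last by exists 0 => x; rewrite horner0 normr0.
  rewrite (_ : (fun x => _) = cst 0); first exact: measurable_cst.
  by apply/funext => x; rewrite horner0.
split.
  rewrite (_ : (fun x => _) = fun x => p.[cos (pi * x)] * cos (pi * x) + c).
    2: by apply/funext => x; rewrite hornerMXaddC.
  by apply: measurable_funD => //; apply: measurable_funM => //; exact: measurable_cos_mul.
exists (M + `|c|) => x; rewrite hornerMXaddC (le_trans (ler_normD _ _))// lerD2r.
by rewrite normrM (le_trans _ (pM x))// ler_piMr// cos_max.
Qed.

Let mi (p : {poly R}) k : mu.-integrable D
  (EFin \o (fun x => f x * (sin (k%:R * pi * x) * p.[cos (pi * x)]))).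
Proof.
have [mp [M pM]] := mcospoly p.
apply: (@integrable_mul_bounded _ M) => //.
  by apply: measurable_funM => //; exact: measurable_sin_mul.
by move=> x; rewrite normrM (le_trans _ (pM x))// ler_piMl// sin_max.
Qed.

(** Since sin(k x) cos(x) is half the sum of sin((k+1) x) and sin((k-1) x), a
    function orthogonal to all sines is orthogonal to sin(k x) times any
    polynomial in cos(x). *)
Lemma sine_moments (p : {poly R}) k :
  \int[mu]_(x in D) (f x * (sin (k%:R * pi * x) * p.[cos (pi * x)])) = 0 :> R.
Proof.
elim/poly_ind: p k => [|p c IH] k.
  under eq_Rintegral do rewrite horner0 !mulr0.
  by rewrite Rintegral_cst// mul0r.
case: k => [|k].
  under eq_Rintegral do rewrite !mul0r sin0 mul0r mulr0.
  by rewrite Rintegral_cst// mul0r.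
have i1 k' : mu.-integrable D (EFin \o (fun x => 2^-1 * (f x * (sin (k'%:R * pi * x) * p.[cos (pi * x)])))).
  by have := integrableZl mD 2^-1 (mi p k'); exact.
have i2 : mu.-integrable D (EFin \o (fun x => c * (f x * sin (k.+1%:R * pi * x)))).
  have := integrableZl mD c (mi 1 k.+1); apply: eq_integrable => // x _ /=.
  by rewrite hornerC mulr1.
under eq_Rintegral => x _.
  have -> : f x * (sin (k.+1%:R * pi * x) * (p * 'X + c%:P).[cos (pi * x)]) =
     2^-1 * (f x * (sin (k.+2%:R * pi * x) * p.[cos (pi * x)])) +
     (2^-1 * (f x * (sin (k%:R * pi * x) * p.[cos (pi * x)])) +
     c * (f x * sin (k.+1%:R * pi * x))).
    rewrite hornerMXaddC -[k.+2%:R]natr1.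
    rewrite (_ : (k.+1%:R + 1) * pi * x = k.+1%:R * pi * x + pi * x); last by ring.
    rewrite (_ : k%:R * pi * x = k.+1%:R * pi * x - pi * x); last by rewrite -natr1; ring.
    by rewrite sinD sinB; field.
  over.
rewrite RintegralD//; last by have := integrableD mD (i1 k) i2; exact.
rewrite RintegralD// RintegralZl// IH RintegralZl// IH.
rewrite RintegralZl// ?f0 ?mulr0 ?addr0//.
by have := mi 1 k.+1; apply: eq_integrable => // x _ /=; rewrite hornerC mulr1.
Qed.

Let g x := f x * sin (pi * x).

Let gi : mu.-integrable D (EFin \o g).
Proof.
by have := mi 1 1; apply: eq_integrable => // x _ /=; rewrite hornerC mulr1 mul1r.
Qed.

Let g0 : \int[mu]_(x in D) g x = 0 :> R.
Proof. by rewrite -[RHS](f0 1); apply: eq_Rintegral => x _; rewrite mul1r. Qed.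

Let H (b x : R) : R := \1_(`]b, +oo[%classic : set R) x.

Let HE b x : H b x = (b < x)%R%:R.
Proof. by rewrite /H indicE mem_setE in_itv /= andbT. Qed.

Let mH b : measurable_fun D (H b).
Proof. by apply: measurable_indic; exact: measurable_itv. Qed.

Let mg : measurable_fun D g.
Proof. by apply/measurable_EFinP; exact: measurable_int gi. Qed.

(** On (0, 1) the condition x > b amounts to cos(pi x) < cos(pi b), so the step
    polynomials at cos(pi b) approximate the indicator of (b, 1) boundedly. *)
Lemma vanishing_tail (b : R) : 0 < b < 1 -> \int[mu]_(x in D) (g x * H b x) = 0 :> R.
Proof.
move=> /andP[b0 b1].
pose q n x := (step_poly (cos (pi * b)) n).[cos (pi * x)] : R.
pose y x : R := 2^-1 + (cos (pi * x) - cos (pi * b)) / 4.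
have y01 x : 0 <= y x <= 1.
  have := cos_max (pi * x); have := cos_max (pi * b).
  rewrite !ler_norml /y => /andP[? ?] /andP[? ?]; apply/andP; split; lra.
have q01 n x : 0 <= q n x <= 1.
  by rewrite /q step_polyE; exact: (onem_exp_itv n (y01 x)).
have qcvg x : D x -> x != b -> q ^~ x @ \oo --> H b x.
  rewrite /= in_itv /= => /andP[x0 x1] xb.
  have inpi z : 0 < z < 1 -> pi * z \in `[0, pi].
    move=> /andP[z0 z1]; rewrite in_itv /= mulr_ge0 ?pi_ge0 ?(ltW z0)//=.
    by rewrite ler_piMr ?pi_ge0// ltW.
  have cE u v : 0 < u < 1 -> 0 < v < 1 -> (cos (pi * u) < cos (pi * v)) = (v < u).
    by move=> u01 v01; rewrite ltr_cos ?inpi// ltr_pM2l ?pi_gt0.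
  rewrite (_ : q^~ x = fun n => (1 - y x ^+ n) ^+ (2 ^ n)); last first.
    by apply/funext => n; rewrite /q step_polyE.
  have /andP[y0 y1] := y01 x; rewrite HE.
  have [bx|xb'|] := ltgtP b x.
  - apply: step_cvg1; rewrite y0 /= /y.
    have : cos (pi * x) < cos (pi * b) by rewrite cE ?b0 ?x0.
    by move=> ?; lra.
  - apply: step_cvg0; rewrite y1 andbT /y.
    have : cos (pi * b) < cos (pi * x) by rewrite cE ?b0 ?x0.
    by move=> ?; lra.
  - by move=> bx; rewrite bx eqxx in xb.
have [] := @dominated_convergence _ _ _ mu D mD
  (fun n x => (g x * q n x)%:E) (fun x => (g x * H b x)%:E) (fun x => `|g x|%:E).
- move=> n; apply/measurable_EFinP; apply: measurable_funM => //.
  exact: (mcospoly _).1.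
- by apply/measurable_EFinP; exact: measurable_funM.
(* at x = b the step polynomials tend to 1/e instead of 0 *)
- exists [set b]; split => //; first exact: lebesgue_measure_set1.
  move=> x /= /not_implyP[Dx]; apply: contra_notP => /eqP xb.
  apply: cvg_EFin; first exact: nearW.
  apply: cvgM; first exact: cvg_cst.
  exact: qcvg.
- by have := integrable_abse gi; exact.
- apply: aeW => x n Dx; rewrite lee_fin normrM ler_piMr//.
  by have /andP[? ?] := q01 n x; rewrite ger0_norm.
move=> _ _ h.
have qi n : mu.-integrable D (EFin \o (fun x => g x * q n x)).
  have := mi (step_poly (cos (pi * b)) n) 1; apply: eq_integrable => // x _ /=.
  by rewrite mul1r mulrA.
have q0 n : (\int[mu]_(x in D) (g x * q n x)%:E = 0)%E.
  rewrite -[LHS]fineK; last exact: (integrable_fin_num mD (qi n)).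
  congr EFin; rewrite -[RHS](sine_moments (step_poly (cos (pi * b)) n) 1).
  by apply: eq_Rintegral => x _; rewrite mul1r mulrA.
move: h; rewrite (_ : (fun n => _) = fun=> 0%E); last by apply/funext => n; exact: q0.
by move=> h; rewrite /Rintegral -(cvg_lim _ h)// lim_cst.
Qed.

Lemma vanishing_primitive (b : R) : \int[mu]_(x in `]-oo, b]) (g \_ D) x = 0 :> R.
Proof.
have -> : \int[mu]_(x in `]-oo, b]) (g \_ D) x = \int[mu]_(x in D) (g x * (1 - H b x)).
  rewrite Rintegral_mkcond [RHS]Rintegral_mkcond; apply: eq_Rintegral => x _.
  rewrite !patchE HE mem_setE in_itv /= leNgt.
  by case: (x \in D); case: (b < x); rewrite ?subrr ?mulr0 ?subr0 ?mulr1.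
have gHi : mu.-integrable D (EFin \o (fun x => g x * H b x)).
  apply: (@integrable_mul_bounded _ 1) => // x.
  by rewrite HE; case: (b < x); rewrite ?normr1 ?normr0.
have -> : \int[mu]_(x in D) (g x * (1 - H b x)) =
    \int[mu]_(x in D) g x - \int[mu]_(x in D) (g x * H b x).
  by rewrite -RintegralB//; apply: eq_Rintegral => x _; rewrite mulrBr mulr1.
rewrite g0 sub0r; apply/eqP; rewrite oppr_eq0; apply/eqP.
have [b0|b0] := leP b 0.
  rewrite -[RHS]g0; apply: eq_Rintegral => x; rewrite inE /= in_itv /= => /andP[x0 x1].
  by rewrite HE (le_lt_trans b0 x0) mulr1.
have [b1|b1] := ltP b 1; first by apply: vanishing_tail; rewrite b0.
transitivity (\int[mu]_(x in D) (0 : R)); last by rewrite Rintegral_cst// mul0r.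
apply: eq_Rintegral => x; rewrite inE /= in_itv /= => /andP[x0 x1].
by rewrite HE ltNge (le_trans (ltW x1) b1) mulr0.
Qed.

(** The primitive of f(x) sin(pi x) vanishes identically, hence so does its
    derivative, which is f(x) sin(pi x) at almost every x by Lebesgue's
    differentiation theorem. *)
Lemma sine_complete_real : ae_eq mu D f (cst 0).
Proof.
have GI : mu.-integrable setT (EFin \o (g \_ D)).
  by rewrite -restrict_EFin; apply/(integrable_mkcond _ mD).
have := @FTC1Ny R (g \_ D); case.
- move=> y; apply: integrableS GI => //; exact: measurable_itv.
- by apply: open_integrable_locally => //; exact: openT.
move=> N [mN N0 sN]; exists N; split => // x xn; apply: sN => /= -[_].
rewrite derive1E (_ : (fun x => _) = cst 0); last first.
  by apply/funext => y; exact: vanishing_primitive.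
rewrite derive_cst patchE; move: xn => /= /not_implyP[Dx fx0].
rewrite mem_set// => /esym/eqP; rewrite mulf_eq0 => /orP[/eqP //|].
move: Dx; rewrite /= in_itv /= => /andP[x0 x1].
by rewrite gt_eqF// sin_gt0_pi// mulr_gt0 ?pi_gt0//= gtr_pMr ?pi_gt0.
Qed.

End vanishing_moments.
End sine_completeness.

(** * Limits of rapidly Cauchy sequences in L2(0,1) *)

Section riesz_fischer.
Context {R : realType}.
Local Notation C := R[i].
Local Notation mu := (@lebesgue_measure R).
Local Notation D := (`]0, 1[%classic : set (measurableTypeR R)).
Let mD : measurable D. Proof. exact: measurable_itv. Qed.

Lemma geometric_cvg (u : nat -> R) (M : R) :
  (forall k, `|u k.+1 - u k| <= M * 2^-1 ^+ k) -> cvgn u.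
Proof.
move=> hu; have M0 : 0 <= M by have := le_trans (normr_ge0 _) (hu 0%N); rewrite expr0 mulr1.
have : cvgn (series (telescope u)).
  apply: normed_cvg; apply: (@series_le_cvg _ _ (geometric M 2^-1)).
  - by move=> n /=.
  - by move=> n /=; rewrite mulr_ge0// exprn_ge0.
  - by move=> n; exact: hu.
  - by apply: is_cvg_geometric_series; rewrite ger0_norm// invf_lt1// ltr1n.
rewrite telescopeK => h.
have -> : u = (fun n => [sequence u n - u 0%N]_n n + u 0%N).
  by apply/funext => n /=; rewrite subrK.
by apply: is_cvgD => //; exact: is_cvg_cst.
Qed.

(** The weights 4^k turn square integrability of the increments into pointwise
    control: the sum H of the functions
    4^k |F (k+1) - F k|^2 has a finite integral, because their integrals are at
    most 4^k / 8^k.  Where H is finite the increments are O(2^-k) and F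
    converges.  Multiplication by the indicator of that set makes the
    convergence hold everywhere, which gives the measurability of the limit. *)
Section fast_cauchy.
Variable F : nat -> L2fun R.
Hypothesis fastF : forall k, nrm2 L2dot (\pi_(L2 R) (F k.+1 - F k)) <= 8^-1 ^+ k.

Let h (k : nat) (x : R) : \bar R := (4 ^+ k * sqmod (F k.+1 x - F k x))%:E.

Let H (x : R) : \bar R := (\sum_(0 <= k <oo) h k x)%E.

Let h0 k x : (0 <= h k x)%E.
Proof. by rewrite lee_fin mulr_ge0 ?exprn_ge0 ?sqmod_ge0. Qed.

Let mF k : cmeasurable_fun D (F k).
Proof. by have [] := set_mem (valP (F k)). Qed.

Let mdF k l : cmeasurable_fun D (fun x => F k x - F l x).
Proof. by have [] := set_mem (valP (F k - F l)). Qed.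

Let mh k : measurable_fun D (h k).
Proof.
apply/measurable_EFinP; apply: measurable_funM => //.
exact: measurable_sqmod.
Qed.

Let mH : measurable_fun D H.
Proof.
exact: (@ge0_emeasurable_sum _ _ _ _ h predT (fun k x _ _ => h0 k x) (fun k _ => mh k)).
Qed.

Let H_ge0 x : (0 <= H x)%E. Proof. exact: nneseries_ge0. Qed.

Let intH : (\int[mu]_(x in D) H x < +oo)%E.
Proof.
rewrite /H integral_nneseries//.
apply: (@le_lt_trans _ _ 2%:E); last exact: ltry.
apply: lime_le; first by apply: is_cvg_nneseries => n _ _; exact: integral_ge0.
apply: nearW => n.
apply: (@le_trans _ _ (\sum_(0 <= k < n) (2^-1 ^+ k)%:E)%E).
  apply: lee_sum => k _; rewrite /h.
  under eq_integral do rewrite EFinM.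
  rewrite ge0_integralZl_EFin//.
  - rewrite -(nrm2_piE (F k.+1 - F k)) -EFinM lee_fin.
    rewrite (le_trans (ler_wpM2l _ (fastF k))) ?exprn_ge0// -exprMn.
    by rewrite (_ : 4 * 8^-1 = 2^-1)//; field.
  - by move=> x _; rewrite lee_fin sqmod_ge0.
  - by apply/measurable_EFinP; exact: measurable_sqmod.
rewrite sumEFin lee_fin.
have -> : \sum_(0 <= k < n) 2^-1 ^+ k = 2 - 2 * 2^-1 ^+ n :> R.
  elim: n => [|n IH]; first by rewrite big_geq// expr0 mulr1 subrr.
  by rewrite big_nat_recr//= IH exprS; field.
by rewrite gerBl mulr_ge0// exprn_ge0.
Qed.

Let G := D `&` [set x | H x < +oo]%E.

Let mG : measurable G.
Proof. exact: emeasurable_fun_infty_o. Qed.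

Let aeG : {ae mu, forall x, D x -> G x}.
Proof.
have Hi : mu.-integrable D H.
  apply/integrableP; split => //.
  by under eq_integral do rewrite gee0_abs//.
have := integrable_ae mD Hi; apply: filterS => x hx Dx; split => //=.
by have := hx Dx; rewrite ge0_fin_numE.
Qed.

Let step_le x k : G x ->
  `|Re (F k.+1 x) - Re (F k x)| <= Num.sqrt (fine (H x)) * 2^-1 ^+ k /\
  `|Im (F k.+1 x) - Im (F k x)| <= Num.sqrt (fine (H x)) * 2^-1 ^+ k.
Proof.
move=> [Dx /= Hx].
have Hf : H x \is a fin_num by rewrite ge0_fin_numE.
have : (h k x <= H x)%E.
  apply: le_trans (nneseries_lim_ge k.+1 _) => //.
  by rewrite big_nat_recr//= leeDr// sume_ge0.
rewrite /h -[H x]fineK// lee_fin; set M := fine _ => hM.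
have p4 : 0 < 4 ^+ k :> R by rewrite exprn_gt0.
have {}hM : sqmod (F k.+1 x - F k x) <= (Num.sqrt M * 2^-1 ^+ k) ^+ 2.
  have M0 : 0 <= M by rewrite fine_ge0.
  rewrite exprMn sqr_sqrtr// -exprM mulnC exprM expr2 -invfM -natrM exprVn.
  by rewrite ler_pdivlMr// mulrC.
have s0 : 0 <= Num.sqrt M * 2^-1 ^+ k by rewrite mulr_ge0 ?sqrtr_ge0 ?exprn_ge0.
have sq (a : R) : a ^+ 2 <= (Num.sqrt M * 2^-1 ^+ k) ^+ 2 ->
    `|a| <= Num.sqrt M * 2^-1 ^+ k.
  by move=> ?; rewrite -ler_sqr ?nnegrE// real_normK ?num_real.
move: hM; case: (F k.+1 x) (F k x) => [a b] [c d]; rewrite /sqmod /= => hM.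
by split; apply: sq; apply: le_trans hM; rewrite ?lerDl ?lerDr sqr_ge0.
Qed.

Let wr x : R := limn (fun k => \1_G x * Re (F k x)).
Let wi x : R := limn (fun k => \1_G x * Im (F k x)).

Let wr_cvg x : (fun k => \1_G x * Re (F k x)) @ \oo --> wr x.
Proof.
have [Gx|nGx] := pselect (G x); last first.
  apply: cvgP; rewrite indicE memNset//=; under eq_fun do rewrite mul0r.
  exact: cvg_cst.
rewrite /wr indicE mem_set//=; under eq_fun do rewrite mul1r.
by apply: geometric_cvg => k; exact: (step_le _ Gx).1.
Qed.

Let wi_cvg x : (fun k => \1_G x * Im (F k x)) @ \oo --> wi x.
Proof.
have [Gx|nGx] := pselect (G x); last first.
  apply: cvgP; rewrite indicE memNset//=; under eq_fun do rewrite mul0r.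
  exact: cvg_cst.
rewrite /wi indicE mem_set//=; under eq_fun do rewrite mul1r.
by apply: geometric_cvg => k; exact: (step_le _ Gx).2.
Qed.

Let mw : cmeasurable_fun D (fun x => wr x +i* wi x).
Proof.
split => /=.
  apply: (@measurable_fun_cvg _ _ _ _ (fun k x => \1_G x * Re (F k x))) => [k|x _].
    by apply: measurable_funM; [exact: measurable_indic|exact: (mF k).1].
  exact: wr_cvg.
apply: (@measurable_fun_cvg _ _ _ _ (fun k x => \1_G x * Im (F k x))) => [k|x _].
  by apply: measurable_funM; [exact: measurable_indic|exact: (mF k).2].
exact: wi_cvg.
Qed.

Let FG k x : C := (\1_G x * Re (F k x)) +i* (\1_G x * Im (F k x)).

Let w_fatou N (B : R) :
  (forall k, (N <= k)%N -> nrm2 L2dot (\pi_(L2 R) (F k - F N)) <= B) ->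
  (\int[mu]_(x in D) (sqmod ((wr x +i* wi x) - F N x))%:E <= B%:E)%E.
Proof.
move=> hB; pose u k x := (sqmod (FG (k + N) x - F N x))%:E.
have mu_ k : measurable_fun D (u k).
  apply/measurable_EFinP; apply: measurable_sqmod.
  have [r i] := mF (k + N); have [r' i'] := mF N.
  have m1 : measurable_fun D (\1_G : _ -> R) by exact: measurable_indic.
  split.
    rewrite (_ : (fun x => _) = fun x => \1_G x * Re (F (k + N) x) - Re (F N x)).
      by apply: measurable_funB => //; exact: measurable_funM.
    by apply/funext => x; rewrite /FG; case: (F N x).
  rewrite (_ : (fun x => _) = fun x => \1_G x * Im (F (k + N) x) - Im (F N x)).
    by apply: measurable_funB => //; exact: measurable_funM.
  by apply/funext => x; rewrite /FG; case: (F N x).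
have u0 k x : (0 <= u k x)%E by rewrite lee_fin sqmod_ge0.
have := fatou mu mD mu_ (fun k x _ => u0 k x).
rewrite (_ : (\int[mu]_(x in D) _)%E =
    (\int[mu]_(x in D) (sqmod ((wr x +i* wi x) - F N x))%:E)%E); last first.
  apply: eq_integral => x _; apply: (cvg_limn_einf_sup _).1.
  apply: cvg_EFin; first exact: nearW.
  have -> : fine \o (u ^~ x) = fun k => (\1_G x * Re (F (k + N) x) - Re (F N x)) ^+ 2 +
     (\1_G x * Im (F (k + N) x) - Im (F N x)) ^+ 2.
    by apply/funext => k; rewrite /u /FG /=; case: (F N x).
  have -> : sqmod ((wr x +i* wi x) - F N x) = (wr x - Re (F N x)) ^+ 2 + (wi x - Im (F N x)) ^+ 2.
    by case: (F N x).
  have Hr : (fun k => \1_G x * Re (F (k + N) x)) @ \oo --> wr x.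
    by have := wr_cvg (x := x); rewrite -(cvg_shiftn N); exact.
  have Hi : (fun k => \1_G x * Im (F (k + N) x)) @ \oo --> wi x.
    by have := wi_cvg (x := x); rewrite -(cvg_shiftn N); exact.
  rewrite !expr2; under eq_fun do rewrite !expr2.
  by apply: cvgD; apply: cvgM; apply: cvgB => //; exact: cvg_cst.
move=> /le_trans; apply; rewrite limn_einf_lim.
apply: lime_le; first exact: is_cvg_einfs.
apply: nearW => n; apply: (@le_trans _ _ (\int[mu]_(x in D) u n x)%E).
  by apply: ereal_inf_lbound; exists n => //=.
apply: le_trans (_ : ((nrm2 L2dot (\pi_(L2 R) (F (n + N)%N - F N)))%:E <= _)%E); last first.
  by rewrite lee_fin hB// leq_addl.
rewrite nrm2_piE le_eqVlt; apply/orP; left; apply/eqP; apply: ge0_ae_eq_integral => //.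
- by apply/measurable_EFinP; apply: measurable_sqmod; exact: (mdF (n + N) N).
- by move=> x _; rewrite lee_fin sqmod_ge0.
- apply: filterS aeG => x Gx Dx; rewrite /u /FG indicE mem_set; last exact: Gx.
  have -> : (F (n + N)%N - F N) x = F (n + N)%N x - F N x by [].
  by rewrite /= !mul1r; case: (F (n + N)%N x).
Qed.

(** Fatou's lemma bounds the distance from the limit to F N by any bound on the
    distances from the later F k to F N. *)
Lemma fast_cauchy_limit (B : R) :
  (forall k, nrm2 L2dot (\pi_(L2 R) (F k - F 0%N)) <= B) ->
  exists w : L2fun R, forall N b,
    (forall k, (N <= k)%N -> nrm2 L2dot (\pi_(L2 R) (F k - F N)) <= b) ->
    nrm2 L2dot (\pi_(L2 R) (w - F N)) <= b.
Proof.
move=> hB.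
have wI : (fun x => wr x +i* wi x) \in @sq_int R.
  have -> : (fun x => wr x +i* wi x) =
      (fun x => 1 * ((wr x +i* wi x) - F 0%N x) + F 0%N x).
    by apply/funext => x; rewrite mul1r subrK.
  apply/mem_set; apply: sq_integrable_lin; last exact: set_mem (valP (F 0%N)).
  split; last by apply: le_lt_trans (w_fatou (fun k _ => hB k)) (ltry _).
  have := cmeasurable_lin (-1) (mF 0) mw.
  by under [X in cmeasurable_fun _ X]eq_fun do rewrite mulN1r addrC.
exists (MkL2fun wI) => N b hb.
by rewrite -lee_fin nrm2_piE; exact: w_fatou hb.
Qed.

End fast_cauchy.
End riesz_fischer.

(** * The Riesz-Fischer theorem *)

Section sine_basis.
Context {R : realType}.
Local Notation C := R[i].
Local Notation mu := (@lebesgue_measure R).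
Local Notation D := (`]0, 1[%classic : set (measurableTypeR R)).
Let mD : measurable D. Proof. exact: measurable_itv. Qed.

Local Notation linl := (@L2dot_linl R).
Local Notation dotC := (@L2dotC R).
Local Notation dot_ge0 := (@L2dot_ge0 R).

Lemma L2_cintegrable (f : L2fun R) : cintegrable f.
Proof.
have [[fr fi] _] := set_mem (valP f).
have dom (h : R -> R) : measurable_fun D h ->
    (forall x, `|h x| <= 1 + sqmod (f x)) -> mu.-integrable D (EFin \o h).
  move=> mh hle; apply: (@le_integrable _ _ _ mu D mD _
    (EFin \o (fun x => 1 + sqmod (f x)))).
  - exact/measurable_EFinP.
  - by move=> x _ /=; rewrite lee_fin [leRHS]ger0_norm// addr_ge0 ?sqmod_ge0.
  - by have := integrableD mD (integrable_cst01 1) (sqmod_integrable f); exact.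
have b (p q : R) : `|p| <= 1 + (p ^+ 2 + q ^+ 2).
  have := sqr_ge0 (`|p| - 2^-1); have := sqr_ge0 q.
  by rewrite -[p ^+ 2]real_normK ?num_real// !expr2; nra.
split; apply: dom => // x; case: (f x) => p q; rewrite /sqmod//=.
by rewrite addrC (addrC (p ^+ 2)) addrC b.
Qed.

(** The sine functions being real, the real and imaginary parts of f are
    separately orthogonal to them. *)
Lemma hat_eq0 (v : L2 R) : (forall n, hat v n.+1 = 0) -> v = 0.
Proof.
elim/quotW: v => f h.
have fs k : Cintegral (fun x => f x * (sine k x)%:C) = 0.
  case: k => [|k]; last by rewrite -[RHS](h k) hat_pi.
  rewrite (_ : (fun x => _) = fun=> 0); last first.
    by apply/funext => x; rewrite /= /sine !mul0r sin0 !mulr0.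
  by rewrite /Cintegral /= Rintegral_cst// mul0r.
have ae0 (T : C -> R) : mu.-integrable D (EFin \o (fun x => T (f x))) ->
    (forall k, \int[mu]_(x in D) (T (f x) * sine k x) = 0) ->
    ae_eq mu D (fun x => T (f x)) (cst 0).
  move=> iT T0; apply: sine_complete_real => // k.
  have s2 : Num.sqrt 2 != 0 :> R by rewrite gt_eqF// sqrtr_gt0.
  apply: (mulfI s2); rewrite mulr0 -[RHS](T0 k) -RintegralZl//.
    by apply: eq_Rintegral => x _; rewrite /sine mulrCA.
  apply: (@integrable_mul_bounded _ 1) => // [|x]; last exact: sin_max.
  exact: measurable_sin_mul.
have [ri ii] := L2_cintegrable f.
have rez := ae0 (@Re R) ri; have imz := ae0 (@Im R) ii.
apply: pi_L2_eq0; apply: filterS2 (rez _) (imz _) => [x re im Dx|k|k].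
- by move: (re Dx) (im Dx); case: (f x) => a b /= -> ->.
- have /(congr1 (@Re R)) /= E := fs k; rewrite -[RHS]E.
  by apply: eq_Rintegral => x _; case: (f x) => a b /=; rewrite mulr0 subr0.
- have /(congr1 (@Im R)) /= E := fs k; rewrite -[RHS]E.
  by apply: eq_Rintegral => x _; case: (f x) => a b /=; rewrite mulr0 add0r.
Qed.

Lemma hat_sqmod_le (v : L2 R) i : sqmod (hat v i.+1) <= nrm2 L2dot v.
Proof.
apply: le_trans (bessel linl dotC dot_ge0 (@sine_orthonormal R) v i.+1).
by rewrite big_ord_recr /= lerDr sumr_ge0// => j _; exact: sqmod_ge0.
Qed.

(** The partial sums are orthonormal combinations, so that the distance between
    two of them is a piece of the convergent series of the |c i|^2.  A
    subsequence with increments below 8^-k is rapidly Cauchy; Bessel's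
    inequality passes the coefficients to its limit. *)
Theorem riesz_fischer (c : nat -> C) (M : R) :
  (forall N, \sum_(i < N) sqmod (c i) <= M) ->
  exists v : L2 R, (forall i, hat v i.+1 = c i) /\
    forall e, 0 < e -> exists N, nrm2 L2dot (v - \sum_(i < N) c i *: esine i.+1) <= e.
Proof.
move=> cM; pose u N : R := \sum_(i < N) sqmod (c i).
have um : {homo u : m n / (m <= n)%N >-> m <= n}.
  move=> m n mn; rewrite /u -!(big_mkord xpredT (fun i => sqmod (c i))).
  by apply: partial_sum_mono => // k; exact: sqmod_ge0.
have tail k : exists N, forall n m, (N <= n)%N -> u m - u n <= 8^-1 ^+ k.
  by apply: (monotone_tail _ um cM); rewrite exprn_gt0.
pose t k := projT1 (cid (tail k)).
have tP k n m : (t k <= n)%N -> u m - u n <= 8^-1 ^+ k.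
  by rewrite /t; case: cid => /= ?; exact.
(* adding up the thresholds makes the subsequence K monotone and unbounded *)
pose K k := (k + \sum_(j < k.+1) t j)%N.
have Kt k : (t k <= K k)%N.
  by rewrite /K big_ord_recr /= addnA leq_addl.
have Kk k : (k <= K k)%N by rewrite /K leq_addr.
have KS k l : (k <= l)%N -> (K k <= K l)%N.
  elim: l => [|l IH]; first by rewrite leqn0 => /eqP ->.
  rewrite leq_eqVlt => /predU1P[->//|]; rewrite ltnS => /IH kl.
  by apply: (leq_trans kl); rewrite /K [X in (_ <= _ + X)%N]big_ord_recr /=; lia.
pose S N : L2fun R := \sum_(i < N) c i *: sineL i.+1.
have SB m n : (m <= n)%N -> nrm2 L2dot (\pi_(L2 R) (S n - S m)) = u n - u m.
  move=> mn; rewrite pi_L2B !pi_sine_combination.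
  rewrite (nrm2_sub_combination linl dotC (@sine_orthonormal R)).
  rewrite (nrm2_combination linl dotC (@sine_orthonormal R)).
  rewrite [X in _ + X - _]big1 ?addr0 => [|i _].
    congr (_ - _); apply: eq_bigr => i _; congr sqmod.
    rewrite (dot_combination linl (@sine_orthonormal R))//.
    exact: leq_trans (ltn_ord i) mn.
  rewrite (dot_combination linl (@sine_orthonormal R)); last first.
    exact: leq_trans (ltn_ord i) mn.
  by rewrite subrr sqmod0.
have fastS k : nrm2 L2dot (\pi_(L2 R) (S (K k.+1) - S (K k))) <= 8^-1 ^+ k.
  by rewrite SB ?KS// tP// Kt.
have bS k : nrm2 L2dot (\pi_(L2 R) (S (K k) - S (K 0%N))) <= M.
  rewrite SB ?KS// (le_trans _ (cM (K k)))// gerBl sumr_ge0// => i _.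
  exact: sqmod_ge0.
have [w wP] := fast_cauchy_limit (F := fun k => S (K k)) fastS bS.
have wK k : nrm2 L2dot (\pi_(L2 R) (w - S (K k))) <= 8^-1 ^+ k.
  by apply: (wP k) => l kl; rewrite SB ?KS// tP// Kt.
have p8 : (fun k : nat => 8^-1 ^+ k : R) @ \oo --> 0.
  by apply: cvg_expr; rewrite ger0_norm ?invr_ge0// invf_lt1// ltr1n.
have small (x : R) : (forall k, x <= 8^-1 ^+ k) -> x <= 0.
  move=> xk; rewrite leNgt; apply/negP => x0.
  have /cvgr0Pnorm_lt /(_ _ x0)[N _ /(_ N (leqnn _))] := p8.
  by rewrite /= ger0_norm ?exprn_ge0// ltNge xk.
exists (\pi_(L2 R) w); split => [i|e e0].
  apply/eqP; rewrite -subr_eq0; apply/eqP/sqmod_eq0/le_anti/andP; split; last exact: sqmod_ge0.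
  apply: small => k; pose l := (k + i.+1)%N.
  have il : (i < K l)%N by rewrite (leq_trans _ (Kk l))// leq_addl.
  have -> : hat (\pi_(L2 R) w) i.+1 - c i = hat (\pi_(L2 R) (w - S (K l))) i.+1.
    by rewrite pi_L2B /hat (dotBl linl) pi_sine_combination (dot_combination linl (@sine_orthonormal R)).
  rewrite (le_trans (hat_sqmod_le _ _))// (le_trans (wK l))//.
  by rewrite ler_wiXn2l ?leq_addr// ?invr_ge0// invf_le1// ler1n.
have /cvgr0Pnorm_lt /(_ _ e0)[N _ /(_ N (leqnn _))] := p8.
rewrite /= ger0_norm ?exprn_ge0// => Ne; exists (K N).
by rewrite -pi_sine_combination -pi_L2B (le_trans (wK N))// ltW.
Qed.

End sine_basis.

(** * Dilations *)

Section dilation.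
Context {R : realType}.
Local Notation C := R[i].
Local Notation mu := (@lebesgue_measure R).
Local Notation D := (`]0, 1[%classic : set (measurableTypeR R)).
Let mD : measurable D. Proof. exact: measurable_itv. Qed.

Local Notation linl := (@L2dot_linl R).
Local Notation dotC := (@L2dotC R).
Local Notation dot_ge0 := (@L2dot_ge0 R).
Local Notation ons := (@sine_orthonormal R).

Lemma hat_inj (v w : L2 R) : (forall i, hat v i.+1 = hat w i.+1) -> v = w.
Proof.
move=> vw; apply/eqP; rewrite -subr_eq0; apply/eqP/hat_eq0 => i.
by rewrite /hat (dotBl linl) -/(hat _ _) vw subrr.
Qed.

Lemma nrm2_sub_partial (v : L2 R) N :
  nrm2 L2dot (v - \sum_(i < N) hat v i.+1 *: esine i.+1) =
  nrm2 L2dot v - \sum_(i < N) sqmod (hat v i.+1).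
Proof.
rewrite (nrm2_sub_combination linl dotC ons v N (fun i => hat v i.+1)).
rewrite [X in _ + X - _]big1 ?addr0// => i _.
by rewrite subrr sqmod0.
Qed.

Lemma sine_expansion (v : L2 R) e : 0 < e -> exists N, forall n, (N <= n)%N ->
  nrm2 L2dot (v - \sum_(i < n) hat v i.+1 *: esine i.+1) <= e.
Proof.
have [w [wv we]] := @riesz_fischer R (fun i => hat v i.+1) _ (bessel linl dotC dot_ge0 ons v).
rewrite (hat_inj wv) in we => /we[N hN]; exists N => n Nn; apply: le_trans hN.
rewrite !nrm2_sub_partial lerB// -(subnKC Nn) big_split_ord /= lerDl.
by rewrite sumr_ge0// => i _; exact: sqmod_ge0.
Qed.

(** Half of Parseval's identity; with Bessel's inequality it makes hat an
    isometry. *)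
Lemma nrm2_le_hat (v : L2 R) B :
  (forall N, \sum_(i < N) sqmod (hat v i.+1) <= B) -> nrm2 L2dot v <= B.
Proof.
move=> vB; apply/ler_addgt0Pr => e e0; have [N /(_ N (leqnn _))] := sine_expansion v e0.
by rewrite nrm2_sub_partial; have := vB N; lra.
Qed.

Let cut (f : R -> C) (x : R) : C := if 0 < x < 1 then f x else 0.

Let DE (x : R) : (x \in (D : set R)) = (0 < x < 1).
Proof. by apply/idP/idP => [/set_mem|h]; [|apply/mem_set]; rewrite /= in_itv. Qed.

Lemma measurable_cut (f : L2fun R) : cmeasurable_fun setT (cut f).
Proof.
have [[mr mi] _] := set_mem (valP f).
split.
  have -> : (fun x => Re (cut f x)) = (fun x => Re (f x)) \_ D.
    by apply/funext => x; rewrite patchE DE /cut; case: ifP.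
  exact/(measurable_restrictT _ mD).
have -> : (fun x => Im (cut f x)) = (fun x => Im (f x)) \_ D.
  by apply/funext => x; rewrite patchE DE /cut; case: ifP.
exact/(measurable_restrictT _ mD).
Qed.

Lemma integral_cut_affine (f : L2fun R) (a b : R) : 1 <= `|a| ->
  (\int[mu]_(x in D) (sqmod (cut f (a * x + b)))%:E <= (nrm2 L2dot (\pi_(L2 R) f))%:E)%E.
Proof.
move=> a1; have a0 : a != 0 by rewrite -normr_gt0 (lt_le_trans _ a1).
have mf := measurable_cut f.
have h0 x : (0 <= (sqmod (cut f x))%:E)%E by rewrite lee_fin sqmod_ge0.
have mh : measurable_fun [set: measurableTypeR R] (fun x => (sqmod (cut f x))%:E).
  by apply/measurable_EFinP; exact: measurable_sqmod.
have mh' : measurable_fun [set: measurableTypeR R] (fun x => (sqmod (cut f (a * x + b)))%:E).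
  by apply/measurable_EFinP; apply: measurable_sqmod; exact: (cmeasurable_affine a b mf).
apply: (@le_trans _ _ (\int[mu]_x (sqmod (cut f (a * x + b)))%:E)%E).
  by apply: (@ge0_subset_integral _ _ _ mu D setT) => // x _; rewrite lee_fin sqmod_ge0.
apply: (@le_trans _ _ (`|a|%:E * \int[mu]_x (sqmod (cut f (a * x + b)))%:E)%E).
  by apply: lee_pemull; [apply: integral_ge0 => x _; rewrite lee_fin sqmod_ge0|rewrite lee_fin].
rewrite -(ge0_integral_affine b a0 mh h0) nrm2_piE [X in (_ <= X)%E]integral_mkcond.
rewrite le_eqVlt; apply/orP; left; apply/eqP; apply: eq_integral => x _.
rewrite patchE DE /cut; case: ifP => // _.
by rewrite sqmod0.
Qed.

Lemma sqmod_sum n (F : nat -> C) :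
  sqmod (\sum_(k < n) F k) <= 2 ^+ n * \sum_(k < n) sqmod (F k).
Proof.
elim: n => [|n IH]; first by rewrite !big_ord0 sqmod0 mulr0.
rewrite !big_ord_recr /=; apply: le_trans (sqmodD _ _) _; rewrite exprS.
have p1 : 1 <= 2 ^+ n :> R by rewrite exprn_ege1// ler1n.
have := sqmod_ge0 (F n); move: IH; move: (sqmod _) (\sum_(_ < _) _) (sqmod _) => a b c.
by move=> ? ?; nra.
Qed.

(** On (0, 1) the dilate by n is a sum of n affine copies of f and -f, each of
    them of norm at most that of f; this makes the dilation continuous. *)
Lemma nrm2_dilate (f : L2fun R) n :
  nrm2 L2dot (\pi_(L2 R) (dilate f n.+1)) <=
  (2 ^+ n.+1 * n.+1%:R) * nrm2 L2dot (\pi_(L2 R) f).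
Proof.
rewrite -lee_fin nrm2_piE; set P := nrm2 _ _.
pose a k : R := if odd k then - n.+1%:R else n.+1%:R.
pose b k : R := if odd k then k.+1%:R else - k%:R.
pose G k x := cut f (a k * x + b k).
have mG k : cmeasurable_fun setT (G k) by exact: (cmeasurable_affine (a k) (b k) (measurable_cut f)).
have mGD k : measurable_fun D (fun x => (sqmod (G k x))%:E).
  by apply/measurable_EFinP; apply: measurable_funTS; exact: measurable_sqmod.
apply: (@le_trans _ _ (\int[mu]_(x in D) ((2 ^+ n.+1)%:E * \sum_(k < n.+1) (sqmod (G k x))%:E))%E).
  have mdil : cmeasurable_fun D (dilate f n.+1).
    by have [] := set_mem (valP (dilate f n.+1)).
  apply: ge0_le_integral => //.
  - by move=> x _; rewrite lee_fin sqmod_ge0.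
  - by apply/measurable_EFinP; exact: measurable_sqmod.
  - by apply: measurable_funeM; exact: emeasurable_sum.
  - move=> x; rewrite /= in_itv /= => /andP[x0 x1].
    rewrite sumEFin -EFinM lee_fin.
    rewrite (_ : odd_ext f (n.+1%:R * x) = \sum_(k < n.+1) (if odd k then - G k x else G k x)).
      apply: le_trans (sqmod_sum _ (fun k => if odd k then - G k x else G k x)) _.
      rewrite ler_wpM2l ?exprn_ge0// ler_sum// => k _.
      by case: ifP => // _; rewrite sqmodN.
    rewrite dilateE ?x0//; apply: eq_bigr => k _; rewrite /G /cut /a /b.
    by case: (odd k).
rewrite ge0_integralZl_EFin//; last 2 first.
- by move=> x _; apply: sume_ge0 => k _; rewrite lee_fin sqmod_ge0.
- exact: emeasurable_sum.
rewrite -mulrA EFinM lee_wpmul2l ?lee_fin ?exprn_ge0//.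
rewrite ge0_integral_sum//; last by move=> k x _; rewrite lee_fin sqmod_ge0.
apply: (@le_trans _ _ (\sum_(k < n.+1) P%:E)%E).
  apply: lee_sum => k _; apply: integral_cut_affine.
  by rewrite /a; case: ifP => _; rewrite ?normrN ger0_norm// ler1n.
by rewrite sumEFin lee_fin sumr_const card_ord mulr_natl.
Qed.

Lemma sin_addnpi (x : R) n : sin (x + n%:R * pi) = (-1) ^+ n * sin x.
Proof.
elim: n => [|n IH]; first by rewrite mul0r addr0 expr0 mul1r.
by rewrite -natr1 mulrDl mul1r addrA sinDpi IH exprS mulN1r mulNr.
Qed.

Lemma odd_ext_sine k (y : R) : 0 <= y ->
  odd_ext (fun x => (sine k x)%:C) y = (sine k y)%:C.
Proof.
move=> y0; have /andP[k1 k2] := floor_itv y; rewrite /odd_ext.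
have fl0 : 0 <= Num.floor y by rewrite floor_ge0.
case: (Num.floor y) fl0 k1 k2 => // j _; rewrite rmorphD /= -pmulrn => k1 k2.
set t := y - j%:R; have yE : y = t + j%:R by rewrite /t subrK.
have sy : sine k y = (-1) ^+ (k * j) * sine k t.
  rewrite /sine mulrCA -sin_addnpi yE natrM; congr (_ * sin _); ring.
rewrite sy; case: eqP => [->|_].
  by rewrite /sine mulr0 sin0 !mulr0.
have st : sine k (1 - t) = - ((-1) ^+ k * sine k t).
  rewrite /sine mulrCA -mulrN; congr (_ * _).
  have := sin_addnpi (- (k%:R * pi * t)) k.
  rewrite sinN mulrN => <-; congr sin; ring.
rewrite -signr_odd oddM; case: (odd j); last by rewrite andbF expr0 mul1r.
by rewrite andbT signr_odd st rmorphN opprK.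
Qed.

Lemma pi_dilate_sine k n :
  \pi_(L2 R) (dilate (sineL k) n) = esine (n * k).
Proof.
apply/eqP; rewrite /esine L2eqE; apply/mem_set => /=.
apply: aeW => x; rewrite /= in_itv /= => /andP[x0 x1].
rewrite -[LHS]/(odd_ext (fun x => (sine k x)%:C) (n%:R * x) - (sine (n * k) x)%:C).
rewrite odd_ext_sine ?mulr_ge0 ?(ltW x0)// /sine natrM.
by apply/eqP; rewrite subr_eq0; apply/eqP; congr ((_ * sin _)%:C); ring.
Qed.

Lemma dilate_lin (a : C) (f g : L2fun R) n :
  dilate (a *: f + g) n = a *: dilate f n + dilate g n.
Proof.
apply: val_inj; apply/funext => x /=.
have -> : (a *: (fun x => odd_ext f (n%:R * x)) + (fun x => odd_ext g (n%:R * x))) x =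
  a * odd_ext f (n%:R * x) + odd_ext g (n%:R * x) by [].
rewrite /odd_ext; case: ifP => _; first by rewrite mulr0 addr0.
by case: ifP => _ //=; rewrite opprD mulrN.
Qed.

(** The dilation by n sends the sine function of index k to that of index n k,
    and it is linear and bounded.  The formula thus holds for finite sine sums,
    and by continuity for all functions. *)
Lemma hat_dilate (f : L2fun R) n m :
  hat (\pi_(L2 R) (dilate f n.+1)) m.+1 =
  if (n.+1 %| m.+1)%N then sine_coef f (m.+1 %/ n.+1) else 0.
Proof.
set t := (if _ then _ else _); set g := dilate f n.+1.
pose K : R := 2 ^+ n.+1 * n.+1%:R; have K0 : 0 < K by rewrite mulr_gt0 ?exprn_gt0 ?ltr0n.
apply/eqP; rewrite -subr_eq0; apply/eqP/sqmod_eq0/le_anti/andP; split; last exact: sqmod_ge0.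
apply/ler_addgt0Pr => e e0; rewrite add0r.
have eK : 0 < e / K by rewrite divr_gt0.
have [N0 hN0] := sine_expansion (\pi_(L2 R) f) eK.
pose N := maxn N0 m.+1.
pose S := \sum_(i < N) hat (\pi_(L2 R) f) i.+1 *: sineL i.+1.
have dil0 : dilate 0 n.+1 = 0 :> L2fun R.
  by have := dilate_lin (-1) (0 : L2fun R) 0 n.+1; rewrite scaler0 addr0 scaleN1r addNr.
have dS : hat (\pi_(L2 R) (dilate S n.+1)) m.+1 = t.
  have dilS M (c : nat -> C) : \pi_(L2 R) (dilate (\sum_(i < M) c i *: sineL i.+1) n.+1) =
      \sum_(i < M) c i *: esine (n.+1 * i.+1).
    elim: M => [|M IH]; first by rewrite !big_ord0 dil0 pi_L20.
    rewrite !big_ord_recr /= addrC dilate_lin pi_L2D IH pi_L2Z addrC.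
    by rewrite pi_dilate_sine.
  rewrite /S (dilS N (fun i => hat (\pi_(L2 R) f) i.+1)).
  rewrite /hat (dot_suml linl) /t.
  have E (i : 'I_N) : L2dot (hat (\pi_(L2 R) f) i.+1 *: esine (n.+1 * i.+1)) (esine m.+1)
     = hat (\pi_(L2 R) f) i.+1 * ((n.+1 * i.+1)%N == m.+1)%:R.
    by rewrite (dotZl linl) -/(hat _ _) hat_esine.
  under eq_bigr do rewrite E.
  have [/dvdnP[q mq]|nd] := boolP (n.+1 %| m.+1)%N; last first.
    rewrite big1// => i _; case: eqP => [e'|]; last by rewrite mulr0.
    by case/negP: nd; rewrite -e' dvdn_mulr.
  have q0 : (0 < q)%N by move: mq; case: q.
  have qm : (q.-1 < N)%N.
    rewrite leq_max (_ : (q.-1 < m.+1)%N) ?orbT// mq prednK// leq_pmulr//.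
  rewrite (bigD1 (Ordinal qm))//= big1 => [|i].
    by rewrite prednK// mulnC -mq eqxx mulr1 addr0 mq mulnK// hat_pi.
  move=> /eqP iq; rewrite mq mulnC eqn_pmul2r//.
  case: eqP => [iq'|]; last by rewrite mulr0.
  by case: iq; apply: val_inj; rewrite /= -iq'.
have -> : hat (\pi_(L2 R) g) m.+1 - t = hat (\pi_(L2 R) (dilate (f - S) n.+1)) m.+1.
  rewrite -dS /hat -(dotBl linl) -pi_L2B; congr (L2dot (\pi_(L2 R) _) _).
  by rewrite -(scaleN1r S) (addrC f) dilate_lin scaleN1r addrC.
rewrite (le_trans (hat_sqmod_le _ _))// (le_trans (nrm2_dilate _ _))//.
rewrite -/K mulrC -ler_pdivlMr// pi_L2B (pi_sine_combination N (fun i => hat (\pi_(L2 R) f) i.+1)); apply: hN0.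
by rewrite leq_max leqnn.
Qed.

End dilation.

(** * Absolutely convergent complex series *)

Section modulus.
Context {R : realType}.
Local Notation C := R[i].
Implicit Types z w : C.

Definition cabs z : R := Num.sqrt (sqmod z).

Lemma normC_cabs z : `|z| = (cabs z)%:C. Proof. exact: normc_def. Qed.

Lemma cabs_ge0 z : 0 <= cabs z. Proof. exact: sqrtr_ge0. Qed.

Lemma sqr_cabs z : cabs z ^+ 2 = sqmod z.
Proof. by rewrite sqr_sqrtr// sqmod_ge0. Qed.

Lemma cabsM z w : cabs (z * w) = cabs z * cabs w.
Proof. by apply: complexI; rewrite rmorphM /= -!normC_cabs normrM. Qed.

Lemma cabsD z w : cabs (z + w) <= cabs z + cabs w.
Proof. by rewrite -lecR rmorphD /= -!normC_cabs ler_normD. Qed.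

Lemma cabsN z : cabs (- z) = cabs z.
Proof. by apply: complexI; rewrite -!normC_cabs normrN. Qed.

Lemma cabsB z w : cabs (z - w) <= cabs z + cabs w.
Proof. by rewrite -(cabsN w) cabsD. Qed.

Lemma cabs0 : cabs 0 = 0.
Proof. by apply: complexI; rewrite -normC_cabs normr0. Qed.

Lemma cabs_eq0 z : (cabs z == 0) = (z == 0).
Proof. by rewrite -[RHS]normr_eq0 normC_cabs -(inj_eq (@complexI R)). Qed.

Lemma cabs_real (x : R) : cabs x%:C = `|x|.
Proof. by rewrite /cabs sqmod_real sqrtr_sqr. Qed.

Lemma cabs_le_ReIm z : cabs z <= `|Re z| + `|Im z|.
Proof.
rewrite {1}[z]complexE (le_trans (cabsD _ _))// cabsM !cabs_real.
by rewrite (_ : cabs 'i = 1) ?mul1r// /cabs /sqmod /= expr0n expr1n add0r sqrtr1.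
Qed.

Lemma Re_le_cabs z : `|Re z| <= cabs z.
Proof.
by rewrite -sqrtr_sqr ler_sqrt ?sqmod_ge0// lerDl sqr_ge0.
Qed.

Lemma Im_le_cabs z : `|Im z| <= cabs z.
Proof.
by rewrite -sqrtr_sqr ler_sqrt ?sqmod_ge0// lerDr sqr_ge0.
Qed.

Lemma cabs_sum (I : Type) (r : seq I) (P : pred I) (F : I -> C) :
  cabs (\sum_(i <- r | P i) F i) <= \sum_(i <- r | P i) cabs (F i).
Proof.
elim/big_rec2: _ => [|i y x _ xy]; first by rewrite cabs0.
by rewrite (le_trans (cabsD _ _))// lerD2l.
Qed.

Lemma C_cvg (u : nat -> C) (l : C) :
  (forall e : R, 0 < e -> exists N, forall n, (N <= n)%N -> cabs (u n - l) <= e) ->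
  (u : nat -> C^o) @ \oo --> (l : C^o).
Proof.
move=> h; apply/cvgrPdist_le => e e0.
(* positive elements of C are real *)
have [d d0 ->] : exists2 d : R, 0 < d & e = d%:C.
  move: e0; rewrite ltcE /= => /andP[/eqP e1 e2]; exists (Re e) => //.
  by case: e e1 e2 => a b /= -> _.
have [N hN] := h _ d0; exists N => // n /= Nn.
by rewrite distrC normC_cabs lecR hN.
Qed.

Lemma C_lim (u : nat -> C) (l : C) :
  (forall e : R, 0 < e -> exists N, forall n, (N <= n)%N -> cabs (u n - l) <= e) ->
  limn (u : nat -> C^o) = l.
Proof. by move=> h; apply: cvg_lim; [exact: norm_hausdorff|exact: C_cvg]. Qed.

End modulus.

Section absolute_series.
Context {R : realType}.
Local Notation C := R[i].
Implicit Types u v : nat -> C.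

Definition psum u N : C := \sum_(1 <= n < N) u n.

Definition abs_bound u (M : R) := forall N, \sum_(1 <= n < N) cabs (u n) <= M.

Definition sumC u : C := limn (fun N => psum u N : C^o).

Lemma bounded_series_cvg (w : nat -> R) (M : R) : (forall n, 0 <= w n) ->
  (forall N, \sum_(1 <= n < N) w n <= M) ->
  exists l, forall e, 0 < e -> exists N, forall n, (N <= n)%N ->
    `|\sum_(1 <= k < n) w k - l| <= e.
Proof.
move=> w0 wM; pose s N := \sum_(1 <= n < N) w n.
have sm := partial_sum_mono 1 w0.
have sc : cvgn s.
  by apply: nondecreasing_is_cvgn => //; exists M => _ [n _ <-]; exact: wM.
exists (limn s) => e e0; have /cvgrPdist_le /(_ e e0)[N _ hN] := sc.
by exists N => n Nn; rewrite distrC; exact: hN.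
Qed.

(** The real series of Re (u n) + |u n| and of |u n| have nonnegative terms and
    bounded partial sums; the same holds with imaginary parts. *)
Lemma abs_cvg u M : abs_bound u M -> exists l, forall e, 0 < e ->
  exists N, forall n, (N <= n)%N -> cabs (psum u n - l) <= e.
Proof.
move=> uM.
have part (T : C -> R) : (forall z, `|T z| <= cabs z) ->
    {morph T : x y / x + y} -> T 0 = 0 ->
    exists l, forall e, 0 < e -> exists N, forall n, (N <= n)%N ->
    `|T (psum u n) - l| <= e.
  move=> Tle TD T0.
  have h1 n : 0 <= T (u n) + cabs (u n).
    by have := Tle (u n); rewrite ler_norml => /andP[? _]; lra.
  have [|l1 hl1] := @bounded_series_cvg (fun n => T (u n) + cabs (u n)) (M + M) h1.
    move=> N; rewrite big_split /= lerD//.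
    apply: le_trans (uM N); apply: ler_sum => n _.
    exact: le_trans (ler_norm _) (Tle _).
  have [|l2 hl2] := @bounded_series_cvg (fun n => cabs (u n)) M _ uM.
    by move=> n; exact: cabs_ge0.
  exists (l1 - l2) => e e0; have e2 : 0 < e / 2 by rewrite divr_gt0.
  have [N1 {}hl1] := hl1 _ e2; have [N2 {}hl2] := hl2 _ e2.
  exists (maxn N1 N2) => n; rewrite geq_max => /andP[/hl1 h3 /hl2 h4].
  have -> : T (psum u n) = \sum_(1 <= k < n) (T (u k) + cabs (u k)) -
      \sum_(1 <= k < n) cabs (u k).
    by rewrite big_split /= addrK /psum (big_morph T TD T0).
  move: h3 h4; set s1 := \sum_(_ <= _ < _) _; set s2 := \sum_(_ <= _ < _) _ => h3 h4.
  have -> : s1 - s2 - (l1 - l2) = (s1 - l1) - (s2 - l2) by ring.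
  by rewrite (le_trans (ler_normB _ _))// (splitr e) lerD.
have [||a ha] := part (@Re R) (@Re_le_cabs R); first by move=> [? ?] [].
  by [].
have [||b hb] := part (@Im R) (@Im_le_cabs R); first by move=> [? ?] [].
  by [].
exists (a +i* b) => e e0; have e2 : 0 < e / 2 by rewrite divr_gt0.
have [N1 {}ha] := ha _ e2; have [N2 {}hb] := hb _ e2.
exists (maxn N1 N2) => n; rewrite geq_max => /andP[/ha h3 /hb h4].
rewrite (le_trans (cabs_le_ReIm _))// (splitr e).
by move: h3 h4; case: (psum u n) => x y /= h3 h4; rewrite lerD.
Qed.

Lemma sumC_cvg u M : abs_bound u M -> forall e, 0 < e ->
  exists N, forall n, (N <= n)%N -> cabs (psum u n - sumC u) <= e.
Proof. by move=> /abs_cvg[l hl]; rewrite /sumC (C_lim hl). Qed.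

Lemma sumC_unique u l : (forall e, 0 < e ->
  exists N, forall n, (N <= n)%N -> cabs (psum u n - l) <= e) -> sumC u = l.
Proof. exact: C_lim. Qed.

Lemma eq_sumC u v : (forall n, (0 < n)%N -> u n = v n) -> sumC u = sumC v.
Proof.
move=> uv; rewrite /sumC (_ : psum u = psum v)//; apply/funext => N.
by apply: eq_big_nat => n /andP[n0 _]; exact: uv.
Qed.

Lemma sumC_lin a u v M M' : abs_bound u M -> abs_bound v M' ->
  sumC (fun n => a * u n + v n) = a * sumC u + sumC v.
Proof.
move=> uM vM; apply: sumC_unique => e e0.
have k0 : 0 < cabs a + 1 by rewrite ltr_wpDl ?cabs_ge0.
have e2 : 0 < e / 2 by rewrite divr_gt0.
have [N1 h1] := sumC_cvg uM (divr_gt0 e2 k0); have [N2 h2] := sumC_cvg vM e2.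
exists (maxn N1 N2) => n; rewrite geq_max => /andP[/h1 h3 /h2 h4].
have -> : psum (fun n => a * u n + v n) n = a * psum u n + psum v n.
  by rewrite /psum big_split /= mulr_sumr.
rewrite (_ : _ - _ = a * (psum u n - sumC u) + (psum v n - sumC v)); last by ring.
rewrite (le_trans (cabsD _ _))// (splitr e) lerD// cabsM.
rewrite (le_trans (ler_wpM2l (cabs_ge0 _) h3))// mulrC mulrAC -mulrA.
by rewrite ler_piMr// ?(ltW e2)// ler_pdivrMr// mul1r lerDl.
Qed.

Lemma sumC_tail u n B : (0 < n)%N ->
  (forall N, \sum_(n <= k < N) cabs (u k) <= B) ->
  cabs (sumC u - psum u n) <= B.
Proof.
move=> n0 hB.
have uM : abs_bound u (\sum_(1 <= k < n) cabs (u k) + B).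
  move=> N; have [nN|Nn] := leqP n N.
    by rewrite (big_cat_nat (n := n))//= lerD2l.
  have h0 : 0 <= B by have := hB n; rewrite big_geq.
  have [N1|N1] := leqP N 1.
    by rewrite big_geq// addr_ge0// sumr_ge0// => i _; exact: cabs_ge0.
  rewrite (@big_cat_nat _ _ _ N 1 n)//= ?(ltnW N1) ?(ltnW Nn)//.
  by rewrite -addrA lerDl addr_ge0// sumr_ge0// => i _; exact: cabs_ge0.
apply/ler_addgt0Pr => e e0; have [N hN] := sumC_cvg uM e0.
pose m := maxn N n; have := hN m (leq_maxl _ _).
have -> : psum u m = psum u n + \sum_(n <= k < m) u k.
  by rewrite /psum (big_cat_nat (n := n))//= leq_maxr.
move=> h; rewrite (_ : sumC u - _ = \sum_(n <= k < m) u k -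
  (psum u n + \sum_(n <= k < m) u k - sumC u)); last by ring.
rewrite (le_trans (cabsB _ _))// lerD// (le_trans (cabs_sum _ _ _))//.
Qed.

End absolute_series.

(** * Dirichlet convolution *)

Section dirichlet_convolution.

Definition dconv {A : nzRingType} (u v : nat -> A) (n : nat) : A :=
  \sum_(1 <= j < n.+1 | (j %| n)%N) u j * v (n %/ j)%N.

Lemma sum_mul_eq (A : nzRingType) (F : nat -> A) j n N : (0 < j)%N -> (0 < n < N)%N ->
  \sum_(1 <= k < N | (j * k == n)%N) F k = if (j %| n)%N then F (n %/ j)%N else 0.
Proof.
move=> j0 /andP[n0 nN]; case: ifP => [/dvdnP[q nq]|nd]; last first.
  rewrite big1// => k /eqP jk; by rewrite -jk dvdn_mulr in nd.
have q0 : (0 < q)%N by move: n0; rewrite nq; case: q {nq}.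
rewrite nq mulnK// big_mkcond (bigD1_seq q) ?iota_uniq//=; last first.
  by rewrite mem_index_iota q0 (leq_ltn_trans _ nN)// nq leq_pmulr.
rewrite mulnC eqxx big1 ?addr0// => k kq.
by rewrite mulnC eqn_pmul2r// (negbTE kq).
Qed.

Lemma dconv_pairs (A : nzRingType) (u v : nat -> A) n N : (0 < n < N)%N ->
  dconv u v n = \sum_(1 <= j < N) \sum_(1 <= k < N | (j * k == n)%N) u j * v k.
Proof.
move=> nN; have /andP[n0 nN'] := nN.
rewrite /dconv [RHS](@big_cat_nat _ _ _ n.+1 1 N)//=.
rewrite [X in _ = _ + X]big_nat_cond [X in _ = _ + X]big1 ?addr0.
  rewrite [LHS]big_mkcond; apply: eq_big_nat => j /andP[j0 _].
  by rewrite (sum_mul_eq (fun k => u j * v k)).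
move=> j /andP[/andP[nj _] _]; have j0 : (0 < j)%N by exact: leq_trans nj.
by rewrite (sum_mul_eq (fun k => u j * v k))// gtnNdvd.
Qed.

(** Summing a convolution over n < N amounts to summing over the pairs below
    the hyperbola j k = N. *)
Lemma sum_dconv (A : nzRingType) (u v : nat -> A) N :
  \sum_(1 <= n < N) dconv u v n =
  \sum_(1 <= j < N) \sum_(1 <= k < N | (j * k < N)%N) u j * v k.
Proof.
transitivity (\sum_(1 <= n < N) \sum_(1 <= j < N) \sum_(1 <= k < N)
    (if (j * k == n)%N then u j * v k else 0)).
  apply: eq_big_nat => n nN; rewrite (dconv_pairs _ _ nN).
  by apply: eq_bigr => j _; rewrite big_mkcond.
rewrite exchange_big_nat /=; apply: eq_big_nat => j /andP[j0 jN].
rewrite exchange_big_nat /= [RHS]big_mkcond; apply: eq_big_nat => k /andP[k0 kN].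
case: ifP => jk; last first.
  rewrite big_nat_cond big1// => n /andP[/andP[_ nN] _].
  by case: eqP => // e; rewrite e nN in jk.
rewrite (bigD1_seq (j * k)%N) ?iota_uniq//=; last first.
  by rewrite mem_index_iota jk muln_gt0 j0 k0.
by rewrite eqxx big1 ?addr0// => n; rewrite eq_sym => /negbTE ->.
Qed.

Context {R : realType}.
Local Notation C := R[i].
Implicit Types u v : nat -> C.

Let A u n : R := cabs (u n).

Let A0 u n : 0 <= A u n. Proof. exact: cabs_ge0. Qed.

Lemma abs_bound_tail u M e : abs_bound u M -> 0 < e ->
  exists K, (0 < K)%N /\ forall N, \sum_(K <= k < N) cabs (u k) <= e.
Proof.
move=> uM e0; pose s N := \sum_(1 <= n < N) cabs (u n).
have sm : {homo s : m n / (m <= n)%N >-> m <= n}.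
  by apply: partial_sum_mono => n; exact: cabs_ge0.
have [K hK] := monotone_tail e0 sm uM.
exists K.+1; split => // N; have [NK|KN] := leqP N K.+1.
  by rewrite big_geq// ltW.
have := hK K.+1 N (leqnSn _).
rewrite /s (@big_cat_nat _ _ _ K.+1 1 N)//= ?(ltnW KN)//.
by rewrite addrAC subrr add0r.
Qed.

Lemma abs_bound_ge0 u M : abs_bound u M -> 0 <= M.
Proof. by move=> /(_ 0%N); rewrite big_geq. Qed.

Lemma abs_bound_dconv u v Mu Mv : abs_bound u Mu -> abs_bound v Mv ->
  abs_bound (dconv u v) (Mu * Mv).
Proof.
move=> uM vM N.
apply: (@le_trans _ _ (\sum_(1 <= n < N) dconv (A u) (A v) n)).
  apply: ler_sum => n _; rewrite (le_trans (cabs_sum _ _ _))//.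
  by apply: ler_sum => j _; rewrite cabsM.
rewrite sum_dconv; apply: (@le_trans _ _ ((\sum_(1 <= j < N) A u j) * \sum_(1 <= k < N) A v k)).
  rewrite mulr_suml; apply: ler_sum => j _; rewrite mulr_sumr big_mkcond.
  by apply: ler_sum => k _; case: ifP => // _; rewrite mulr_ge0.
apply: ler_pM => //; apply: sumr_ge0 => i _; exact: A0.
Qed.

(** The product of the partial sums runs over the square j, k < N.  The pairs of
    the square that are not below the hyperbola satisfy j >= K or k >= K as soon
    as K^2 <= N, so that they contribute no more than two tails. *)
Lemma dconv_psum_dist u v Mu Mv K N : (0 < K)%N -> (K * K <= N)%N ->
  abs_bound u Mu -> abs_bound v Mv ->
  cabs (psum u N * psum v N - psum (dconv u v) N) <=
  (\sum_(K <= j < N) cabs (u j)) * Mv + Mu * (\sum_(K <= k < N) cabs (v k)).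
Proof.
move=> K0 KN uM vM.
have KN' : (K <= N)%N by apply: leq_trans KN; rewrite leq_pmulr.
have tailE w : \sum_(K <= j < N) A w j = \sum_(1 <= j < N) A w j * (K <= j)%N%:R.
  rewrite [RHS](@big_cat_nat _ _ _ K)//= [X in _ = X + _]big_nat_cond
    [X in _ = X + _]big1 ?add0r.
    by apply: eq_big_nat => j /andP[-> _]; rewrite mulr1.
  by move=> j /andP[/andP[_ jK] _]; rewrite leqNgt jK mulr0.
have -> : psum u N * psum v N - psum (dconv u v) N =
    \sum_(1 <= j < N) \sum_(1 <= k < N | (N <= j * k)%N) u j * v k.
  rewrite /psum sum_dconv mulr_suml -sumrB; apply: eq_bigr => j _.
  rewrite mulr_sumr (bigID (fun k => (j * k < N)%N))/= addrAC subrr add0r.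
  by apply: eq_bigl => k; rewrite -leqNgt.
apply: (@le_trans _ _ (\sum_(1 <= j < N) \sum_(1 <= k < N)
   (A u j * (K <= j)%N%:R * A v k + A u j * (A v k * (K <= k)%N%:R)))).
  rewrite (le_trans (cabs_sum _ _ _))//; apply: ler_sum => j _.
  rewrite (le_trans (cabs_sum _ _ _))// big_mkcond; apply: ler_sum => k _.
  have p1 : 0 <= A u j * (K <= j)%N%:R * A v k by rewrite !mulr_ge0.
  have p2 : 0 <= A u j * (A v k * (K <= k)%N%:R) by rewrite !mulr_ge0.
  case: ifP => [jk|_]; last by rewrite addr_ge0.
  rewrite cabsM -/(A u j) -/(A v k).
  have [Kj|jK] := leqP K j; first by rewrite mulr1 lerDl.
  have [Kk|kK] := leqP K k; first by rewrite mulr0 mul0r add0r mulr1.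
  have := leq_trans KN jk; rewrite leqNgt.
  by rewrite (leq_ltn_trans (leq_mul (leqnn j) (ltnW kK)))// ltn_pmul2r.
under eq_bigr do rewrite big_split /= -mulr_sumr -mulr_sumr.
rewrite big_split /= -!mulr_suml -!tailE.
apply: lerD; [apply: ler_wpM2l => //|apply: ler_wpM2r => //]; exact: sumr_ge0.
Qed.

Theorem sumC_dconv u v Mu Mv : abs_bound u Mu -> abs_bound v Mv ->
  sumC (dconv u v) = sumC u * sumC v.
Proof.
move=> uM vM; apply: sumC_unique => e e0.
have Mu0 := abs_bound_ge0 uM; have Mv0 := abs_bound_ge0 vM.
pose M := Mu + Mv + cabs (sumC v) + 1.
have cv := cabs_ge0 (sumC v).
have M0 : 0 < M by rewrite /M; lra.
pose d := e / (4 * M); have d0 : 0 < d by rewrite divr_gt0 ?mulr_gt0.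
have [K1 [K10 hK1]] := abs_bound_tail uM d0; have [K2 [K20 hK2]] := abs_bound_tail vM d0.
have [N1 hN1] := sumC_cvg uM d0; have [N2 hN2] := sumC_cvg vM d0.
pose K := maxn K1 K2; have K0 : (0 < K)%N by rewrite leq_max K10.
exists (maxn (K * K) (maxn N1 N2)) => n; rewrite !geq_max => /and3P[Kn /hN1 h1 /hN2 h2].
have tail w K' : (K' <= K)%N -> (0 < K')%N -> (forall N, \sum_(K' <= k < N) cabs (w k) <= d) ->
    \sum_(K <= k < n) cabs (w k) <= d.
  move=> KK K'0 h; apply: le_trans (h n).
  have Kn' : (K <= n)%N by apply: leq_trans Kn; rewrite leq_pmulr.
  by rewrite [leRHS](@big_cat_nat _ _ _ K)//= lerDr sumr_ge0// => i _; exact: cabs_ge0.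
have t1 := tail u K1 (leq_maxl _ _) K10 hK1; have t2 := tail v K2 (leq_maxr _ _) K20 hK2.
have h3 := dconv_psum_dist K0 Kn uM vM.
have pu : cabs (psum u n) <= Mu by apply: le_trans (cabs_sum _ _ _) (uM n).
have -> : psum (dconv u v) n - sumC u * sumC v =
   - (psum u n * psum v n - psum (dconv u v) n) +
   (psum u n * (psum v n - sumC v) + (psum u n - sumC u) * sumC v) by ring.
apply: le_trans (cabsD _ _) _; rewrite cabsN.
have h4 := cabsD (psum u n * (psum v n - sumC v)) ((psum u n - sumC u) * sumC v).
rewrite !cabsM in h4.
have dM : 4 * (d * M) = e by rewrite /d; field; rewrite gt_eqF.
have a1 : (\sum_(K <= j < n) cabs (u j)) * Mv <= d * M.
  by apply: ler_pM => //; [apply: sumr_ge0 => i _; exact: cabs_ge0|rewrite /M; lra].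
have a2 : Mu * (\sum_(K <= j < n) cabs (v j)) <= d * M.
  by rewrite mulrC; apply: ler_pM => //; [apply: sumr_ge0 => i _; exact: cabs_ge0|rewrite /M; lra].
have a3 : cabs (psum u n) * cabs (psum v n - sumC v) <= d * M.
  by rewrite mulrC; apply: ler_pM => //; rewrite ?cabs_ge0//; rewrite /M; lra.
have a4 : cabs (psum u n - sumC u) * cabs (sumC v) <= d * M.
  by apply: ler_pM => //; rewrite ?cabs_ge0//; rewrite /M; lra.
lra.
Qed.

End dirichlet_convolution.

(** * Dirichlet series on the half-plane *)

Section powers.
Context {R : realType}.
Local Notation C := R[i].
Implicit Types (z w s : C) (x y p : R).

Lemma cexpD z w : cexp (z + w) = cexp z * cexp w.
Proof.
case: z w => a b [c d]; rewrite /cexp /= expRD cosD sinD.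
by apply/eqP; rewrite eq_complex /=; apply/andP; split; apply/eqP; ring.
Qed.

Lemma cabs_cexp z : cabs (cexp z) = expR (Re z).
Proof.
rewrite /cexp cabsM cabs_real ger0_norm ?expR_ge0// /cabs /sqmod /=.
by rewrite cos2Dsin2 sqrtr1 mulr1.
Qed.

Definition rpow (n : nat) p : R := expR (- p * ln n%:R).

Lemma rpow_gt0 n p : 0 < rpow n p. Proof. exact: expR_gt0. Qed.

Lemma rpow_ge0 n p : 0 <= rpow n p. Proof. exact: expR_ge0. Qed.

Lemma rpowD n p q : rpow n (p + q) = rpow n p * rpow n q.
Proof. by rewrite /rpow opprD mulrDl expRD. Qed.

Lemma ln_nat_ge0 n : 0 <= ln n%:R :> R.
Proof. by case: n => [|n]; [rewrite ln0|rewrite ln_ge0// ler1n]. Qed.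

Lemma cabs_npow n s : cabs (npow n s) = rpow n (Re s).
Proof.
rewrite /npow cabs_cexp /rpow; congr expR.
by case: s => a b; rewrite /= mulr0 subr0.
Qed.

Lemma npowM m n s : (0 < m)%N -> (0 < n)%N -> npow (m * n) s = npow m s * npow n s.
Proof.
move=> m0 n0; rewrite /npow -cexpD natrM lnM ?posrE ?ltr0n//.
by rewrite rmorphD mulrDr.
Qed.

(** With e = p - 1, the term n^-p is at most ((n-1)^-e - n^-e) / e, by the
    convexity of the exponential: the sum telescopes. *)
Lemma sum_rpow p : 1 < p -> exists M, forall N, \sum_(1 <= n < N) rpow n p <= M.
Proof.
move=> p1; pose e := p - 1; have e0 : 0 < e by rewrite subr_gt0.
exists (1 + e^-1) => N.
have step n : (0 < n)%N -> rpow n.+1 p <= e^-1 * (rpow n e - rpow n.+1 e).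
  move=> n0; rewrite mulrC ler_pdivlMr//.
  have n0' : 0 < n%:R :> R by rewrite ltr0n.
  have n1' : 0 < n.+1%:R :> R by rewrite ltr0n.
  have l1 : n.+1%:R^-1 <= ln n.+1%:R - ln n%:R :> R.
    rewrite -opprB -lnV ?posrE// -?lnM ?posrE ?invr_gt0//.
    have -> : n%:R / n.+1%:R = 1 + (- n.+1%:R^-1) :> R.
      by rewrite -[n.+1%:R in LHS]natr1 -natr1; field; rewrite natr1 gt_eqF.
    rewrite lerNr; apply: le_ln1Dx; rewrite ltrN2 invf_lt1// ltr1n.
    by rewrite ltnS.
  have -> : rpow n e = rpow n.+1 e * expR (e * (ln n.+1%:R - ln n%:R)).
    by rewrite /rpow -expRD; congr expR; ring.
  have -> : rpow n.+1 p = rpow n.+1 e * n.+1%:R^-1.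
    have pe : p = e + 1 by rewrite subrK.
    rewrite [in LHS]pe rpowD; congr (_ * _).
    by rewrite /rpow mulN1r expRN lnK// posrE.
  rewrite -mulrA -subr_ge0.
  have -> : rpow n.+1 e * expR (e * (ln n.+1%:R - ln n%:R)) - rpow n.+1 e -
      rpow n.+1 e * (n.+1%:R^-1 * e) =
     rpow n.+1 e * (expR (e * (ln n.+1%:R - ln n%:R)) - (1 + n.+1%:R^-1 * e)) by ring.
  rewrite mulr_ge0 ?rpow_ge0// subr_ge0.
  apply: le_trans (expR_ge1Dx _); rewrite lerD2l mulrC ler_wpM2l//.
  exact: ltW.
have bound m : \sum_(1 <= n < m.+2) rpow n p <= 1 + e^-1 * (1 - rpow m.+1 e).
  elim: m => [|m IH].
    by rewrite big_nat1 /rpow ln1 !mulr0 expR0 subrr mulr0 addr0.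
  rewrite big_nat_recr//=; have := step m.+1 isT; move: IH.
  rewrite !mulrBr; lra.
have i0 : 0 <= e^-1 by rewrite invr_ge0 ltW.
case: N => [|[|N]]; [by rewrite big_geq// addr_ge0..|].
apply: (le_trans (bound N)); rewrite lerD2l ler_piMr// gerBl rpow_ge0//.
Qed.

End powers.

Section dirichlet_series_facts.
Context {R : realType}.
Local Notation C := R[i].
Implicit Types (a c : nat -> C) (s : C).

(** Square summability in terms of real partial sums, the form used in all
    estimates. *)
Definition l2 c := exists M : R, forall N, \sum_(1 <= n < N) sqmod (c n) <= M.

Lemma l2P c : sq_summable c <-> l2 c.
Proof.
have s0 n : (0 <= (sqmod (c n))%:E)%E by rewrite lee_fin sqmod_ge0.
split => [h|[M cM]]; last first.
  apply: (@le_lt_trans _ _ M%:E); last exact: ltry.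
  apply: lime_le; first by apply: is_cvg_nneseries => n _ _; exact: s0.
  by apply: nearW => N; rewrite sumEFin lee_fin.
move: h; rewrite /sq_summable; set S := (\sum_(1 <= n <oo) _)%E => h.
have S0 : (0 <= S)%E by apply: nneseries_ge0 => n _ _; exact: s0.
exists (fine S) => N; rewrite -lee_fin fineK ?ge0_fin_numE// -sumEFin.
by apply: (nneseries_lim_ge N) => n _ _; exact: s0.
Qed.

(** By the inequality of arithmetic and geometric means, as n^-2p is summable. *)
Lemma l2_weighted c p : l2 c -> 2^-1 < p ->
  exists M, forall N, \sum_(1 <= n < N) cabs (c n) * rpow n p <= M.
Proof.
move=> [M cM] p2; have [|M' hM'] := @sum_rpow R (p + p); first lra.
exists (M + M') => N; apply: le_trans (lerD (cM N) (hM' N)).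
rewrite -big_split /=; apply: ler_sum => n _; rewrite rpowD -sqr_cabs.
have := sqr_ge0 (cabs (c n) - rpow n p).
have := cabs_ge0 (c n); have := rpow_ge0 n p; nra.
Qed.

(** By conversion, dirichlet_series c s is sumC (dterm c s). *)
Definition dterm c s (n : nat) : C := c n * npow n s.

Lemma cabs_dterm c s n : cabs (dterm c s n) = cabs (c n) * rpow n (Re s).
Proof. by rewrite /dterm cabsM cabs_npow. Qed.

Lemma l2_dterm c s : l2 c -> half_plane s -> exists M, abs_bound (dterm c s) M.
Proof.
move=> c2 hs; have [M hM] := l2_weighted c2 hs; exists M => N.
by under eq_bigr do rewrite cabs_dterm.
Qed.

Lemma dterm_dconv a c s n : (0 < n)%N ->
  dterm (dconv a c) s n = dconv (dterm a s) (dterm c s) n.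
Proof.
move=> n0; rewrite /dterm /dconv mulr_suml [LHS]big_mkcond [RHS]big_mkcond.
apply: eq_big_nat => j /andP[j0 _]; case: ifP => // /dvdnP[q nq].
have q0 : (0 < q)%N by move: n0; rewrite nq; case: q {nq}.
by rewrite nq mulnK// npowM// [npow q s * _]mulrC mulrACA.
Qed.

Lemma abs_bound_dterm_dconv a c s M M' : abs_bound (dterm a s) M ->
  abs_bound (dterm c s) M' -> abs_bound (dterm (dconv a c) s) (M * M').
Proof.
move=> aM cM N; apply: le_trans (abs_bound_dconv aM cM N).
rewrite le_eqVlt; apply/orP; left; apply/eqP; apply: eq_big_nat => n /andP[n0 _].
by rewrite dterm_dconv.
Qed.

Theorem dirichlet_mul a c s : l2 a -> l2 c -> half_plane s ->
  dirichlet_series a s * dirichlet_series c s = dirichlet_series (dconv a c) s.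
Proof.
move=> a2 c2 hs; have [M aM] := l2_dterm a2 hs; have [M' cM] := l2_dterm c2 hs.
rewrite -[LHS](sumC_dconv aM cM) -[RHS]/(sumC (dterm (dconv a c) s)).
by apply: eq_sumC => n n0; rewrite dterm_dconv.
Qed.

(** The terms of index greater than n carry an extra factor at most (n+1)^-t
    when the abscissa moves right by t. *)
Lemma dirichlet_leading c (p M t : R) n : (0 < n)%N -> 0 <= t ->
  abs_bound (dterm c p%:C) M -> (forall k, (0 < k < n)%N -> c k = 0) ->
  cabs (dirichlet_series c (p + t)%:C - dterm c (p + t)%:C n) <= rpow n.+1 t * M.
Proof.
move=> n0 t0 cM c0.
have -> : dterm c (p + t)%:C n = psum (dterm c (p + t)%:C) n.+1.
  rewrite /psum big_nat_recr//= [X in _ = X + _]big_nat_cond.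
  rewrite [X in _ = X + _]big1 ?add0r//.
  by move=> k /andP[k0 _]; rewrite /dterm c0// mul0r.
apply: sumC_tail => // N.
apply: (@le_trans _ _ (\sum_(n.+1 <= k < N) rpow n.+1 t * cabs (dterm c p%:C k))).
  rewrite [leLHS]big_nat_cond [leRHS]big_nat_cond; apply: ler_sum => k.
  rewrite andbT => /andP[nk _].
  rewrite !cabs_dterm /= rpowD mulrCA [leRHS]mulrC [leRHS]mulrC [leRHS]mulrCA.
  rewrite mulrCA [X in _ <= _ * X]mulrC ler_wpM2l ?cabs_ge0//.
  rewrite ler_wpM2l ?rpow_ge0// /rpow ler_expR !mulNr lerN2 ler_wpM2l//.
  by rewrite ler_ln ?posrE ?ltr0n// ?ler_nat// (leq_trans _ nk).
rewrite -mulr_sumr ler_wpM2l ?rpow_ge0//; apply: le_trans (cM N).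
have [Nn|nN] := leqP N n.+1.
  by rewrite big_geq// sumr_ge0// => k _; exact: cabs_ge0.
rewrite [leRHS](@big_cat_nat _ _ _ n.+1)//= ?(ltnW nN)// lerDr sumr_ge0// => k _.
exact: cabs_ge0.
Qed.

(** The ratio (n / (n+1))^t is at most 1 / (1 + t d), with d = ln (n+1) - ln n,
    hence tends to 0 as t grows. *)
Lemma rpow_ratio_lt n (x M : R) t0 : (0 < n)%N ->
  (forall t, t0 <= t -> x * rpow n t <= rpow n.+1 t * M) -> x <= 0.
Proof.
move=> n0 h; rewrite leNgt; apply/negP => x0.
pose d : R := ln n.+1%:R - ln n%:R.
have d0 : 0 < d by rewrite subr_gt0 ltr_ln ?posrE ?ltr0n// ltr_nat.
have h' t : t0 <= t -> x * expR (d * t) <= M.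
  move=> /h; rewrite (_ : rpow n t = rpow n.+1 t * expR (d * t)); last first.
    by rewrite /rpow /d -expRD; congr expR; ring.
  by rewrite mulrCA ler_pM2l ?rpow_gt0.
(* at this t, x (1 + t d) exceeds M *)
pose t := Num.max t0 (M / (x * d)).
have := h' t; rewrite le_max lexx => /(_ isT) {}h'.
have := ler_pM2l x0 (1 + d * t) (expR (d * t)); rewrite expR_ge1Dx => h1.
have h2 : x * (1 + d * t) <= M by apply: le_trans h'; rewrite h1.
have xd : 0 < x * d by rewrite mulr_gt0.
have : M / (x * d) <= t by rewrite le_max lexx orbT.
rewrite ler_pdivrMr//; nra.
Qed.

(** If n is the least index of a nonzero coefficient, the series is equivalent
    to its n-th term far to the right, hence does not vanish there. *)
Theorem dirichlet_unique c (p M t0 : R) : abs_bound (dterm c p%:C) M ->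
  (forall t, t0 <= t -> dirichlet_series c (p + t)%:C = 0) ->
  forall n, (0 < n)%N -> c n = 0.
Proof.
move=> cM c0; elim/ltn_ind => n IH n0.
suff : cabs (c n) * rpow n p <= 0.
  rewrite pmulr_lle0 ?rpow_gt0// => h; apply/eqP; rewrite -cabs_eq0.
  by rewrite eq_le h cabs_ge0.
apply: (@rpow_ratio_lt n _ M (Num.max t0 0)) => // t.
rewrite ge_max => /andP[t0t tp].
have := dirichlet_leading n0 tp cM (fun k => fun h => IH k (andP h).2 (andP h).1).
by rewrite c0// sub0r cabsN cabs_dterm /= rpowD mulrA.
Qed.

(** The series tends to its first coefficient far to the right. *)
Lemma dirichlet_to_1 c (p M : R) : abs_bound (dterm c p%:C) M -> c 1%N = 1 ->
  exists t0, forall t, t0 <= t -> dirichlet_series c (p + t)%:C != 0.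
Proof.
move=> cM c1; have M0 := abs_bound_ge0 cM.
have l2 : 0 < ln 2 :> R by rewrite ln_gt0// ltr1n.
exists (M / ln 2) => t tM; have t0 : 0 <= t by rewrite (le_trans _ tM)// divr_ge0// ltW.
apply/eqP => h0; have := @dirichlet_leading c p M t 1 isT t0 cM.
rewrite h0 sub0r cabsN cabs_dterm c1 => H.
have {}H : 1 <= rpow 2 t * M.
  have e1 : cabs (1 : C) * rpow 1 (Re (p + t)%:C) = 1.
    by rewrite /rpow ln1 mulr0 expR0 mulr1 (cabs_real 1) normr1.
  by rewrite -[leLHS]e1; apply: H => k; case: k => [|[]].
have : expR (t * ln 2) <= M.
  by rewrite -[leLHS]mulr1 (le_trans (ler_wpM2l (expR_ge0 _) H))// mulrA /rpow -expRD mulNr subrr expR0 mul1r.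
have := expR_ge1Dx (t * ln 2); move: tM; rewrite ler_pdivrMr//; lra.
Qed.

End dirichlet_series_facts.

(** * Estimates for the complex exponential *)

Section exponential_estimate.
Context {R : realType}.
Local Notation C := R[i].
Implicit Types (x y : R) (z : C).

Lemma MVT_bound (f df : R -> R) x (M : R) : f 0 = 0 ->
  (forall t, is_derive t (1 : R) f (df t)) -> (forall t, `|t| <= `|x| -> `|df t| <= M) ->
  `|f x| <= M * `|x|.
Proof.
move=> f0 fd dfM.
have cf : continuous f.
  move=> t; apply: differentiable_continuous; apply/derivable1_diffP.
  by case: (fd t).
have [x0|x0] := leP 0 x.
  have [|c] := @MVT_segment R f df 0 x x0 (fun t _ => fd t).
    exact: continuous_subspaceT.
  rewrite in_itv /= => /andP[c0 cx]; rewrite f0 !subr0 => ->.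
  rewrite normrM ler_wpM2r// dfM// !ger0_norm//.
have [|c] := @MVT_segment R f df x 0 (ltW x0) (fun t _ => fd t).
  exact: continuous_subspaceT.
rewrite in_itv /= => /andP[cx c0]; rewrite f0 !sub0r => /(congr1 Num.norm).
rewrite normrM !normrN => ->; rewrite ler_wpM2r// dfM// !ler0_norm ?(ltW x0)//.
by rewrite lerN2.
Qed.

Lemma cos_sub1_le y : `|cos y - 1| <= `|y|.
Proof.
have := @MVT_bound (fun t => cos t - 1) (fun t => - sin t) y 1.
rewrite mul1r; apply.
- by rewrite cos0 subrr.
- move=> t; have := is_deriveB (is_derive_cos t) (is_derive_cst (1 : R) t 1).
  by rewrite subr0.
- by move=> t _; rewrite normrN sin_max.
Qed.

Lemma cos_sub1_le2 y : `|cos y - 1| <= y ^+ 2.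
Proof.
have := @MVT_bound (fun t => cos t - 1) (fun t => - sin t) y `|y|.
rewrite -expr2 real_normK ?num_real//; apply.
- by rewrite cos0 subrr.
- move=> t; have := is_deriveB (is_derive_cos t) (is_derive_cst (1 : R) t 1).
  by rewrite subr0.
- move=> t ty; rewrite normrN; apply: le_trans ty.
  have := @MVT_bound sin cos t 1; rewrite mul1r; apply; first exact: sin0.
  by move=> u _; exact: cos_max.
Qed.

Lemma sin_sub_le2 y : `|sin y - y| <= y ^+ 2.
Proof.
have := @MVT_bound (fun t => sin t - t) (fun t => cos t - 1) y `|y|.
rewrite -expr2 real_normK ?num_real//; apply.
- by rewrite sin0 subrr.
- by move=> t ty; apply: le_trans ty; exact: cos_sub1_le.
Qed.

Lemma expR_sub1_le x : `|expR x - 1| <= `|x| * expR `|x|.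
Proof.
have h1 := expR_ge1Dx x; have h2 := expR_ge1Dx (- x).
have e0 := expR_gt0 x; have ee : expR (- x) * expR x = 1 by rewrite -expRD addNr expR0.
have [x0|x0] := leP 0 x.
  by rewrite (ger0_norm x0) ger0_norm; [nra|lra].
have h3 : 1 <= expR (- x) by lra.
by rewrite (ltr0_norm x0) ler0_norm; nra.
Qed.

Lemma expR_sub1D_le x : `|expR x - 1 - x| <= x ^+ 2 * expR `|x|.
Proof.
have h1 := expR_ge1Dx x; have h2 := expR_ge1Dx (- x).
have e0 := expR_gt0 x; have ee : expR (- x) * expR x = 1 by rewrite -expRD addNr expR0.
rewrite ger0_norm; last lra.
have [x0|x0] := leP 0 x; last rewrite (ltr0_norm x0).
  rewrite (ger0_norm x0); have : expR x - 1 <= x * expR x by nra.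
  by rewrite expr2; nra.
have h3 : 1 <= expR (- x) by lra.
have : expR x <= 1 by nra.
have : x * x <= x * x * expR (- x) by nra.
by rewrite expr2; nra.
Qed.

(** A second order estimate valid for all z: it is applied to z = - h ln n with
    n arbitrarily large, so that a local expansion at 0 would not do. *)
Lemma cexp_taylor z : cabs (cexp z - 1 - z) <= 4 * (cabs z ^+ 2 * expR (cabs z)).
Proof.
rewrite (le_trans (cabs_le_ReIm _))//.
have := Re_le_cabs z; have := Im_le_cabs z; have := sqr_cabs z.
case: z => x y; rewrite /sqmod /=; set r := cabs _; rewrite mul0r subr0 mul0r addr0 subr0.
move=> rE yr xr.
have r0 : 0 <= r by exact: cabs_ge0.
have e1 : expR `|x| <= expR r by rewrite ler_expR.
have er1 : 1 <= expR r by rewrite -expR0 ler_expR.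
have ex : expR x <= expR r by rewrite ler_expR (le_trans (ler_norm x)).
have ex0 := expR_ge0 x.
have y2 : y ^+ 2 <= r ^+ 2 by rewrite rE lerDr sqr_ge0.
have x2 : x ^+ 2 <= r ^+ 2 by rewrite rE lerDl sqr_ge0.
have -> : expR x * cos y - 1 - x = expR x * (cos y - 1) + (expR x - 1 - x) by ring.
have -> : expR x * sin y - y = expR x * (sin y - y) + (expR x - 1) * y by ring.
have H (p q : R) : `|expR x * p| <= expR r * r ^+ 2 -> `|q| <= expR r * r ^+ 2 ->
   `|expR x * p + q| <= 2 * (r ^+ 2 * expR r).
  by move=> ? ?; rewrite (le_trans (ler_normD _ _))//; lra.
have E (p : R) : `|p| <= y ^+ 2 -> `|expR x * p| <= expR r * r ^+ 2.
  move=> py; rewrite normrM (ger0_norm ex0) ler_pM//.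
  exact: le_trans py y2.
have -> : 4 * (r ^+ 2 * expR r) = 2 * (r ^+ 2 * expR r) + 2 * (r ^+ 2 * expR r) by ring.
apply: lerD; apply: H.
- exact/E/cos_sub1_le2.
- rewrite (le_trans (expR_sub1D_le x))// mulrC ler_pM ?expR_ge0 ?sqr_ge0//.
- exact/E/sin_sub_le2.
- rewrite normrM (le_trans (ler_wpM2r _ (expR_sub1_le x)))//.
  rewrite mulrAC mulrC expr2 ler_pM ?expR_ge0 ?mulr_ge0// ler_pM//.
Qed.

End exponential_estimate.

(** * Holomorphy of Dirichlet series *)

Section holomorphy.
Context {R : realType}.
Local Notation C := R[i].

Lemma quadratic_derivable (f : C -> C) (s l : C) (d K : R) : 0 < d ->
  (forall h, cabs h <= d -> cabs (f (h + s) - f s - h * l) <= K * cabs h ^+ 2) ->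
  derivable (f : C^o -> C^o) s 1.
Proof.
move=> d0 hf; apply/cvg_ex; exists l; apply/cvgrPdist_le => e e0.
have [r r0 re] : exists2 r : R, 0 < r & e = r%:C.
  move: e0; rewrite ltcE /= => /andP[/eqP e1 e2]; exists (Re e) => //.
  by case: e e1 e2 => a b /= -> _.
pose k := Num.min d (r / (`|K| + 1)).
have K1 : 0 < `|K| + 1 by rewrite ltr_wpDl.
have k0 : 0 < k by rewrite lt_min d0 divr_gt0.
near=> h.
have h0 : h != 0 by near: h; exact: nbhs_dnbhs_neq.
have hk : cabs h <= k.
  rewrite -lecR -normC_cabs; near: h; apply: dnbhs0_le.
  by rewrite ltcR.
have ch0 : 0 < cabs h by rewrite lt_def cabs_eq0 h0 cabs_ge0.
have [hd hr] : cabs h <= d /\ cabs h <= r / (`|K| + 1).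
  by move: hk; rewrite le_min => /andP.
rewrite re normC_cabs lecR -(ler_pM2l ch0) -cabsM.
have -> : h * (l - h^-1 *: (f (h *: 1 + s) - f s)) = - (f (h + s) - f s - h * l).
  have -> : h *: 1 = h :> C^o by rewrite /GRing.scale /= mulr1.
  have -> : h^-1 *: (f (h + s) - f s : C^o) = h^-1 * (f (h + s) - f s) by [].
  by field.
rewrite cabsN (le_trans (hf h hd))// expr2 mulrCA ler_pM2l//.
rewrite (le_trans (ler_wpM2r (cabs_ge0 _) (ler_norm K)))//.
move: hr; rewrite ler_pdivlMr// mulrDr mulr1 mulrC; have := ltW ch0; lra.
Unshelve. all: by end_near.
Qed.

(** The series is differentiated termwise.  By the estimate on the exponential,
    the error in the n-th term is O(|h|^2 (ln n)^2 n^|h|) times that term.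
    For |h| <= d, both (ln n)^2 and n^|h| are O(n^d); the errors remain summable
    since d is small enough for Re s - 2d to exceed 1/2. *)
Theorem dirichlet_holomorphic (c : nat -> C) : l2 c -> holomorphic (dirichlet_series c).
Proof.
move=> c2 s hs; pose d : R := (Re s - 2^-1) / 4.
have hs' : 2^-1 < Re s by [].
have d0 : 0 < d by rewrite divr_gt0// subr_gt0.
have sd : 2^-1 < Re s - (d + d) by rewrite /d; lra.
have sd1 : 2^-1 < Re s - d by rewrite /d; lra.
have [M2 hM2] := l2_weighted c2 sd.
have [M1 hM1] := l2_weighted c2 sd1.
have [M hM] := l2_dterm c2 hs.
pose L n : R := ln n%:R; have L0 n : 0 <= L n by exact: ln_nat_ge0.
have rpowB n p q : rpow n (p - q) = rpow n p * expR (q * L n).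
  by rewrite /rpow -expRD; congr expR; rewrite /L; ring.
have eL n : d * L n <= expR (d * L n).
  by apply: le_trans (expR_ge1Dx _); rewrite lerDr.
have eL2 n : (d * L n) ^+ 2 <= 4 * expR (d * L n).
  have := expR_ge1Dx (d * L n / 2); have p0 : 0 <= d * L n / 2 by rewrite divr_ge0// mulr_ge0// ltW.
  have -> : expR (d * L n) = expR (d * L n / 2) * expR (d * L n / 2).
    by rewrite -expRD; congr expR; field.
  rewrite expr2; nra.
pose g n : C := - (L n)%:C * dterm c s n.
have gM : abs_bound g (d^-1 * M1).
  move=> N; apply: (@le_trans _ _ (d^-1 * \sum_(1 <= n < N) cabs (c n) * rpow n (Re s - d))); last first.
    by rewrite ler_wpM2l// invr_ge0 ltW.
  rewrite mulr_sumr; apply: ler_sum => n _.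
  rewrite cabsM cabsN cabs_real ger0_norm// cabs_dterm rpowB ler_pdivlMl//.
  have := ler_wpM2l (mulr_ge0 (cabs_ge0 (c n)) (rpow_ge0 n (Re s))) (eL n).
  by congr (_ <= _); ring.
apply: (@quadratic_derivable _ s (sumC g) d (16 / d ^+ 2 * M2)) => // h hd.
have hsh : half_plane (h + s).
  rewrite /half_plane /=; have := le_trans (Re_le_cabs h) hd.
  rewrite ler_norml => /andP[h1 _].
  have -> : Re (h + s) = Re h + Re s by case: (h) (s) => [? ?] [].
  lra.
have [M' hM'] := l2_dterm c2 hsh.
have bnd1 : abs_bound (fun n => -1 * dterm c s n + dterm c (h + s) n) (M + M').
  move=> N; apply: le_trans (lerD (hM N) (hM' N)); rewrite -big_split /=.
  by apply: ler_sum => n _; rewrite mulN1r (le_trans (cabsD _ _))// cabsN.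
have -> : dirichlet_series c (h + s) - dirichlet_series c s - h * sumC g =
    sumC (fun n => - h * g n + (-1 * dterm c s n + dterm c (h + s) n)).
  rewrite (sumC_lin _ gM bnd1) (sumC_lin _ hM hM').
  rewrite -[dirichlet_series c (h + s)]/(sumC (dterm c (h + s))).
  by rewrite -[dirichlet_series c s]/(sumC (dterm c s)); ring.
set u := fun n => _.
have uE n : u n = dterm c s n * (cexp (- h * (L n)%:C) - 1 - (- h * (L n)%:C)).
  rewrite /u /g /dterm.
  have -> : npow n (h + s) = npow n s * cexp (- h * (L n)%:C).
    by rewrite /npow -cexpD; congr cexp; rewrite /L; ring.
  by ring.
rewrite -[sumC u]subr0.
have -> : 0 = psum u 1 by rewrite /psum big_geq.
apply: sumC_tail => // N.
apply: (@le_trans _ _ (\sum_(1 <= n < N) 16 / d ^+ 2 * cabs h ^+ 2 * (cabs (c n) * rpow n (Re s - (d + d))))); last first.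
  by rewrite -mulr_sumr mulrAC ler_wpM2r ?sqr_ge0// ler_wpM2l// divr_ge0 ?sqr_ge0.
apply: ler_sum => n _; rewrite uE cabsM cabs_dterm rpowB.
rewrite (le_trans (ler_wpM2l _ (cexp_taylor _)))//.
  by rewrite mulr_ge0 ?cabs_ge0 ?rpow_ge0.
rewrite cabsM cabsN cabs_real (ger0_norm (L0 n)).
set r := cabs h; set E := expR (d * L n).
have r0 : 0 <= r := cabs_ge0 h.
have E1 : expR (r * L n) <= E by rewrite ler_expR ler_wpM2r.
have -> : expR ((d + d) * L n) = E * E by rewrite -expRD; congr expR; ring.
have L2 : L n ^+ 2 <= 4 / d ^+ 2 * E.
  by rewrite mulrAC ler_pdivlMr ?exprn_gt0// mulrC -exprMn; exact: eL2.
have E0 : 0 <= E by exact: expR_ge0.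
have key : 4 * ((r * L n) ^+ 2 * expR (r * L n)) <= 16 / d ^+ 2 * r ^+ 2 * (E * E).
  apply: (@le_trans _ _ (4 * (r ^+ 2 * (4 / d ^+ 2 * E)) * E)).
    rewrite -mulrA ler_wpM2l// ler_pM ?expR_ge0 ?sqr_ge0// exprMn.
    by rewrite ler_wpM2l ?sqr_ge0.
  by rewrite le_eqVlt; apply/orP; left; apply/eqP; field; rewrite gt_eqF.
have := ler_wpM2l (mulr_ge0 (cabs_ge0 (c n)) (rpow_ge0 n (Re s))) key.
by congr (_ <= _); ring.
Qed.

End holomorphy.

(** * Uniform boundedness by a gliding hump *)

Section gliding_hump.
Context {R : realType}.
Local Notation C := R[i].
Implicit Types (c u v x : nat -> C).

Definition energy c N : R := \sum_(1 <= n < N) sqmod (c n).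

Lemma energy_ge0 c N : 0 <= energy c N.
Proof. by apply: sumr_ge0 => n _; exact: sqmod_ge0. Qed.

Lemma energy_mono c m n : (m <= n)%N -> energy c m <= energy c n.
Proof. by apply: partial_sum_mono => k; exact: sqmod_ge0. Qed.

Lemma eq_energy u v N : (forall n, (0 < n < N)%N -> u n = v n) -> energy u N = energy v N.
Proof. by move=> uv; apply: eq_big_nat => n nN; rewrite uv. Qed.

Lemma energyS c n : energy c n.+2 = energy c n.+1 + sqmod (c n.+1).
Proof. by rewrite /energy big_nat_recr. Qed.

Lemma energyD_le u v N :
  energy (fun n => u n + v n) N <= 2 * energy u N + 2 * energy v N.
Proof.
rewrite /energy !mulr_sumr -big_split /=; apply: ler_sum => n _; exact: sqmodD.
Qed.

Lemma energyZ (z : C) u N : energy (fun n => z * u n) N = sqmod z * energy u N.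
Proof. by rewrite /energy mulr_sumr; apply: eq_bigr => n _; rewrite sqmodM. Qed.

Lemma energy_parallelogram u v N :
  energy (fun n => u n + v n) N + energy (fun n => u n - v n) N =
  2 * energy u N + 2 * energy v N.
Proof.
rewrite /energy !mulr_sumr -!big_split /=; apply: eq_bigr => n _.
by case: (u n) (v n) => [a b] [p q]; rewrite /sqmod /=; ring.
Qed.

Lemma energy_stable c m n : (0 < m <= n)%N -> (forall k, (m <= k)%N -> c k = 0) ->
  energy c n = energy c m.
Proof.
move=> /andP[m0 mn] c0; rewrite /energy (@big_cat_nat _ _ _ m)//= [X in _ + X]big_nat_cond.
rewrite [X in _ + X]big1 ?addr0// => k /andP[/andP[mk _] _].
by rewrite c0// sqmod0.
Qed.

Definition dirac_seq (i n : nat) : C := (n == i)%:R.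

Lemma l2_dirac_seq i : l2 (dirac_seq i).
Proof.
exists 1 => N; have [iN|Ni] := boolP (i \in index_iota 1 N).
  rewrite (bigD1_seq i) ?iota_uniq//= big1 => [|n /negbTE ni].
    by rewrite /dirac_seq eqxx /sqmod /= expr1n expr0n addr0 addr0.
  by rewrite /dirac_seq ni sqmod0.
rewrite big1_seq => [|n /= nN]; first exact: ler01.
rewrite /dirac_seq; case: eqP => [e|_]; first by rewrite -e nN in Ni.
by rewrite sqmod0.
Qed.

(** A linear map on sequences given by a lower triangular matrix: the value at n
    depends on the entries of index at most n.  If it preserves square
    summability it is bounded.  This is an instance of the uniform boundedness
    principle, but triangularity permits a construction without limits of
    vectors: the humps have disjoint supports, so that their energies add up
    exactly, and a hump does not affect the image below its support. *)
Variable T : (nat -> C) -> nat -> C.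
Hypothesis T_lin : forall z u v n, T (fun k => z * u k + v k) n = z * T u n + T v n.
Hypothesis T_local : forall u v n, (forall k, (0 < k <= n)%N -> u k = v k) -> T u n = T v n.
Hypothesis T_l2 : forall c, l2 c -> l2 (T c).

Let T0 u n : (forall k, (0 < k <= n)%N -> u k = 0) -> T u n = 0.
Proof.
move=> u0; rewrite (_ : T u n = T (fun k => -1 * u k + u k) n).
  by rewrite T_lin mulN1r addNr.
by apply: T_local => k /u0 ->; rewrite mulr0 addr0.
Qed.

Let TD u v n : T (fun k => u k + v k) n = T u n + T v n.
Proof.
rewrite -[T u n]mul1r -T_lin; congr T.
by apply/funext => k; rewrite mul1r.
Qed.

Let head c (m n : nat) : C := if (n < m)%N then c n else 0.
Let tail c (m n : nat) : C := if (n < m)%N then 0 else c n.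

Let headD c m n : c n = head c m n + tail c m n.
Proof. by rewrite /head /tail; case: ifP; rewrite ?addr0 ?add0r. Qed.

(** Restricted to sequences supported below m, the operator has finite rank and
    its range is spanned by the images of finitely many unit vectors. *)
Lemma head_bound m : exists2 H, 0 <= H &
  forall c N, energy (T (head c m)) N <= H * energy c m.
Proof.
elim: m => [|m [H H0 hH]].
  exists 0 => // c N; rewrite mul0r /energy big_nat_cond big1// => n _.
  by rewrite T0 ?sqmod0// => k _; rewrite /head.
case: m hH => [|m] hH.
  exists 0 => // c N; rewrite mul0r /energy big_nat_cond big1// => n _.
  by rewrite T0 ?sqmod0// => -[].
have [B hB] := T_l2 (l2_dirac_seq m.+1).
have B0 : 0 <= B by have := hB 0%N; rewrite big_geq.
exists (2 * B + 2 * H) => [|c N]; first by rewrite addr_ge0// mulr_ge0.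
have E : T (head c m.+2) = fun n => c m.+1 * T (dirac_seq m.+1) n + T (head c m.+1) n.
  apply/funext => n; rewrite -T_lin; congr T; apply/funext => k.
  rewrite /head /dirac_seq ltnS leq_eqVlt; case: eqP => [->|_] /=.
    by rewrite ltnn mulr1 addr0.
  by rewrite mulr0 add0r.
rewrite E (le_trans (energyD_le _ _ _))// energyZ energyS.
have h1 := hH c N; have h2 : energy (T (dirac_seq m.+1)) N <= B := hB N.
have h3 := energy_ge0 c m.+1; have h4 := sqmod_ge0 (c m.+1).
have h5 := ler_wpM2l h4 h2; nra.
Qed.

Section unbounded.
Hypothesis unbounded : forall M, exists c N, M * energy c N < energy (T c) N.

(** Unboundedness cannot come from the entries below m, where the operator is
    bounded; it persists on sequences supported beyond m. *)
Lemma far_hump m (e K : R) : 0 < e -> 0 <= K -> exists u N,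
  [/\ (m < N)%N, (forall n, (n < m)%N \/ (N <= n)%N -> u n = 0),
      energy u N <= e & K <= energy (T u) N].
Proof.
move=> e0 K0; have [H H0 hH] := head_bound m.
have [c0 [N0 hc]] := unbounded (2 * H + 2 * (K / e)).
pose N := (maxn N0 m.+1); pose c := head c0 N0.
have N00 : (0 < N0)%N.
  by case: N0 hc {N c} => // ; rewrite /energy !big_geq// mulr0 ltxx.
have cE : energy c N = energy c0 N0.
  rewrite (@energy_stable c N0)//; last by move=> k Nk; rewrite /c /head ltnNge Nk.
    by apply: eq_energy => n /andP[_ nN]; rewrite /c /head nN.
  by rewrite N00 leq_maxl.
have TcE : energy (T c0) N0 <= energy (T c) N.
  rewrite (_ : energy (T c0) N0 = energy (T c) N0); first by rewrite energy_mono ?leq_maxl.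
  apply: eq_energy => n /andP[_ nN]; apply: T_local => k /andP[_ kn].
  by rewrite /c /head (leq_ltn_trans kn nN).
pose t := tail c m; set S := energy c0 N0 in hc cE.
have TtE : (K / e) * S < energy (T t) N.
  have h1 : energy (T c) N <= 2 * energy (T (head c m)) N + 2 * energy (T t) N.
    apply: le_trans (energyD_le _ _ _); rewrite le_eqVlt; apply/orP; left; apply/eqP.
    apply: eq_energy => n _; rewrite -TD; congr T; apply/funext => k.
    exact: headD.
  have h2 := hH c N; have h3 : energy c m <= S.
    by rewrite -cE energy_mono// (leq_trans (leqnSn m))// leq_maxr.
  have h4 := ler_wpM2l H0 h3; lra.
have S0 : 0 < S.
  rewrite lt_def energy_ge0 andbT; apply/eqP => S0.
  have c0' n : (0 < n < N)%N -> c n = 0.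
    move=> nN; have : energy c N = 0 by rewrite cE.
    rewrite /energy big_nat_cond => /eqP.
    rewrite psumr_eq0 => [|k _]; last exact: sqmod_ge0.
    move=> /allP /(_ n); rewrite mem_index_iota => /(_ nN); rewrite nN /=.
    case: (c n) => a b; rewrite /sqmod /= paddr_eq0 ?sqr_ge0// !sqrf_eq0.
    by move=> /andP[/eqP -> /eqP ->].
  move: TtE; rewrite S0 mulr0 /energy big_nat_cond big1 ?ltxx// => n /andP[/andP[n0 nN] _].
  rewrite T0 ?sqmod0// => k /andP[k0 kn].
  by rewrite /t /tail; case: ifP => // _; rewrite c0'// k0 (leq_ltn_trans kn nN).
(* the hump is normalized to have energy at most e *)
pose z : C := (Num.sqrt (e / S))%:C.
have zE : sqmod z = e / S.
  by rewrite sqmod_real sqr_sqrtr// divr_ge0// ltW.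
have TZ u n : T (fun k => z * u k) n = z * T u n.
  rewrite -[RHS]addr0 -(@T0 (fun=> 0) n)// -T_lin; congr T.
  by apply/funext => k; rewrite addr0.
exists (fun n => z * t n), N; split.
- by rewrite leq_maxr.
- move=> n; rewrite /t /tail /c /head => -[->|Nn]; first by rewrite mulr0.
  case: ifP => _; first by rewrite mulr0.
  by rewrite ltnNge (leq_trans (leq_maxl _ _) Nn) mulr0.
- have SS : e / S * S = e by rewrite mulfVK ?gt_eqF.
  rewrite energyZ zE -[leRHS]SS ler_wpM2l ?divr_ge0 ?(ltW e0) ?(ltW S0)//.
  rewrite -cE; apply: ler_sum => n _; rewrite /t /tail; case: ifP => // _.
  by rewrite sqmod0 sqmod_ge0.
- rewrite (_ : T _ = fun n => z * T t n); last by apply/funext => n; exact: TZ.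
  rewrite energyZ zE; have eS : 0 <= e / S by rewrite divr_ge0 ?ltW.
  apply: le_trans (ler_wpM2l eS (ltW TtE)).
  by rewrite le_eqVlt; apply/orP; left; apply/eqP; field; rewrite !gt_eqF.
Qed.

Let valid (st : (nat -> C) * nat) :=
  (0 < st.2)%N /\ forall n, (st.2 <= n)%N -> st.1 n = 0.

(** The image of a hump may cancel the image obtained so far, but by the
    parallelogram identity one of the sum and the difference has an image of
    energy at least that of the image of the hump. *)
Lemma next_hump st k : exists st' : (nat -> C) * nat, valid st ->
  [/\ valid st', (st.2 < st'.2)%N, (forall n, (n < st.2)%N -> st'.1 n = st.1 n),
      energy st'.1 st'.2 <= energy st.1 st.2 + 2^-1 ^+ k &
      k%:R <= energy (T st'.1) st'.2].
Proof.
have [vst|nvst] := pselect (valid st); last by exists st.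
case: st vst => x N [/= N0 vx].
have [|//|u [N' [NN' u0 uE TuE]]] := @far_hump N (2^-1 ^+ k) k%:R.
  by rewrite exprn_gt0.
have choice (s : C) : sqmod s = 1 -> let y := fun n => x n + s * u n in
    [/\ valid (y, N'), (N < N')%N, (forall n, (n < N)%N -> y n = x n) &
      energy y N' <= energy x N + 2^-1 ^+ k].
  move=> s1; split => //= [|n nN|].
  - split => /= [|n Nn]; first exact: leq_ltn_trans NN'.
    by rewrite vx ?(leq_trans (ltnW NN'))// u0 ?mulr0 ?addr0//; right.
  - by rewrite u0 ?mulr0 ?addr0//; left.
  rewrite (_ : energy _ N' = energy x N' + energy (fun n => s * u n) N').
    rewrite energyZ s1 mul1r lerD//.
    by rewrite (@energy_stable x N) ?N0 ?(ltnW NN').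
  rewrite /energy -big_split /=; apply: eq_bigr => n _.
  have [nN|Nn] := ltnP n N; last by rewrite vx// add0r /sqmod /= !expr0n /= !add0r.
  by rewrite u0 ?mulr0 ?addr0 /sqmod /= ?expr0n /= ?addr0//; left.
have P := energy_parallelogram (T x) (T u) N'.
have Tx := energy_ge0 (T x) N'.
have [h|h] := leP k%:R (energy (fun n => T x n + T u n) N').
  have [] := choice 1; first exact: sqmod1.
  move=> v1 v2 v3 v4; exists ((fun n => x n + 1 * u n), N') => _; split => //=.
  apply: le_trans h _; rewrite le_eqVlt; apply/orP; left; apply/eqP.
  apply: eq_energy => n _; rewrite -TD; congr T; apply/funext => j; by rewrite mul1r.
have [] := choice (-1); first by rewrite sqmodN sqmod1.
move=> v1 v2 v3 v4; exists ((fun n => x n + (-1) * u n), N') => _; split => //=.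
apply: (@le_trans _ _ (energy (fun n => T x n - T u n) N')); first lra.
rewrite le_eqVlt; apply/orP; left; apply/eqP.
apply: eq_energy => n _; transitivity (-1 * T u n + T x n).
  by rewrite mulN1r addrC.
rewrite -T_lin; congr T.
by apply/funext => j; rewrite addrC.
Qed.

Let next st k := projT1 (cid (next_hump st k)).

Let nextP st k := projT2 (cid (next_hump st k)).

Fixpoint humps k : (nat -> C) * nat :=
  if k is j.+1 then next (humps j) j else ((fun=> 0), 1%N).

Lemma humps_valid k : valid (humps k).
Proof. by elim: k => [//|k IH]; have [] := nextP k IH. Qed.

Lemma leq_humps k : (k < (humps k).2)%N.
Proof.
elim: k => [//|k IH]; have [_ h _ _ _] := nextP k (humps_valid k).
exact: leq_ltn_trans h.
Qed.

Lemma humps_mono k l : (k <= l)%N -> ((humps k).2 <= (humps l).2)%N /\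
  forall n, (n < (humps k).2)%N -> (humps l).1 n = (humps k).1 n.
Proof.
elim: l => [|l IH]; first by rewrite leqn0 => /eqP ->.
rewrite leq_eqVlt => /predU1P[->//|]; rewrite ltnS => /IH[h1 h2].
have [_ h h3 _ _] := nextP l (humps_valid l); split.
  exact: leq_trans h1 (ltnW h).
by move=> n nk; rewrite h3 ?h2// (leq_trans nk).
Qed.

Lemma humps_energy k : energy (humps k).1 (humps k).2 <= 2 - 2 * 2^-1 ^+ k.
Proof.
elim: k => [|k IH]; first by rewrite /energy big_geq// expr0 mulr1 subrr.
have [_ _ _ h _] := nextP k (humps_valid k).
by apply: (le_trans h); move: IH; rewrite exprS; lra.
Qed.

Lemma unbounded_absurd : False.
Proof.
pose c n := (humps n).1 n.
have cE k n : (n < (humps k).2)%N -> c n = (humps k).1 n.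
  rewrite /c => nk; have [kn|nk'] := leqP k n; first by have [_ ->] := humps_mono kn.
  by have [_ ->] := humps_mono (ltnW nk'); rewrite ?leq_humps.
have c2 : l2 c.
  exists 2 => N; apply: (@le_trans _ _ (energy c (humps N).2)).
    by rewrite energy_mono// ltnW// leq_humps.
  rewrite (@eq_energy c (humps N).1) => [|n /andP[_ nN]]; last exact: cE.
  by rewrite (le_trans (humps_energy N))// gerBl mulr_ge0// exprn_ge0.
have [M hM] := T_l2 c2.
have key k : k%:R <= M.
  apply: le_trans (hM (humps k.+1).2); rewrite -/(energy _ _).
  have [_ _ _ _ h] := nextP k (humps_valid k).
  apply: (le_trans h); rewrite le_eqVlt; apply/orP; left; apply/eqP.
  apply: eq_energy => n /andP[_ nN]; apply: T_local => j /andP[_ jn].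
  by rewrite (cE k.+1)// (leq_ltn_trans jn).
have := key (Num.truncn M).+1; rewrite leNgt => /negP; apply.
exact: truncnS_gt.
Qed.

End unbounded.

Theorem local_operator_bounded :
  exists M, forall c N, energy (T c) N <= M * energy c N.
Proof.
apply: contrapT => h; apply: unbounded_absurd => M.
apply: contrapT => hM; apply: h; exists M => c N.
by rewrite leNgt; apply/negP => lt; apply: hM; exists c, N.
Qed.

End gliding_hump.

(** * Convolution operators *)

Section dirichlet_algebra.
Context {R : realType}.
Local Notation C := R[i].
Implicit Types (a b c d : nat -> C) (s : C).

Lemma dconv_local a u v n : (forall k, (0 < k <= n)%N -> u k = v k) ->
  dconv a u n = dconv a v n.
Proof.
move=> uv; rewrite /dconv big_nat_cond [RHS]big_nat_cond; apply: eq_bigr => j.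
move=> /andP[/andP[j0 jn] /dvdnP[q nq]]; rewrite nq mulnK// uv//.
rewrite nq leq_pmulr// andbT.
by case: q nq => // nq; move: jn; rewrite nq mul0n ltnS leqNgt j0.
Qed.

Lemma dconv_linr a (z : C) u v n :
  dconv a (fun k => z * u k + v k) n = z * dconv a u n + dconv a v n.
Proof.
rewrite /dconv mulr_sumr -big_split /=; apply: eq_bigr => j _.
by rewrite mulrDr mulrCA.
Qed.

Lemma dirichlet_dirac1 s : dirichlet_series (dirac_seq 1) s = 1.
Proof.
apply: (@sumC_unique R (dterm (dirac_seq 1) s)) => e e0; exists 2 => n n2.
rewrite /psum (bigD1_seq 1%N) ?iota_uniq ?mem_index_iota//= big1 => [|k /negbTE k1]; last first.
  by rewrite /dterm /dirac_seq k1 mul0r.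
rewrite addr0 /dterm mul1r /npow ln1 mulr0 /cexp /= expR0 cos0 sin0.
by rewrite (_ : _ * _ = 1) ?subrr ?cabs0 ?ltW// mul1r.
Qed.

Definition half_plane_abs c := forall s, half_plane s -> exists M, abs_bound (dterm c s) M.

Lemma l2_half_plane_abs c : l2 c -> half_plane_abs c.
Proof. by move=> c2 s; exact: l2_dterm. Qed.

Lemma dconv_half_plane_abs a c : l2 a -> l2 c -> half_plane_abs (dconv a c).
Proof.
move=> a2 c2 s hs; have [M aM] := l2_dterm a2 hs; have [M' cM] := l2_dterm c2 hs.
by exists (M * M'); exact: abs_bound_dterm_dconv.
Qed.

Lemma half_plane_1D (t : R) : 0 <= t -> half_plane (1 + t)%:C.
Proof. by move=> t0; rewrite /half_plane /=; lra. Qed.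

(** Equality far to the right suffices; for the reciprocal of a series this is
    the region where the series is known not to vanish. *)
Theorem dirichlet_inj c d (t0 : R) : half_plane_abs c -> half_plane_abs d ->
  (forall t, t0 <= t -> dirichlet_series c (1 + t)%:C = dirichlet_series d (1 + t)%:C) ->
  forall n, (0 < n)%N -> c n = d n.
Proof.
move=> hc hd cd n n0; apply/eqP; rewrite -subr_eq0; apply/eqP.
pose e k := -1 * d k + c k.
have eE s k : dterm e s k = -1 * dterm d s k + dterm c s k by rewrite /dterm /e; ring.
have h1 : half_plane (1%:C : C) by rewrite /half_plane /=; lra.
have [M cM] := hc _ h1; have [M' dM] := hd _ h1.
have eM : abs_bound (dterm e 1%:C) (M' + M).
  move=> N; apply: le_trans (lerD (dM N) (cM N)); rewrite -big_split /=.
  by apply: ler_sum => k _; rewrite eE mulN1r (le_trans (cabsD _ _))// cabsN.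
have -> : c n - d n = e n by rewrite /e; ring.
apply: (@dirichlet_unique R e 1 (M' + M) (Num.max t0 0)) => // t.
rewrite ge_max => /andP[t0t tp]; have hs := half_plane_1D tp.
have [N cN] := hc _ hs; have [N' dN] := hd _ hs.
have -> : dirichlet_series e (1 + t)%:C =
    sumC (fun k => -1 * dterm d (1 + t)%:C k + dterm c (1 + t)%:C k).
  by apply: eq_sumC => k _; rewrite -/(dterm _ _ _) eE.
rewrite (sumC_lin _ dN cN) -[sumC (dterm d _)]/(dirichlet_series d (1 + t)%:C).
by rewrite -[sumC (dterm c _)]/(dirichlet_series c (1 + t)%:C) cd// mulN1r addNr.
Qed.

Lemma eq_l2 c d : (forall n, (0 < n)%N -> c n = d n) -> l2 c -> l2 d.
Proof.
move=> cd [M hM]; exists M => N; rewrite -/(energy d N) -(@eq_energy _ c d) => [|n /andP[n0 _]]; first exact: hM.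
exact: cd.
Qed.

Lemma energy_ord c N : energy c N.+1 = \sum_(i < N) sqmod (c i.+1).
Proof. by rewrite /energy big_add1 /= big_mkord. Qed.

Lemma dconv_bounded a : (forall c, l2 c -> l2 (dconv a c)) ->
  exists M, forall c N, energy (dconv a c) N <= M * energy c N.
Proof.
apply: local_operator_bounded; first exact: dconv_linr.
by move=> u v n; exact: dconv_local.
Qed.

End dirichlet_algebra.

Section operators.
Context {R : realType}.
Local Notation C := R[i].
Local Notation linl := (@L2dot_linl R).
Local Notation dotC := (@L2dotC R).
Local Notation dot_ge0 := (@L2dot_ge0 R).
Local Notation ons := (@sine_orthonormal R).

Lemma bounded_of_nrm2 (L : L2 R -> L2 R) (M : R) :
  (forall v, nrm2 L2dot (L v) <= M * nrm2 L2dot v) -> bounded_operator L2dot L.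
Proof.
move=> h; exists (Num.sqrt `|M|) => v; rewrite !hnormE -sqrtrM//.
rewrite ler_sqrt ?mulr_ge0// ?(nrm2_ge0 dot_ge0)// (le_trans (h v))//.
by rewrite ler_wpM2r ?ler_norm// (nrm2_ge0 dot_ge0).
Qed.

Lemma nrm2_of_bounded (L : L2 R -> L2 R) : bounded_operator L2dot L ->
  exists M, 0 <= M /\ forall v, nrm2 L2dot (L v) <= M * nrm2 L2dot v.
Proof.
move=> [M h]; exists (M ^+ 2); split => [|v]; first exact: sqr_ge0.
have := h v; rewrite !hnormE => hv.
have n0 := nrm2_ge0 dot_ge0.
rewrite -[leLHS]sqr_sqrtr// -[X in _ * X]sqr_sqrtr// -exprMn.
by rewrite ler_sqr ?nnegrE ?sqrtr_ge0// (le_trans (sqrtr_ge0 _) hv).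
Qed.

Lemma hat_lin (z : C) (u v : L2 R) n : hat (z *: u + v) n = z * hat u n + hat v n.
Proof. exact: linl. Qed.

(** The sequence of coefficients determines the image by completeness of the
    sine system, whence linearity; it exists by the Riesz-Fischer theorem. *)
Theorem convolution_operator (t : nat -> C) (M : R) :
  (forall c N, energy (dconv t c) N <= M * energy c N) ->
  exists L : {linear L2 R -> L2 R}, bounded_operator L2dot L /\
    forall v i, hat (L v) i.+1 = dconv t (hat v) i.+1.
Proof.
move=> tM; pose M' := `|M|.
have tM' (v : L2 R) N : \sum_(i < N) sqmod (dconv t (hat v) i.+1) <= M' * nrm2 L2dot v.
  rewrite -(energy_ord (dconv t (hat v))) (le_trans (tM _ _))//.
  rewrite (le_trans (ler_wpM2r (energy_ge0 _ _) (ler_norm M)))// ler_wpM2l//.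
  by rewrite energy_ord; exact: (bessel linl dotC dot_ge0 ons v N).
have [L0 L0E] : exists L0 : L2 R -> L2 R,
    forall v i, hat (L0 v) i.+1 = dconv t (hat v) i.+1.
  pose w v := cid (@riesz_fischer R (fun i => dconv t (hat v) i.+1) _ (tM' v)).
  by exists (fun v => projT1 (w v)) => v i; case: (w v) => /= u [].
have lin : linear L0.
  move=> z u v; apply: hat_inj => i; rewrite [RHS]hat_lin !L0E -dconv_linr.
  by apply: dconv_local => k _; exact: hat_lin.
pose L : {linear L2 R -> L2 R} := HB.pack L0 (GRing.isLinear.Build _ _ _ _ L0 lin).
exists L; split => [|v i]; last exact: L0E.
apply: (@bounded_of_nrm2 _ M') => v; apply: nrm2_le_hat => N.
by under eq_bigr do rewrite L0E.
Qed.

End operators.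

(** * Dilates, Riesz bases and multipliers *)

Section dilates.
Context {R : realType}.
Local Notation C := R[i].
Local Notation linl := (@L2dot_linl R).
Local Notation dotC := (@L2dotC R).
Local Notation dot_ge0 := (@L2dot_ge0 R).
Local Notation ons := (@sine_orthonormal R).
Variable phi : L2fun R.
Hypothesis phi1 : sine_coef phi 1 = 1.

Let a := sine_coef phi.
Let f (n : nat) : L2 R := \pi_(L2 R) (dilate phi n.+1).
Let Sphi := dirichlet_series a.

Lemma sine_coef_l2 : l2 a.
Proof.
exists (nrm2 L2dot (\pi_(L2 R) phi)) => N.
rewrite -/(energy a N); apply: le_trans (energy_mono a (leqnSn N)) _.
rewrite energy_ord; under eq_bigr => i _ do rewrite /a -hat_pi.
exact: (bessel linl dotC dot_ge0 ons).
Qed.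

Let a2 := sine_coef_l2.

(** Synthesis from the dilates acts on coefficients as the convolution by those
    of phi, that is the multiplication by Sphi on Dirichlet series. *)
Lemma hat_dilate_combination (c : nat -> C) N m : (m < N)%N ->
  hat (\sum_(i < N) c i.+1 *: f i) m.+1 = dconv c a m.+1.
Proof.
move=> mN; rewrite /hat (dot_suml linl).
under eq_bigr => i _ do rewrite (dotZl linl) -/(hat _ _) hat_dilate.
rewrite /dconv big_add1 /= big_mkord.
rewrite [RHS]big_mkcond (big_ord_widen N (fun i =>
  if (i.+1 %| m.+1)%N then c i.+1 * a (m.+1 %/ i.+1)%N else 0))//=.
rewrite [RHS]big_mkcond; apply: eq_bigr => i _.
case: ifP => [im|_]; last by rewrite mulr0 if_same.
by rewrite ltnS -ltnS (dvdn_leq _ im).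
Qed.

Section riesz_to_multipliers.
Hypothesis rb : riesz_basis L2dot f.

(** Let L send the dilates to an orthonormal basis g and let K be its inverse.
    A combination of the dilates is K applied to the same combination of g,
    which gives the bound.  Conversely, c being the coefficients of a vector v,
    let d be the coefficients of L v in the basis g.  Then v = K (L v) is the
    limit of the combinations of the dilates with coefficients d. *)
Lemma riesz_bounds : exists M, 0 <= M /\
  (forall (c : nat -> C) N, energy (dconv c a) N <= M * energy c N) /\
  (forall c : nat -> C, l2 c -> exists2 d, l2 d &
     forall n, (0 < n)%N -> dconv d a n = c n).
Proof.
case: rb => L [Lb [K [Kb LK KL]]] [og dense].
have [M [M0 hM]] := nrm2_of_bounded Kb; exists M; split => //.
have Kcomb N (d : nat -> C) : K (\sum_(i < N) d i *: L (f i)) = \sum_(i < N) d i *: f i.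
  by rewrite linear_sum; apply: eq_bigr => i _; rewrite linearZ LK.
split.
  move=> c N; case: N => [|N]; first by rewrite /energy !big_geq// mulr0.
  rewrite !energy_ord.
  under eq_bigr => i _ do rewrite -(@hat_dilate_combination c N i (ltn_ord i)).
  apply: le_trans (bessel linl dotC dot_ge0 ons _ N) _.
  rewrite -(Kcomb N (fun i => c i.+1)) (le_trans (hM _))//.
  by rewrite (nrm2_combination linl dotC og N (fun i => c i.+1)).
move=> c [B cB].
have [v [vc _]] : exists v : L2 R, (forall i, hat v i.+1 = c i.+1) /\ True.
  have [|v [vc _]] := @riesz_fischer R (fun i => c i.+1) B.
    by move=> N; rewrite -energy_ord; exact: cB.
  by exists v.
pose d n := L2dot (L v) (L (f n.-1)).
exists d.
  exists (nrm2 L2dot (L v)) => N; rewrite -/(energy d N).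
  apply: le_trans (energy_mono d (leqnSn N)) _.
  by rewrite energy_ord; exact: (bessel linl dotC dot_ge0 og).
case=> // m _; rewrite -vc; apply/esym/eqP; rewrite -subr_eq0; apply/eqP/sqmod_eq0.
apply/le_anti/andP; split; last exact: sqmod_ge0.
apply/ler_addgt0Pr => e e0; rewrite add0r.
have M1 : 0 < M + 1 by rewrite ltr_wpDl.
have e1 : 0 < e / (M + 1) by rewrite divr_gt0.
have s0 : 0 < Num.sqrt (e / (M + 1)) by rewrite sqrtr_gt0.
have [n [c' hc']] := dense (L v) _ s0.
have {}hc' : nrm2 L2dot (L v - \sum_(i < n) c' i *: L (f i)) <= e / (M + 1).
  by move: hc'; rewrite hnormE ltr_sqrt// => /ltW.
(* the combination must reach the index m for its coefficient to be exact *)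
pose N := maxn n m.+1; have mN : (m < N)%N by rewrite leq_maxr.
have nN : (n <= N)%N by rewrite leq_maxl.
have approx : nrm2 L2dot (L v - \sum_(i < N) d i.+1 *: L (f i)) <= e / (M + 1).
  apply: le_trans hc'; rewrite (nrm2_sub_combination linl dotC og (L v) N (fun i => d i.+1)).
  rewrite (nrm2_sub_combination linl dotC og) [X in _ + X - _]big1 => [|i _]; last first.
    by rewrite subrr sqmod0.
  rewrite addr0 -(subnKC nN) big_split_ord /=.
  have h1 : 0 <= \sum_(i < n) sqmod (L2dot (L v) (L (f i)) - c' i).
    by apply: sumr_ge0 => i _; exact: sqmod_ge0.
  have h2 : 0 <= \sum_(i < N - n) sqmod (L2dot (L v) (L (f (n + i)%N))).
    by apply: sumr_ge0 => i _; exact: sqmod_ge0.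
  lra.
have -> : hat v m.+1 - dconv d a m.+1 = hat (v - \sum_(i < N) d i.+1 *: f i) m.+1.
  by rewrite /hat (dotBl linl) -/(hat _ _) -/(hat _ _) hat_dilate_combination.
apply: le_trans (hat_sqmod_le _ _) _.
have -> : v - \sum_(i < N) d i.+1 *: f i = K (L v - \sum_(i < N) d i.+1 *: L (f i)).
  by rewrite linearB LK (Kcomb N (fun i => d i.+1)).
apply: le_trans (hM _) _; apply: le_trans (ler_wpM2l M0 approx) _.
by rewrite mulrCA ler_piMr ?(ltW e0)// ler_pdivrMr// mul1r lerDl.
Qed.

Lemma riesz_multipliers : multipliers Sphi /\ multipliers (fun s => (Sphi s)^-1).
Proof.
have [M [M0 [ub inv]]] := riesz_bounds.
have [b b2 ba] := inv _ (l2_dirac_seq 1).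
have l2M c : l2 c -> l2 (dconv c a).
  move=> [B hB]; exists (M * B) => N.
  exact: le_trans (ub c N) (ler_wpM2l M0 (hB N)).
have eqD (c d : nat -> C) (s : C) : (forall n, (0 < n)%N -> c n = d n) -> dirichlet_series c s = dirichlet_series d s.
  by move=> cd; apply: eq_sumC => n n0; rewrite cd.
have bS s : half_plane s -> dirichlet_series b s * Sphi s = 1.
  by move=> hs; rewrite (dirichlet_mul b2 a2 hs) (eqD _ _ _ ba) dirichlet_dirac1.
have S0 s : half_plane s -> Sphi s != 0.
  by move=> /bS h; apply/eqP => S0; move: h; rewrite S0 mulr0 => /esym/eqP; rewrite oner_eq0.
have hol : holomorphic Sphi by exact: dirichlet_holomorphic.
split; split; first exact: hol.
- move=> g [c c2 gE]; exists (dconv c a); first exact/l2P/l2M/l2P.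
  move=> s hs; rewrite gE// mulrC; apply: dirichlet_mul => //; exact/l2P.
- move=> s hs; apply: (@derivableV C C^o Sphi s 1); [exact: S0|exact: hol].
- move=> g [c /l2P c2 gE]; have [d d2 da] := inv c c2; exists d; first exact/l2P.
  move=> s hs; rewrite gE//; apply: (mulfI (S0 s hs)).
  rewrite mulrA mulfV ?S0// mul1r mulrC (dirichlet_mul d2 a2 hs).
  by apply: eqD => n n0; rewrite da.
Qed.

End riesz_to_multipliers.

Section multipliers_to_riesz.
Hypothesis mS : multipliers Sphi.
Hypothesis mV : multipliers (fun s => (Sphi s)^-1).

(** The constant 1 belongs to the dirichlet_space, so that 1/Sphi is a Dirichlet
    series.  Its product with Sphi equals 1 far to the right, where Sphi does not
    vanish since its first coefficient is 1, hence equals 1 everywhere by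
    uniqueness of the coefficients. *)
Lemma reciprocal_series : exists2 b, l2 b &
  (forall s, half_plane s -> (Sphi s)^-1 = dirichlet_series b s) /\
  (forall s, half_plane s -> Sphi s * dirichlet_series b s = 1).
Proof.
have one : dirichlet_space (fun _ : C => 1).
  exists (dirac_seq 1); first exact/l2P/l2_dirac_seq.
  by move=> s _; rewrite dirichlet_dirac1.
have [b /l2P b2 bE] := mV.2 _ one; exists b => //.
have bE' s : half_plane s -> (Sphi s)^-1 = dirichlet_series b s.
  by move=> hs; rewrite -bE// mulr1.
split=> // s hs.
have h1 : half_plane (1%:C : C) by rewrite /half_plane /=; lra.
have [M aM] := l2_dterm a2 h1.
have [t0 ht] := dirichlet_to_1 aM phi1.
have ab n : (0 < n)%N -> dconv a b n = dirac_seq 1 n.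
  apply: (@dirichlet_inj R _ _ (Num.max t0 0)).
  - exact: dconv_half_plane_abs.
  - exact/l2_half_plane_abs/l2_dirac_seq.
  move=> t; rewrite ge_max => /andP[t0t tp]; have hs' := half_plane_1D tp.
  rewrite -(dirichlet_mul a2 b2 hs') dirichlet_dirac1 -bE'// mulfV//.
  exact: ht.
rewrite (dirichlet_mul a2 b2 hs) -(dirichlet_dirac1 s).
by apply: eq_sumC => n n0; rewrite /dterm ab.
Qed.

(** Multiplication of functions is turned into convolution of coefficients by
    uniqueness of the latter. *)
Lemma multiplier_l2 m t : multipliers m -> l2 t ->
  (forall s, half_plane s -> m s = dirichlet_series t s) ->
  forall c : nat -> C, l2 c -> l2 (dconv t c).
Proof.
move=> [_ mm] t2 mt c c2.
have [|c' /l2P c'2 cE] := mm (dirichlet_series c).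
  by exists c => //; exact/l2P.
apply: (eq_l2 _ c'2) => n n0.
apply: (@dirichlet_inj R _ _ 0) n n0.
- exact: l2_half_plane_abs.
- exact: dconv_half_plane_abs.
move=> t' /half_plane_1D hs; rewrite -cE// mt//.
exact: dirichlet_mul.
Qed.

(** The convolutions by the coefficients of Sphi and of 1/Sphi are bounded and
    inverse to each other; the former sends the sine functions to the
    dilates. *)
Lemma multipliers_riesz : riesz_basis L2dot f.
Proof.
have [b b2 [bE ab]] := reciprocal_series.
have [MA hA] := dconv_bounded (multiplier_l2 mS a2 (fun s _ => erefl)).
have lb := multiplier_l2 mV b2 bE; have la := multiplier_l2 mS a2 (fun s _ => erefl).
have [MB hB] := dconv_bounded lb.
have [L [Lb LE]] := convolution_operator hB.
have [K [Kb KE]] := convolution_operator hA.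
have inverse t u : l2 t -> l2 u -> (forall c : nat -> C, l2 c -> l2 (dconv u c)) ->
    (forall s, half_plane s -> dirichlet_series t s * dirichlet_series u s = 1) ->
    forall c : nat -> C, l2 c -> forall n, (0 < n)%N -> dconv t (dconv u c) n = c n.
  move=> t2 u2 lu tu c c2; apply: (@dirichlet_inj R _ _ 0).
  - by apply: dconv_half_plane_abs => //; exact: lu.
  - exact: l2_half_plane_abs.
  move=> x /half_plane_1D hs; rewrite -(dirichlet_mul t2 (lu _ c2) hs).
  by rewrite -(dirichlet_mul u2 c2 hs) mulrA tu// mul1r.
have hat_l2 (v : L2 R) : l2 (hat v).
  exists (nrm2 L2dot v) => N; rewrite -/(energy (hat v) N).
  apply: le_trans (energy_mono _ (leqnSn N)) _; rewrite energy_ord.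
  exact: (bessel linl dotC dot_ge0 ons).
have KL : cancel L K.
  move=> v; apply: hat_inj => i; rewrite KE.
  rewrite (@dconv_local _ a (hat (L v)) (dconv b (hat v))).
    by rewrite (inverse a b).
  by case=> // k _; rewrite LE.
have LK : cancel K L.
  move=> v; apply: hat_inj => i; rewrite LE.
  rewrite (@dconv_local _ b (hat (K v)) (dconv a (hat v))).
    by rewrite (inverse b a)// => s hs; rewrite mulrC ab.
  by case=> // k _; rewrite KE.
have Ke n : K (esine n.+1) = f n.
  apply: hat_inj => i; rewrite KE hat_dilate.
  rewrite -(@sum_mul_eq _ a n.+1 i.+1 i.+2) ?leqnn// /dconv big_mkcond [RHS]big_mkcond.
  apply: eq_big_nat => j /andP[j0 _]; rewrite mulnC.
  case: ifP => [/dvdnP[q iq]|nd]; last first.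
    by case: eqP => // jn; rewrite -jn dvdn_mulr in nd.
  rewrite iq mulnK// [(q * j)%N]mulnC eqn_pmul2l//.
  case: q iq => [//|q _]; rewrite hat_esine//.
  by case: eqP; rewrite ?mulr1 ?mulr0.
exists L; first by split => //; exists K; split.
have Lf n : L (f n) = esine n.+1 by rewrite -Ke LK.
split => [i j|v eps eps0]; first by rewrite !Lf; exact: ons.
have e2 : 0 < (eps / 2) ^+ 2 by rewrite exprn_gt0// divr_gt0.
have [N /(_ N (leqnn _)) hN] := sine_expansion v e2.
exists N, (fun i => hat v i.+1); under eq_bigr do rewrite Lf.
rewrite hnormE (@le_lt_trans _ _ (eps / 2))//.
  have h0 : 0 <= eps / 2 by rewrite divr_ge0// ltW.
  by rewrite -[leRHS](ger0_norm h0) -sqrtr_sqr ler_sqrt ?sqr_ge0.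
by rewrite ltr_pdivrMr// ltr_pMr// ltr1n.
Qed.

End multipliers_to_riesz.
End dilates.

(* In the inverse, 0^-1 = 0 by convention; this is harmless: 1/Sphi would not be
   holomorphic at a zero of Sphi. *)
Theorem theorem5p2 (R : realType) (phi : L2fun R)
  (phi1 : sine_coef phi 1 = 1) :
  let Sphi := dirichlet_series (sine_coef phi) in
  riesz_basis L2dot (fun n : nat => \pi_(L2 R) (dilate phi n.+1)) <->
  multipliers Sphi /\ multipliers (fun s => (Sphi s)^-1).
Proof.
split; first exact: riesz_multipliers.
by move=> [mS mV]; exact: multipliers_riesz.
Qed.
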